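(* Assume hypotheses (i)–(iv) listed in the context on $M,A,V_0,f,\rho,\kappa,\xi_0,\dot\xi_0$. Then there exists a solution $x(t),\xi(\nu,t)$, $t\in\mathbb{R}$, of the equations $$\frac{d}{dt}\frac{\partial \mathcal{L}_0}{\partial\dot x}-\frac{\partial \mathcal{L}_0}{\partial x}=\frac{\partial f}{\partial x}\int\kappa\,\xi\,d\nu,\qquad \rho\,(\ddot\xi+\nu^2\xi)=\kappa f(x),$$ with initial values $x|_{t=0}=x_0$, $\xi|_{t=0}=\xi_0(\nu)$, $\dot x|_{t=0}=\dot x_0$, $\dot\xi|_{t=0}=\dot\xi_0(\nu)$. Moreover, the energy $E$ (defined in the context) is finite and constant along the solution, and the functions $$\psi(t)=f(x(t)),\qquad \mathcal{E}(t)=\int\rho(\nu)\big(\nu^2\xi^2(\nu,t)+\dot\xi^2(\nu,t)\big)\,d\nu$$ are bounded.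
   Context: Notation: $\int$ means $\int_{-\infty}^{+\infty}$; dots denote $d/dt$. $M$ is a smooth $m$-dimensional manifold with local coordinates $x=(x_1,\dots,x_m)$; $\mathcal{L}_0(x,\dot x)=\frac12\langle A(x)\dot x,\dot x\rangle-V_0(x)$ is a Lagrangian on $M$ ($A$ determines a Riemannian metric on $M$, $V_0:M\to\mathbb{R}$), and $f:M\to\mathbb{R}$. $\rho,\kappa,\xi_0,\dot\xi_0$ are real functions of $\nu\in\mathbb{R}$; the unknown $\xi(\nu,t)$ is real-valued; $x_0\in M$ and $\dot x_0$ is a tangent vector at $x_0$. The function $\kappa/\sqrt\rho$ is extended by zero to $\mathbb{R}\setminus\operatorname{supp}\rho$ (so $\kappa^2/\rho$ means $(\kappa/\sqrt\rho)^2$). Energy: $$E(x,\xi,\dot x,\dot\xi)=\tfrac12\langle A\dot x,\dot x\rangle+\tfrac12\int\rho\dot\xi^2\,d\nu+V_0(x)+\tfrac12\int\rho\nu^2\xi^2\,d\nu-f(x)\int\kappa\xi\,d\nu .$$ Hypotheses: (i) $A,V_0,f$ are smooth, $A$ is positive definite, $\rho\ge0$, and $\operatorname{supp}\kappa\subset\operatorname{supp}\rho$. (ii) The integrals $\int\frac{\kappa^2}{\rho}\,d\nu$ and $K:=\int\frac{\kappa^2}{\rho\nu^2}\,d\nu$ are finite. (iii) The effective potential $V(x)=V_0(x)-Kf^2(x)/2$ is bounded from below; moreover, either $f$ is bounded or $V\to\infty$ as $|f|\to\infty$; the sets $M_E=\{x\in M: V\le E\}$ are compact. (iv) $\int\rho\,(\dot\xi_0^2+\nu^2\xi_0^2)\,d\nu<\infty$.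 *)

(* Defs.v *)
From HB Require Import structures.
From mathcomp Require Import all_boot all_order all_algebra.
From mathcomp Require Import all_classical all_reals all_analysis.

Set Implicit Arguments.
Unset Strict Implicit.
Unset Printing Implicit Defensive.

Import Order.TTheory GRing.Theory Num.Theory.
Import numFieldNormedType.Exports.
Local Open Scope ring_scope.
Local Open Scope classical_set_scope.

(* Class C^k on an open set [U], by iterated partial derivatives.  Since [U] is
   open, continuity and derivability at the points of [U] only depend on the
   values of [g] in [U]; [g] may be arbitrary elsewhere. *)
Fixpoint class_C (R : realType) (m : nat) (V : normedModType R) (k : nat)
    (U : set 'rV[R]_m) (g : 'rV[R]_m -> V) : Prop :=
  (forall u, U u -> {for u, continuous g}) /\
  if k is k'.+1 then
    forall i : 'I_m,
      (forall u, U u -> derivable g u (delta_mx 0 i)) /\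
      class_C k' U (fun u => 'D_(delta_mx 0 i) g u)
  else True.

Definition smooth_on (R : realType) (m : nat) (V : normedModType R)
    (U : set 'rV[R]_m) (g : 'rV[R]_m -> V) : Prop :=
  forall k, class_C k U g.

(* An m-dimensional manifold given by a smooth atlas (not required to be
   maximal).  [chart_map c] is only meaningful on [chart_dom c], and its inverse
   [chart_inv c] on the image of [chart_dom c]. *)
Record manifold (R : realType) (m : nat) := Manifold {
  carrier :> topologicalType ;
  chart : Type ;
  chart_dom : chart -> set carrier ;
  chart_map : chart -> carrier -> 'rV[R]_m ;
  chart_inv : chart -> 'rV[R]_m -> carrier ;
  manifold_hausdorff : hausdorff_space carrier ;
  manifold_second_countable : @second_countable carrier ;
  chart_dom_cover : forall x, exists c, chart_dom c x ;
  chart_dom_open : forall c, open (chart_dom c) ;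
  chart_img_open : forall c, open (chart_map c @` chart_dom c) ;
  chart_mapK : forall c x, chart_dom c x -> chart_inv c (chart_map c x) = x ;
  chart_map_continuous : forall c x, chart_dom c x ->
    {for x, continuous (chart_map c)} ;
  chart_inv_continuous : forall c u, (chart_map c @` chart_dom c) u ->
    {for u, continuous (chart_inv c)} ;
  transition_smooth : forall c d,
    smooth_on (chart_map c @` (chart_dom c `&` chart_dom d))
      (chart_map d \o chart_inv c)
}.

Definition smooth_fun (R : realType) (m : nat) (M : manifold R m)
    (g : M -> R) : Prop :=
  forall c : chart M, smooth_on (chart_map c @` chart_dom c) (g \o chart_inv c).

Definition quad (R : realType) (m : nat) (B : 'M[R]_m) (w : 'rV[R]_m) : R :=
  (w *m B *m w^T) 0 0.

(* [A c u] is the matrix of the metric at the point of coordinates [u] in the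
   chart [c].  Tangent vectors are rows, so under a change of chart with
   Jacobian [J] (in the library's convention ['d tau u w = w *m 'J tau u])
   coordinates transform as [w' = w *m J]. *)
Record riemannian (R : realType) (m : nat) (M : manifold R m)
    (A : chart M -> 'rV[R]_m -> 'M[R]_m) : Prop := Riemannian {
  metric_smooth : forall c, smooth_on (chart_map c @` chart_dom c) (A c) ;
  metric_sym : forall c u, (chart_map c @` chart_dom c) u ->
    (A c u)^T = A c u ;
  metric_posdef : forall c u, (chart_map c @` chart_dom c) u ->
    forall w, w != 0 -> 0 < quad (A c u) w ;
  metric_tensor : forall c d u,
    (chart_map c @` (chart_dom c `&` chart_dom d)) u ->
    let tau := chart_map d \o chart_inv c in
    A c u = 'J tau u *m A d (tau u) *m ('J tau u)^T
}.

Section System.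
Variables (R : realType) (m : nat) (M : manifold R m).
Variables (A : chart M -> 'rV[R]_m -> 'M[R]_m) (V0 f : M -> R).
Variables (rho kappa : R -> R).

Let mu := @lebesgue_measure R.

Definition supp (g : R -> R) : set R := closure [set nu | g nu != 0].

(* Extended-real quotients: [r / 0 = +oo] for [r > 0], and [0 / 0 = 0].  Hence
   [kappa^2 / rho] is 0 off [supp rho] when [supp kappa `<=` supp rho], and its
   integral can only be finite if kappa vanishes almost everywhere on the zero
   set of rho. *)
Definition kappa2_rho (nu : R) : \bar R :=
  ((kappa nu ^+ 2)%:E / (rho nu)%:E)%E.

Definition kappa2_rho_nu2 (nu : R) : \bar R :=
  ((kappa nu ^+ 2)%:E / (rho nu * nu ^+ 2)%:E)%E.

Definition coupling_const : R := fine (\int[mu]_nu kappa2_rho_nu2 nu)%E.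

Definition effective_potential (x : M) : R :=
  V0 x - coupling_const * f x ^+ 2 / 2.

Definition lagrangian (c : chart M) (u w : 'rV[R]_m) : R :=
  quad (A c u) w / 2 - V0 (chart_inv c u).

(* Energy of the state with position and velocity of coordinates [u] and [w] in
   the chart [c], and with oscillators in position [xi] and velocity [dxi]. *)
Definition energy (c : chart M) (u w : 'rV[R]_m) (xi dxi : R -> R) : \bar R :=
  ((quad (A c u) w / 2)%:E
   + 2^-1%:E * \int[mu]_nu (rho nu * dxi nu ^+ 2)%:E
   + (V0 (chart_inv c u))%:E
   + 2^-1%:E * \int[mu]_nu (rho nu * nu ^+ 2 * xi nu ^+ 2)%:E
   - (f (chart_inv c u))%:E * \int[mu]_nu (kappa nu * xi nu)%:E)%E.

(* The field equation at time [t], in every chart around [x t], with [F] the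
   value of the integral of [kappa * xi]. *)
Definition particle_equation (x : R -> M) (F : R) (t : R) : Prop :=
  forall c : chart M, chart_dom c (x t) ->
    let u := chart_map c \o x in
    [/\ derivable u t 1, derivable (derive1 u) t 1 &
      forall k : 'I_m,
        let e : 'rV[R]_m := delta_mx 0 k in
        let p := fun s => 'D_e (lagrangian c (u s)) (derive1 u s) in
        derivable p t 1 /\
        derive1 p t - 'D_e (fun y => lagrangian c y (derive1 u t)) (u t)
          = 'D_e (f \o chart_inv c) (u t) * F].

(* Twice differentiable solutions on the whole time axis; [xi nu t] is the
   position of the oscillator of frequency [nu] at time [t].  Where rho = 0 and
   kappa <> 0 the oscillator equation would read [0 = kappa * f], so it is
   imposed at every other [nu].  The frequencies left out form a null set as
   soon as [kappa^2 / rho] has a finite integral, and there are none if kappa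
   vanishes wherever rho does. *)
Record solution (x : R -> M) (xi : R -> R -> R) : Prop := Solution {
  sol_continuous : continuous x ;
  sol_integrable : forall t,
    mu.-integrable [set: R] (fun nu => (kappa nu * xi nu t)%:E) ;
  sol_particle : forall t,
    particle_equation x (\int[mu]_nu (kappa nu * xi nu t)) t ;
  sol_derivable : forall nu t,
    derivable (xi nu) t 1 /\ derivable (derive1 (xi nu)) t 1 ;
  sol_oscillator : forall nu, ~ (rho nu = 0 /\ kappa nu <> 0) -> forall t,
    rho nu * (derive1n 2 (xi nu) t + nu ^+ 2 * xi nu t) = kappa nu * f (x t)
}.

End System.

(* Main.v *)
Require Import Defs.
From HB Require Import structures.
From mathcomp Require Import all_boot all_order all_algebra.
From mathcomp Require Import all_classical all_reals all_analysis.
From mathcomp Require Import measurable_realfun.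
From mathcomp Require Import ring lra.

Import Order.TTheory GRing.Theory Num.Theory.
Import numFieldNormedType.Exports.
Local Open Scope ring_scope.
Local Open Scope classical_set_scope.

(** The oscillators can be solved explicitly in terms of the interaction
    [phi = f \o x]: by variation of constants, uniformly in the frequency, each of
    them is the sum of its free motion and of a convolution of [phi] with a sine.
    Substituting into the integral of [kappa * xi] gives a force [field_force phi] on
    the particle which depends on the whole past of [phi] but is Lipschitz and causal
    in it ([force_dist]); the two integrals that are assumed finite are exactly what
    these estimates need. The system thus becomes a single functional differential
    equation for the position and momentum of the particle.

    In a chart this equation has a local solution by a contraction argument
    ([picard], [local_flow]). Newton's equations, written for the momentum, do not
    depend on the chart ([law_covariant]), so that local solutions are motions on the
    manifold and can be glued as soon as they meet with the same velocity
    ([solves_glue]).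

    The continuation to all times rests on the energy. It is conserved
    ([energy_conserved]): the work done by the interaction on the particle is taken
    from the field. Completing the square in each oscillator ([energy_ge]) shows that
    it is at least the kinetic energy of the particle plus its effective potential
    ([energy_split]). Hence the particle remains in a compact sublevel set of the
    effective potential, with bounded kinetic energy and bounded [f]; by Cauchy-Schwarz
    its momenta remain bounded in charts. A covering argument over the sublevel set
    and over balls of momenta then gives a step of continuation that depends only on
    the energy and on an upper bound for the time already elapsed ([step_uniform]).
    Such steps reach every positive time ([continue_forever]), and reversal of time
    gives the negative ones ([global_motion]).

    The bound on [f] along the motion comes from the same compactness, and the
    oscillator energy is bounded because half of it absorbs the interaction energy
    ([field_energy_le]). *)

Set Implicit Arguments.
Unset Strict Implicit.
Unset Printing Implicit Defensive.

(** * Curves and primitives on the line *)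

Section RealCalculus.
Variable R : realType.

Definition between (s t r : R) := Num.min s t <= r <= Num.max s t.

Lemma between_abs (t r : R) : between 0 t r -> `|r| <= `|t|.
Proof.
rewrite /between; case: (leP 0 t) => t0 /andP[rl ru].
  by rewrite !ger0_norm //.
by rewrite (ltr0_norm t0) ler0_norm ?lerN2.
Qed.

Lemma mvt_le (a b : R) (f df : R -> R) (M : R) : a <= b ->
    (forall x, a <= x <= b -> is_derive x 1 f (df x)) ->
    (forall x, a <= x <= b -> `|df x| <= M) ->
  `|f b - f a| <= M * (b - a).
Proof.
move=> ab dfP dfM.
have cf : {within `[a, b], continuous f}.
  apply: derivable_within_continuous => x.
  by rewrite in_itv /= => /dfP[].
have dfo x : x \in `]a, b[%R -> is_derive x 1 f (df x).
  by rewrite in_itv /= => /andP[ax xb]; apply: dfP; rewrite !ltW.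
have [c + ->] := MVT_segment ab dfo cf.
rewrite in_itv /= => /dfM cM.
by rewrite normrM (ger0_norm (_ : 0 <= b - a)) ?subr_ge0 // ler_wpM2r // subr_ge0.
Qed.

Lemma mvt_between (s t : R) (f df : R -> R) (M : R) :
    (forall x, between s t x -> is_derive x 1 f (df x)) ->
    (forall x, between s t x -> `|df x| <= M) ->
  `|f t - f s| <= M * `|t - s|.
Proof.
rewrite /between => dfP dfM; case: (lerP s t) dfP dfM => st dfP dfM.
  exact: (mvt_le st dfP).
rewrite distrC; exact: (mvt_le (ltW st) dfP).
Qed.

Lemma derive0_between (s t : R) (f : R -> R) :
  (forall x, between s t x -> is_derive x 1 f 0) -> f t = f s.
Proof.
move=> dfP; apply/eqP; rewrite -subr_eq0 -normr_le0.
have := @mvt_between s t f (cst 0) 0 dfP.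
rewrite mul0r; apply => x _.
by rewrite normr0.
Qed.

Definition partial_int (h : R -> R) (a t : R) : R := \int[lebesgue_measure]_(r in `[a, t]) h r.

Lemma partial_int_derive (h : R -> R) (a t : R) : continuous h -> a < t ->
  is_derive t 1 (partial_int h a) (h t).
Proof.
move=> ch at_.
have [] := @continuous_FTC1_closed R h a t (t + 1).
- by rewrite ltrDl.
- apply: continuous_compact_integrable; first exact: segment_compact.
  exact: continuous_subspaceT.
- exact: at_.
- exact: ch.
by rewrite derive1E => dh eh; apply: DeriveDef.
Qed.

(** The primitive of [h] that vanishes at 0, as a difference of two integrals
    over segments starting at a point to the left of both 0 and [t], so that no
    oriented integral is needed. *)
Definition prim (h : R -> R) (t : R) : R :=
  partial_int h (Num.min t 0 - 1) t - partial_int h (Num.min t 0 - 1) 0.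

Lemma prim0 (h : R -> R) : prim h 0 = 0.
Proof. by rewrite /prim subrr. Qed.

Lemma prim_derive (h : R -> R) (t : R) : continuous h -> is_derive t 1 (prim h) (h t).
Proof.
move=> ch.
pose a := Num.min t 0 - 2.
have at_ : a < t by rewrite /a; case: (leP t 0); lra.
have a0 : a < 0 by rewrite /a; case: (leP t 0); lra.
apply: (@near_eq_is_derive _ _ _ (fun x : R => partial_int h a x - partial_int h a 0)).
  have : \forall x \near t, t - 1 < x.
    by apply: lt_nbhsr; rewrite ltrBlDr ltrDl.
  apply: filterS => x tx.
  have ax : a < Num.min x 0 - 1.
    by rewrite /a; case: (leP t 0); case: (leP x 0); lra.
  have [xm m0] : Num.min x 0 <= x /\ Num.min x 0 <= 0.
    by rewrite !ge_min !lexx orbT.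
  have := @derive0_between 0 x
    (partial_int h a \- partial_int h (Num.min x 0 - 1)).
  rewrite /= /prim => H.
  suff : partial_int h a x - partial_int h (Num.min x 0 - 1) x =
         partial_int h a 0 - partial_int h (Num.min x 0 - 1) 0 by lra.
  apply: H => y.
  rewrite /between minC => /andP[yl yu].
  apply: (is_derive_eq _ (subrr (h y))).
  by apply: is_deriveB; apply: partial_int_derive => //; lra.
rewrite -[X in is_derive _ _ _ X]subr0.
by apply: is_deriveB; apply: partial_int_derive.
Qed.

Lemma derivable1_continuous (V : normedModType R) (f : R -> V) (t : R) :
  derivable f t 1 -> {for t, continuous f}.
Proof.
by move=> df; apply: differentiable_continuous; exact/derivable1_diffP.
Qed.

Lemma prim_dist (h1 h2 : R -> R) (t e : R) : continuous h1 -> continuous h2 ->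
    (forall r, between 0 t r -> `|h1 r - h2 r| <= e) ->
  `|prim h1 t - prim h2 t| <= e * `|t|.
Proof.
move=> c1 c2 H.
have := @mvt_between 0 t (prim h1 \- prim h2) (h1 \- h2) e.
rewrite /= !prim0 subrr !subr0; apply => // x _.
by apply: is_deriveB; exact: prim_derive.
Qed.

Lemma prim_unique (h H : R -> R) : continuous h -> H 0 = 0 ->
  (forall t : R, is_derive t 1 H (h t)) -> H = prim h.
Proof.
move=> ch H0 dH; apply/funext => t.
have := @derive0_between 0 t (H \- prim h).
rewrite /= H0 prim0 subrr => E; apply/eqP; rewrite -subr_eq0; apply/eqP/E => x _.
apply: (is_derive_eq _ (subrr (h x))).
by apply: is_deriveB; exact: prim_derive.
Qed.

Lemma is_derive_mulr (c t : R) : is_derive t 1 (fun s : R => s * c) c.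
Proof.
have H := @is_deriveM R R id (cst c) t 1 1 0 (is_derive_id _ _) (is_derive_cst _ _ _).
by apply: (is_derive_eq H); rewrite scaler0 add0r; exact: mulr1.
Qed.

Lemma mx_norm_le m n (A : 'M[R]_(m, n)) (e : R) : 0 <= e ->
  (forall i j, `|A i j| <= e) -> `|A| <= e.
Proof.
move=> e0 H; rewrite [leLHS]/Num.Def.normr /= mx_normrE.
by apply: bigmax_le => // -[i j] _; exact: H.
Qed.

Lemma mx_entry_le m n (A : 'M[R]_(m, n)) i j : `|A i j| <= `|A|.
Proof.
by rewrite [leRHS]/Num.Def.normr /= mx_normrE; exact: (le_bigmax _ _ (i, j)).
Qed.

Lemma is_derive_mx (V : normedModType R) m n (A : V -> 'M[R]_(m, n)) dA (t v : V) :
  is_derive t v A dA <->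
  (forall i j, is_derive t v (fun s => A s i j) (dA i j)).
Proof.
split=> [[dAt <-] i j|H].
  apply: DeriveDef; first exact: (derivable_mxP _ _ _).1.
  by rewrite derive_mx // mxE.
have dAt : derivable A t v by apply/derivable_mxP => i j; case: (H i j).
apply: DeriveDef => //; rewrite derive_mx //; apply/matrixP => i j.
by rewrite mxE; case: (H i j).
Qed.

Lemma mx_continuousP (T : topologicalType) m n (A : T -> 'M[R]_(m, n)) (t : T) :
  (forall i j, {for t, continuous (fun s => A s i j)}) -> {for t, continuous A}.
Proof.
move=> H; apply/cvgrPdist_le => e e0.
have : \forall s \near t, forall ij : 'I_m * 'I_n,
    `|A t ij.1 ij.2 - A s ij.1 ij.2| <= e.
  by apply: filter_forall => -[i j]; move/cvgrPdist_le: (H i j) => /(_ e e0).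
apply: filterS => s Hs; apply: mx_norm_le => [|i j]; first exact: ltW.
by have := Hs (i, j); rewrite !mxE.
Qed.

Definition mx_prim m n (h : R -> 'M[R]_(m, n)) (t : R) : 'M[R]_(m, n) :=
  \matrix_(i, j) prim (fun s => h s i j) t.

Lemma entry_continuous (T : topologicalType) m n (h : T -> 'M[R]_(m, n)) (t : T) i j :
  {for t, continuous h} -> {for t, continuous (fun s => h s i j)}.
Proof.
move=> ch; apply: (@continuous_comp _ _ _ h (fun A => A i j)) => //.
exact: coord_continuous.
Qed.

Lemma mx_prim_derive m n (h : R -> 'M[R]_(m, n)) (t : R) : continuous h ->
  is_derive t 1 (mx_prim h) (h t).
Proof.
move=> ch; apply/is_derive_mx => i j.
have -> : (fun s => mx_prim h s i j) = prim (fun s => h s i j).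
  by apply/funext => s; rewrite mxE.
by apply: prim_derive => s; exact/entry_continuous/ch.
Qed.

Lemma mx_mvt_between m n (f df : R -> 'M[R]_(m, n)) (s t M : R) : 0 <= M ->
    (forall x, between s t x -> is_derive x 1 f (df x)) ->
    (forall x, between s t x -> `|df x| <= M) ->
  `|f t - f s| <= M * `|t - s|.
Proof.
move=> M0 dfP dfM; apply: mx_norm_le => [|i j]; first by rewrite mulr_ge0.
rewrite !mxE; apply: (@mvt_between s t (fun x => f x i j) (fun x => df x i j)).
  by move=> x /dfP /is_derive_mx.
by move=> x /dfM; apply: le_trans; exact: mx_entry_le.
Qed.

(** The difference quotients at [a] of the glued curve are, on either side, those
    of one of the two curves. *)
Lemma is_derive_glue (V : normedModType R) (f g : R -> V) (a : R) (d : V) :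
    is_derive a 1 f d -> is_derive a 1 g d -> f a = g a ->
  is_derive a 1 (fun s => if a <= s then g s else f s) d.
Proof.
move=> [df ef] [dg eg] fga.
set k := fun s : R => _.
suff cvk : (fun h : R => h^-1 *: (k (h *: 1 + a) - k a)) @ 0^' --> d.
  apply: DeriveDef; first by apply/cvg_ex; exists d.
  exact: cvg_lim cvk.
have cvf : (fun h : R => h^-1 *: (f (h *: 1 + a) - f a)) @ 0^' --> d.
  by rewrite -ef; exact: df.
have cvg' : (fun h : R => h^-1 *: (g (h *: 1 + a) - g a)) @ 0^' --> d.
  by rewrite -eg; exact: dg.
apply/cvgrPdist_le => e e0.
move/cvgrPdist_le: cvf => /(_ e e0); move/cvgrPdist_le: cvg' => /(_ e e0).
apply: filterS2 => h gh fh; rewrite /k lexx.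
by case: ifP => _ //; rewrite -fga.
Qed.

Lemma continuous_glue (T : topologicalType) (f g : R -> T) (a : R) :
  continuous f -> continuous g -> f a = g a ->
  continuous (fun s => if a <= s then g s else f s).
Proof.
move=> cf cg fga s; have [sa|as_|->] := ltgtP s a.
- have : f x @[x --> s] --> f s by exact: cf.
  rewrite /continuous_at ifN -?ltNge //; apply: cvg_trans; apply: near_eq_cvg.
  by have := lt_nbhsl sa; apply: filterS => x xa; rewrite ifN -?ltNge.
- have : g x @[x --> s] --> g s by exact: cg.
  rewrite /continuous_at ifT ?ltW //; apply: cvg_trans; apply: near_eq_cvg.
  by have := lt_nbhsr as_; apply: filterS => x xa; rewrite ifT ?ltW.
- rewrite /continuous_at lexx => A /= nA.
  have ga : \forall x \near a, A (g x) := cg a A nA.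
  have fa : \forall x \near a, A (f x) by have := cf a A; rewrite fga; exact.
  suff : \forall x \near a, A (if a <= x then g x else f x) by [].
  by move: ga fa; apply: filterS2 => x gx fx; case: ifP.
Qed.

(** Stopping time at [a] and [b] turns statements on a segment into statements on
    the whole line. *)
Definition clamp (a b t : R) : R := Num.min b (Num.max a t).

Lemma clamp_itv (a b t : R) : a <= b -> a <= clamp a b t <= b.
Proof. by move=> ab; rewrite /clamp le_min ab le_max lexx /= ge_min lexx. Qed.

Lemma clamp_id (a b t : R) : a <= t <= b -> clamp a b t = t.
Proof. by move=> /andP[a_t tb]; rewrite /clamp (max_idPr a_t) (min_idPr tb). Qed.

Lemma clamp_continuous (a b : R) : continuous (clamp a b).
Proof.
move=> t; apply: continuous_min; first exact: cvg_cst.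
by apply: continuous_max; [exact: cvg_cst|exact: cvg_id].
Qed.

End RealCalculus.

(** * Functions with continuous partial derivatives *)

Section FrechetFromPartials.
Variables (R : realType) (m : nat).
Local Notation E := 'rV[R]_m.
Local Notation e_ i := (delta_mx 0 i : 'rV[R]_m).

Lemma near_ball2 (V : normedModType R) (x : V) (P Q : V -> Prop) :
    (\forall y \near x, P y) -> (\forall y \near x, Q y) ->
  exists2 r : R, 0 < r & forall y, `|x - y| < r -> P y /\ Q y.
Proof.
move=> HP HQ; have : \forall y \near x, P y /\ Q y by exact: filterI.
move=> /nbhs_ballP[r /= r0 Hr]; exists r => // y xy.
by apply: Hr; rewrite -ball_normE.
Qed.

Lemma mx_norm_lt p q (A : 'M[R]_(p, q)) (e : R) : 0 < e ->
  (forall i j, `|A i j| < e) -> `|A| < e.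
Proof.
move=> e0 H; rewrite [ltLHS]/Num.Def.normr /= mx_normrE.
by apply/bigmax_ltP; split=> // -[i j] _; exact: H.
Qed.

Lemma is_derive_line (V W : normedModType R) (g : V -> W) (y v : V) (s : R) :
  derivable g (s *: v + y) v ->
  is_derive s 1 (fun r : R => g (r *: v + y)) ('D_v g (s *: v + y)).
Proof.
move=> dg.
have E1 : (fun h : R => h^-1 *: (((fun r : R => g (r *: v + y)) \o shift s) (h *: 1)
      - g (s *: v + y))) =
    (fun h : R => h^-1 *: ((g \o shift (s *: v + y)) (h *: v) - g (s *: v + y))).
  by apply/funext => h /=; rewrite [h%:A]mulr1 scalerDl addrA.
by split; [rewrite /derivable E1|rewrite /derive E1].
Qed.

Lemma frechet (V W : normedModType R) (f : V -> W) (L : {linear V -> W}) (x : V) :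
    continuous L ->
    (forall e : R, 0 < e ->
       \forall h \near 0, `|f (h + x) - f x - L h| <= e * `|h|) ->
  differentiable f x /\ 'd f x = L :> (V -> W).
Proof.
move=> cL H.
have fo : f \o shift x = cst (f x) + L +o_ 0 id.
  apply/eqaddoP => e e0; near=> h.
  rewrite /= !fctE opprD addrA.
  by near: h; exact: H.
have dL := diff_unique cL fo.
by split=> //; apply/diff_locallyP; rewrite dL.
Unshelve. all: by end_near. Qed.

Lemma differentiable_approx (V W : normedModType R) (f : V -> W) (x : V) :
  differentiable f x -> forall e : R, 0 < e ->
    \forall h \near 0, `|f (h + x) - f x - 'd f x h| <= e * `|h|.
Proof.
move=> /diff_locally /eqaddoP fo e e0; near=> h.
have : `|(f \o shift x - (cst (f x) + 'd f x)) h| <= e * `|h|.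
  by near: h; exact: fo.
by rewrite !fctE /= opprD addrA.
Unshelve. all: by end_near. Qed.

(** Mean value inequality on a ball: moving the coordinates from those of [z] to
    those of [y] one at a time stays inside the ball, because the norm is the
    maximum norm. *)
Lemma partials_lipschitz_real (g : E -> R) (u : E) (r M : R) : 0 < r -> 0 <= M ->
    (forall y, `|u - y| < r -> forall i, derivable g y (e_ i)) ->
    (forall y, `|u - y| < r -> forall i, `|'D_(e_ i) g y| <= M) ->
  forall y z, `|u - y| < r -> `|u - z| < r ->
    `|g y - g z| <= m%:R * M * `|y - z|.
Proof.
move=> r0 M0 dg bg y z yr zr.
pose w (k : nat) : E := \row_j (if (j < k)%N then y 0 j else z 0 j).
have w0 : w 0%N = z by apply/rowP => j; rewrite mxE.
have wm : w m = y by apply/rowP => j; rewrite mxE ltn_ord.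
suff H k : (k <= m)%N -> `|g (w k) - g z| <= k%:R * M * `|y - z|.
  by rewrite -{1}wm; exact: H.
elim: k => [_|k IH km]; first by rewrite w0 subrr normr0 !mul0r.
pose i := Ordinal km.
have wS : w k.+1 = (y 0 i - z 0 i) *: e_ i + w k.
  apply/rowP => j; rewrite !mxE eqxx /= ltnS leq_eqVlt.
  have [->|ji] := eqVneq j i; first by rewrite eqxx ltnn /= mulr1 subrK.
  have -> : (j == k :> nat) = false.
    by apply/negbTE; apply: contra ji => /eqP jk; apply/eqP/val_inj.
  by rewrite mulr0 add0r.
have step : `|g (w k.+1) - g (w k)| <= M * `|y - z|.
  have := @mvt_between R 0 (y 0 i - z 0 i) (fun s => g (s *: e_ i + w k))
    (fun s => 'D_(e_ i) g (s *: e_ i + w k)) M.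
  rewrite -wS scale0r add0r subr0 => H.
  have inb s : between 0 (y 0 i - z 0 i) s -> `|u - (s *: e_ i + w k)| < r.
    move=> bs; apply: mx_norm_lt => // a j; rewrite !mxE ord1 eqxx /=.
    have uy : `|u 0 j - y 0 j| < r.
      by have := mx_entry_le (u - y) 0 j; rewrite !mxE => /le_lt_trans; exact.
    have uz : `|u 0 j - z 0 j| < r.
      by have := mx_entry_le (u - z) 0 j; rewrite !mxE => /le_lt_trans; exact.
    have [ji|ji] := eqVneq j i; last first.
      by rewrite mulr0 add0r; case: ifP.
    rewrite ji in uy uz *; rewrite ltnn mulr1; move: uy uz bs.
    rewrite /between !ltr_norml => /andP[? ?] /andP[? ?].
    by case: (leP 0 (y 0 i - z 0 i)) => ? /andP[? ?]; apply/andP; split; lra.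
  apply: le_trans (H _ _) _.
  - by move=> s bs; apply: is_derive_line; apply: dg; exact: inb.
  - by move=> s bs; apply: bg; exact: inb.
  - rewrite ler_wpM2l //.
    by have := mx_entry_le (y - z) 0 i; rewrite !mxE.
rewrite -[_ - g z](subrKA (g (w k))).
apply: le_trans (ler_normD _ _) _.
rewrite -natr1 !mulrDl mul1r addrC lerD //; exact/IH/ltnW.
Qed.

(** Entry by entry, again thanks to the maximum norm. *)
Lemma partials_lipschitz p q (g : E -> 'M[R]_(p, q)) (u : E) (r M : R) :
    0 < r -> 0 <= M ->
    (forall y, `|u - y| < r -> forall i, derivable g y (e_ i)) ->
    (forall y, `|u - y| < r -> forall i, `|'D_(e_ i) g y| <= M) ->
  forall y z, `|u - y| < r -> `|u - z| < r ->
    `|g y - g z| <= m%:R * M * `|y - z|.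
Proof.
move=> r0 M0 dg bg y z yr zr.
apply: mx_norm_le => [|a b]; first by rewrite !mulr_ge0.
rewrite !mxE.
apply: (@partials_lipschitz_real (fun y => g y a b) u r M) => // x xr i.
  by have := dg x xr i => /derivable_mxP.
apply: le_trans (bg x xr i).
have [_ ->] := (is_derive_mx _ _ _ _).1 (derivableP (dg x xr i)) a b.
exact: mx_entry_le.
Qed.

Section GenericTarget.
Variable W : normedModType R.

(** The only property of the target space that the theory uses; abstracting it
    treats real-valued and matrix-valued functions at once. *)
Definition mean_value_target := forall (g : E -> W) (u : E) (r M : R),
    0 < r -> 0 <= M ->
    (forall y, `|u - y| < r -> forall i, derivable g y (e_ i)) ->
    (forall y, `|u - y| < r -> forall i, `|'D_(e_ i) g y| <= M) ->
  forall y z, `|u - y| < r -> `|u - z| < r ->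
    `|g y - g z| <= m%:R * M * `|y - z|.

Hypothesis mvW : mean_value_target.

Definition partial_sum (d : 'I_m -> W) (h : E) : W := \sum_i h 0 i *: d i.

Lemma partial_sum_linear d : linear (partial_sum d).
Proof.
move=> k x y; rewrite /partial_sum scaler_sumr -big_split /=.
by apply: eq_bigr => i _; rewrite !mxE scalerDl scalerA.
Qed.

Lemma partial_sum_delta d i : partial_sum d (e_ i) = d i.
Proof.
rewrite /partial_sum (bigD1 i) //= mxE !eqxx scale1r big1 ?addr0 // => j ji.
by rewrite mxE (negbTE ji) andbF scale0r.
Qed.

Lemma partial_sum_le d (h : E) : `|partial_sum d h| <= (\sum_i `|d i|) * `|h|.
Proof.
rewrite /partial_sum mulr_suml; apply: le_trans (ler_norm_sum _ _ _) _.
apply: ler_sum => i _; rewrite normrZ mulrC ler_wpM2l //; exact: mx_entry_le.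
Qed.

(** The mean value inequality, applied to [g] minus the candidate differential,
    whose partial derivatives are small near [u]. *)
Lemma partials_differentiable (g : E -> W) (u : E) :
    (forall i, \forall y \near u, derivable g y (e_ i)) ->
    (forall i, {for u, continuous (fun y => 'D_(e_ i) g y)}) ->
  differentiable g u /\
  'd g u = partial_sum (fun i => 'D_(e_ i) g u) :> (E -> W).
Proof.
move=> dg cg.
pose d i := 'D_(e_ i) g u.
pose LM := GRing.isLinear.Build _ _ _ _ _ (partial_sum_linear d).
pose L : {linear E -> W} := HB.pack (partial_sum d) LM.
have cL : continuous L.
  apply/linear_bounded_continuous/linear_boundedP; near=> k => h.
  apply: le_trans (partial_sum_le d h) _; apply: ler_wpM2r; first exact: normr_ge0.
  by near: k; apply: nbhs_pinfty_ge; exact: num_real.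
apply: (@frechet E W g L u) => // e e0.
have e'0 : 0 < e / m.+1%:R by rewrite divr_gt0.
pose Q (i : 'I_m) (y : E) := derivable g y (e_ i) /\
  `|'D_(e_ i) g y - d i| <= e / m.+1%:R.
have HQ i : \forall y \near u, Q i y.
  have cgi : \forall y \near u, `|d i - 'D_(e_ i) g y| <= e / m.+1%:R.
    by move/cvgrPdist_le : (cg i) => /(_ _ e'0).
  apply: filterS2 (dg i) cgi => y dy cy.
  by split=> //; rewrite distrC.
have : \forall y \near u, forall i, Q i y.
  exact: (@filter_forall _ _ Q (nbhs u) _ HQ).
move=> HQ'; have [r r0 Hr'] := near_ball2 HQ' HQ'.
have Hr y : `|u - y| < r -> forall i, Q i y by move=> /Hr' [].
pose k := g \- partial_sum d.
have dk y i : `|u - y| < r -> is_derive y (e_ i) k ('D_(e_ i) g y - d i).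
  move=> /Hr /(_ i) [dy _]; apply: is_deriveB; first exact: DeriveDef.
  have dL : differentiable L y by exact: linear_differentiable.
  split; first exact: diff_derivable.
  rewrite (@deriveE _ _ _ L) // diff_lin //; exact: partial_sum_delta.
apply/nbhs_ballP; exists r => //= h; rewrite -ball_normE /= sub0r normrN => hr.
have := @mvW k u r (e / m.+1%:R) r0 (ltW e'0) _ _ (h + u) u.
have -> : k (h + u) - k u = g (h + u) - g u - L h.
  rewrite /k /= -[partial_sum d (h + u)]/(L (h + u)) linearD.
  rewrite -[partial_sum d u]/(L u) !opprD opprK addrACA !addrA.
  by rewrite subrK.
rewrite addrK => H; apply: le_trans (H _ _ _ _) _.
- by move=> y yr i; case: (dk y i yr).
- move=> y yr i; case: (dk y i yr) => _ ->.
  by have [] := Hr y yr i.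
- by rewrite opprD addrCA subrr addr0 normrN.
- by rewrite subrr normr0.
- rewrite ler_wpM2r // mulrCA ler_piMr ?(ltW e0) //.
  by rewrite ler_pdivrMr ?ltr0Sn // mul1r ler_nat.
Unshelve. all: by end_near. Qed.

Lemma class_C_differentiable (U : set E) (g : E -> W) (u : E) :
    open U -> class_C 1 U g -> U u ->
  differentiable g u.
Proof.
move=> oU [_ gU] Uu.
apply: (proj1 (@partials_differentiable g u _ _)) => i.
  have [dg _] := gU i.
  have nU : nbhs u U by exact: open_nbhs_nbhs.
  by move: nU; apply: filterS => y /dg.
by have [_ [cg _]] := gU i; exact: cg.
Qed.

Lemma derive_partial_sum (g : E -> W) (u w : E) : differentiable g u ->
  'D_w g u = \sum_i w 0 i *: 'D_(e_ i) g u.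
Proof.
move=> dg; rewrite deriveE // {1}(row_sum_delta w) linear_sum.
by apply: eq_bigr => i _; rewrite linearZ /= -deriveE.
Qed.

Lemma chain_curve (g : E -> W) (u : R -> E) (t : R) :
    differentiable g (u t) -> derivable u t 1 ->
  is_derive t 1 (g \o u) ('D_('D_1 u t) g (u t)).
Proof.
move=> dg /derivable1_diffP du.
have dgu : differentiable (g \o u) t by exact: differentiable_comp.
split; first exact/derivable1_diffP.
by rewrite !deriveE // diff_comp //= -deriveE.
Qed.

End GenericTarget.

Lemma mean_value_real : mean_value_target R.
Proof. exact: partials_lipschitz_real. Qed.

Lemma mean_value_mx p q : mean_value_target 'M[R]_(p, q).
Proof. exact: partials_lipschitz. Qed.

End FrechetFromPartials.

Section Schwarz.
Variables (R : realType) (m : nat).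
Local Notation E := 'rV[R]_m.
Local Notation e_ i := (delta_mx 0 i : 'rV[R]_m).

Lemma mx_norm_delta_le (i : 'I_m) : `|e_ i| <= 1.
Proof.
apply: mx_norm_le => // a j; rewrite mxE.
by case: (_ && _); rewrite ?normr1 ?normr0.
Qed.

(** One half of the equality of mixed derivatives: the second difference of [g]
    is, up to o(h^2), the mixed derivative taken in either order. *)
Lemma second_difference (U : set E) (g : E -> R) (u : E) (i j : 'I_m) (e : R) :
    open U -> class_C 2 U g -> U u -> 0 < e ->
  \forall h \near (0 : R), 0 < h ->
    `|g (h *: e_ i + h *: e_ j + u) - g (h *: e_ i + u) - g (h *: e_ j + u) + g u
      - h ^+ 2 * 'D_(e_ j) (fun y => 'D_(e_ i) g y) u| <= e * h ^+ 2.
Proof.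
move=> oU [_ gU] Uu e0.
have [dg cg] := gU i.
set a := fun y => 'D_(e_ i) g y in cg *.
have da : differentiable a u := class_C_differentiable (@mean_value_real R m) oU cg Uu.
have e30 : 0 < e / 3 by lra.
have := differentiable_approx da e30.
have : \forall k \near (0 : E), U (k + u).
  have : (fun k : E => k + u) @ nbhs (0 : E) --> 0 + u.
    by apply: cvgD; [exact: cvg_id|exact: cvg_cst].
  by rewrite add0r; apply; exact: open_nbhs_nbhs.
move=> H1 H2; have [r r0 Hr] := near_ball2 H1 H2.
near=> h => h0.
have hr : h * 2 < r.
  have : h < r / 2 by near: h; apply: lt_nbhsl; lra.
  by lra.
have inb s b : 0 <= s <= h -> 0 <= b <= h -> 
    `|s *: e_ i + b *: e_ j| <= s + b.
  move=> /andP[s0 sh] /andP[b0 bh]; apply: le_trans (ler_normD _ _) _.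
  rewrite !normrZ !ger0_norm //; apply: lerD; rewrite ler_piMr ?mx_norm_delta_le //.
have near_u s b : 0 <= s <= h -> 0 <= b <= h ->
    U (s *: e_ i + b *: e_ j + u) /\
    `|a (s *: e_ i + b *: e_ j + u) - a u - 'd a u (s *: e_ i + b *: e_ j)|
      <= e / 3 * (s + b).
  move=> sh bh; have := Hr (s *: e_ i + b *: e_ j).
  rewrite sub0r normrN => -[|? ab].
    by apply: le_lt_trans (inb s b sh bh) _; lra.
  split=> //; apply: le_trans ab _.
  by apply: ler_wpM2l; [exact: ltW|exact: inb].
have hh : 0 <= h <= h by rewrite lexx ltW.
have zh : (0 : R) <= 0 <= h by apply/andP; split=> //; exact: ltW.
pose D := 'D_(e_ j) a u.
pose phi s := g (s *: e_ i + (h *: e_ j + u)) - g (s *: e_ i + u) - s * (h * D).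
pose dphi s := a (s *: e_ i + (h *: e_ j + u)) - a (s *: e_ i + u) - h * D.
have dphiP s : 0 <= s <= h -> is_derive s 1 phi (dphi s).
  move=> sh; apply: is_deriveB.
    apply: is_deriveB; apply: is_derive_line; apply: dg.
      by have [] := near_u s h sh hh; rewrite addrA.
    by have [] := near_u s 0 sh zh; rewrite scale0r addr0.
  exact: is_derive_mulr.
have dphi_le s : 0 <= s <= h -> `|dphi s| <= e * h.
  move=> sh; have [_ A1] := near_u s h sh hh; have [_] := near_u s 0 sh zh.
  rewrite scale0r !addr0 => A2; rewrite /dphi addrA.
  have -> : a (s *: e_ i + h *: e_ j + u) - a (s *: e_ i + u) - h * D =
    (a (s *: e_ i + h *: e_ j + u) - a u - 'd a u (s *: e_ i + h *: e_ j))
    - (a (s *: e_ i + u) - a u - 'd a u (s *: e_ i)).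
    have -> : 'd a u (s *: e_ i + h *: e_ j) = h * D + 'd a u (s *: e_ i).
      by rewrite addrC linearP /D deriveE.
    by ring.
  apply: le_trans (ler_normB _ _) _; apply: le_trans (lerD A1 A2) _.
  rewrite -mulrDr (_ : e * h = e / 3 * (3 * h)); last by field.
  by rewrite ler_pM2l //; move: sh => /andP[]; lra.
have := mvt_le (ltW h0) dphiP dphi_le.
rewrite /phi !scale0r !add0r mul0r !subr0 -mulrA -expr2.
congr (`|_| <= _); rewrite -/D addrA; ring.
Unshelve. all: by end_near. Qed.

(** The second difference is symmetric in the two directions. *)
Lemma mixed_derivatives (U : set E) (g : E -> R) (u : E) (i j : 'I_m) :
    open U -> class_C 2 U g -> U u ->
  'D_(e_ j) (fun y => 'D_(e_ i) g y) u = 'D_(e_ i) (fun y => 'D_(e_ j) g y) u.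
Proof.
move=> oU cg Uu; apply/eqP; rewrite -subr_eq0 -normr_le0; apply/ler_addgt0Pl.
move=> e e0; rewrite addr0.
have e20 : 0 < e / 2 by lra.
have [r r0 Hr] := near_ball2 (second_difference i j oU cg Uu e20)
  (second_difference j i oU cg Uu e20).
pose h := r / 2; have h0 : 0 < h by rewrite divr_gt0.
have [|/(_ h0) + /(_ h0)] := Hr h.
  by rewrite sub0r normrN gtr0_norm // /h; lra.
set d1 := 'D_(e_ j) _ u; set d2 := 'D_(e_ i) _ u.
rewrite (addrC (h *: e_ j) (h *: e_ i)).
set s := g _ - _ - _ + _; set s' := g _ - _ - _ + _.
have -> : s' = s by rewrite /s /s'; ring.
move=> A1 A2.
have h20 : 0 < h ^+ 2 by rewrite exprn_gt0.
rewrite -(ler_pM2l h20) -[X in X * `|_|](gtr0_norm h20) -normrM.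
clearbody s s' h d1 d2.
have -> : h ^+ 2 * (d1 - d2) = (s - h ^+ 2 * d2) - (s - h ^+ 2 * d1) by ring.
apply: le_trans (ler_normB _ _) _; apply: le_trans (lerD A2 A1) _.
by rewrite -mulrDl -splitr mulrC.
Qed.

End Schwarz.

(** * Lipschitz estimates and contraction *)

(** Local Lipschitz continuity and derivability along a curve are both stable
    under the ring operations, hence under determinants and cofactors. *)
Section ClosedUnderRingOperations.
Variables (R : realType) (X : Type).

Record ring_closed (C : (X -> R) -> Prop) : Prop := RingClosed {
  closed_cst : forall k : R, C (fun=> k) ;
  closed_add : forall f g, C f -> C g -> C (fun x => f x + g x) ;
  closed_mul : forall f g, C f -> C g -> C (fun x => f x * g x)
}.

Variable C : (X -> R) -> Prop.
Hypothesis CC : ring_closed C.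

Lemma closed_sum (I : Type) (r : seq I) (F : I -> X -> R) :
  (forall i, C (F i)) -> C (fun x => \sum_(i <- r) F i x).
Proof.
move=> CF; elim: r => [|i r IH].
  have -> : (fun x => \sum_(i <- [::]) F i x) = (fun=> 0).
    by apply/funext => x; rewrite big_nil.
  exact: closed_cst.
have -> : (fun x => \sum_(j <- i :: r) F j x) =
    (fun x => F i x + \sum_(j <- r) F j x).
  by apply/funext => x; rewrite big_cons.
exact: closed_add.
Qed.

Lemma closed_prod (I : Type) (r : seq I) (F : I -> X -> R) :
  (forall i, C (F i)) -> C (fun x => \prod_(i <- r) F i x).
Proof.
move=> CF; elim: r => [|i r IH].
  have -> : (fun x => \prod_(i <- [::]) F i x) = (fun=> 1).
    by apply/funext => x; rewrite big_nil.
  exact: closed_cst.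
have -> : (fun x => \prod_(j <- i :: r) F j x) =
    (fun x => F i x * \prod_(j <- r) F j x).
  by apply/funext => x; rewrite big_cons.
exact: closed_mul.
Qed.

Lemma closed_det n (A : X -> 'M[R]_n) :
  (forall i j, C (fun x => A x i j)) -> C (fun x => \det (A x)).
Proof.
move=> CA; rewrite /determinant; apply: closed_sum => s.
by apply: (closed_mul CC); [exact: (closed_cst CC)|apply: closed_prod => i].
Qed.

Lemma closed_adj n (A : X -> 'M[R]_n) i j :
  (forall i j, C (fun x => A x i j)) -> C (fun x => (\adj (A x)) i j).
Proof.
move=> CA.
have -> : (fun x => (\adj (A x)) i j) =
    (fun x => (-1) ^+ (j + i) * \det (row' j (col' i (A x)))).
  by apply/funext => x; rewrite mxE.
apply: (closed_mul CC); first exact: (closed_cst CC).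
apply: closed_det => k l.
have -> : (fun x => row' j (col' i (A x)) k l) =
    (fun x => A x (lift j k) (lift i l)) by apply/funext => x; rewrite !mxE.
exact: CA.
Qed.

Lemma closed_mulmx p q r (A : X -> 'M[R]_(p, q)) (B : X -> 'M[R]_(q, r)) i j :
    (forall i j, C (fun x => A x i j)) -> (forall i j, C (fun x => B x i j)) ->
  C (fun x => (A x *m B x) i j).
Proof.
move=> CA CB.
have -> : (fun x => (A x *m B x) i j) = (fun x => \sum_k A x i k * B x k j).
  by apply/funext => x; rewrite mxE.
by apply: closed_sum => k; exact: closed_mul.
Qed.

End ClosedUnderRingOperations.

Section DerivableClosed.
Variables (R : realType) (t : R).

Lemma derivable_ring_closed : ring_closed (fun f : R -> R => derivable f t 1).
Proof.
split=> [k|f g|f g]; [exact: derivable_cst|exact: derivableD|exact: derivableM].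
Qed.

End DerivableClosed.

Section LocallyLipschitz.
Variables (R : realType).

(** Quantifying over all small radii, rather than asking for one, lets several such
    estimates be put on a common ball by intersecting filters. *)
Definition lipnear (E W : normedModType R) (g : E -> W) (a : E) :=
  exists2 L : R, 0 <= L & \forall r \near (0 : R)^'+, forall y z : E,
    `|a - y| < r -> `|a - z| < r -> `|g y - g z| <= L * `|y - z|.

Lemma lipnear_bounded (E W : normedModType R) (g : E -> W) (a : E) :
  lipnear g a -> exists2 B : R, 0 <= B & \forall r \near (0 : R)^'+,
    forall y, `|a - y| < r -> `|g y| <= B.
Proof.
move=> [L L0 Lg]; exists (`|g a| + L); first by rewrite addr_ge0.
near=> r => y yr.
have r1 : r < 1 by near: r; exact: nbhs_right_lt.
have r0 : 0 < r by [].
have H : forall y z : E, `|a - y| < r -> `|a - z| < r ->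
  `|g y - g z| <= L * `|y - z| by near: r.
rewrite -[g y](subrKC (g a)); apply: le_trans (ler_normD _ _) _.
rewrite lerD2l distrC; apply: le_trans (H _ _ _ yr) _.
  by rewrite subrr normr0.
by rewrite ler_piMr // ltW // (lt_trans yr).
Unshelve. all: by end_near. Qed.

Lemma lipnear_comp (E F W : normedModType R) (phi : E -> F) (g : F -> W) (a : E) :
    (forall y z, `|phi y - phi z| <= `|y - z|) -> lipnear g (phi a) ->
  lipnear (g \o phi) a.
Proof.
move=> lphi [L L0 Lg]; exists L => //; near=> r => y z yr zr.
have H : forall y z : F, `|phi a - y| < r -> `|phi a - z| < r ->
  `|g y - g z| <= L * `|y - z| by near: r.
apply: le_trans (H _ _ _ _) _; rewrite ?(le_lt_trans (lphi _ _)) //.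
by rewrite ler_wpM2l.
Unshelve. all: by end_near. Qed.

Lemma lipnear_ring_closed (E : normedModType R) (a : E) :
  ring_closed (fun g : E -> R => lipnear g a).
Proof.
split=> [k|f g [L L0 Lf] [M M0 Mg]|f g lf lg].
- by exists 0 => //; near=> r => y z _ _; rewrite subrr normr0 mul0r.
- exists (L + M); first exact: addr_ge0.
  near=> r => y z yr zr; rewrite opprD addrACA mulrDl.
  apply: le_trans (ler_normD _ _) _; apply: lerD.
    by move: y z yr zr; near: r.
  by move: y z yr zr; near: r.
have [B B0 Bf] := lipnear_bounded lf; have [D D0 Dg] := lipnear_bounded lg.
move: lf lg => [L L0 Lf] [M M0 Mg].
exists (B * M + D * L); first by rewrite addr_ge0 // mulr_ge0.
near=> r => y z yr zr.
have -> : f y * g y - f z * g z = f y * (g y - g z) + g z * (f y - f z) by ring.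
apply: le_trans (ler_normD _ _) _; rewrite mulrDl !normrM -!mulrA.
apply: lerD; apply: ler_pM => //.
- by move: y yr; near: r.
- by move: y z yr zr; near: r.
- by move: z zr; near: r.
- by move: y z yr zr; near: r.
Unshelve. all: by end_near. Qed.

(** Near [a] the function stays away from 0 by half of its modulus at [a]. *)
Lemma lipnear_inv (E : normedModType R) (g : E -> R) (a : E) :
  lipnear g a -> g a != 0 -> lipnear (fun x => (g x)^-1) a.
Proof.
move=> [L L0 Lg] ga0.
pose b := `|g a| / 2; have b0 : 0 < b by rewrite divr_gt0 // normr_gt0.
have L1 : 0 < L + 1 by rewrite ltr_wpDl.
exists (b^-1 * b^-1 * L); first by rewrite !mulr_ge0 // invr_ge0 ltW.
near=> r => y z yr zr.
have r0 : 0 < r by [].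
have H : forall y z : E, `|a - y| < r -> `|a - z| < r ->
  `|g y - g z| <= L * `|y - z| by near: r.
have low x : `|a - x| < r -> b <= `|g x|.
  move=> xr; have : `|g a - g x| <= b.
    apply: le_trans (H _ _ _ xr) _; first by rewrite subrr normr0.
    have : r < b / (L + 1) by near: r; apply: nbhs_right_lt; rewrite divr_gt0.
    rewrite ltr_pdivlMr // => rb.
    have : L * `|a - x| <= (L + 1) * r by rewrite ler_pM // ?ltW // ltrDl.
    by move: rb; rewrite mulrC; lra.
  have := lerB_dist (g a) (g x).
  have : `|g a| = b + b by rewrite /b -splitr.
  by lra.
have gy := low y yr; have gz := low z zr.
have gy0 : g y != 0 by rewrite -normr_gt0 (lt_le_trans b0).
have gz0 : g z != 0 by rewrite -normr_gt0 (lt_le_trans b0).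
have -> : (g y)^-1 - (g z)^-1 = (g y)^-1 * (g z)^-1 * (g z - g y).
  by field; rewrite gy0 gz0.
rewrite normrM (distrC (g z)) -[leRHS]mulrA; apply: ler_pM => //; last exact: H.
by rewrite normrM !normfV; apply: ler_pM; rewrite ?invr_ge0 // lef_pV2 ?posrE //
  (lt_le_trans b0).
Unshelve. all: by end_near. Qed.

Lemma lipnear_mx (E : normedModType R) p q (g : E -> 'M[R]_(p, q)) (a : E) :
  (forall i j, lipnear (fun x => g x i j) a) -> lipnear g a.
Proof.
move=> H.
have {}H (ij : 'I_p * 'I_q) : exists L : R, 0 <= L /\ \forall r \near (0 : R)^'+,
    forall y z : E, `|a - y| < r -> `|a - z| < r ->
    `|g y ij.1 ij.2 - g z ij.1 ij.2| <= L * `|y - z|.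
  by have [L L0 Lg] := H ij.1 ij.2; exists L.
have [L HL] := choice H.
exists (\sum_ij L ij); first by apply: sumr_ge0 => ij _; case: (HL ij).
pose Q (ij : 'I_p * 'I_q) (r : R) := forall y z : E, `|a - y| < r -> `|a - z| < r ->
    `|g y ij.1 ij.2 - g z ij.1 ij.2| <= L ij * `|y - z|.
have : \forall r \near (0 : R)^'+, forall ij, Q ij r.
  by apply: (@filter_forall _ _ Q) => ij; case: (HL ij).
apply: filterS => r Hr y z yr zr.
apply: mx_norm_le => [|i j].
  by rewrite mulr_ge0 // sumr_ge0 // => ij _; case: (HL ij).
rewrite !mxE; apply: le_trans (Hr (i, j) y z yr zr) _.
rewrite ler_wpM2r // (bigD1 (i, j)) //= lerDl sumr_ge0 // => ij _.
by case: (HL ij).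
Qed.

Lemma lipnear_entry (E : normedModType R) p q (g : E -> 'M[R]_(p, q)) (a : E) i j :
  lipnear g a -> lipnear (fun x => g x i j) a.
Proof.
move=> [L L0 Lg]; exists L => //; move: Lg; apply: filterS => r H y z yr zr.
by apply: le_trans (H y z yr zr); have := mx_entry_le (g y - g z) i j; rewrite !mxE.
Qed.

(** A continuous gradient is bounded near [u]. *)
Lemma class_C_lipnear (m : nat) (W : normedModType R) (U : set 'rV[R]_m)
    (g : 'rV[R]_m -> W) (u : 'rV[R]_m) :
    mean_value_target m W -> open U -> class_C 1 U g -> U u ->
  lipnear g u.
Proof.
move=> mvW oU [_ gU] Uu.
pose M := \sum_(i < m) (`|'D_(delta_mx 0 i) g u| + 1).
have M0 : 0 <= M by apply: sumr_ge0 => i _; rewrite addr_ge0.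
exists (m%:R * M); first by rewrite mulr_ge0.
have nU : nbhs u U by exact: open_nbhs_nbhs.
pose Q (i : 'I_m) y := `|'D_(delta_mx 0 i) g y| <= M.
have HQ i : \forall y \near u, Q i y.
  have [_ [cg _]] := gU i.
  have : \forall y \near u, `|'D_(delta_mx 0 i) g u - 'D_(delta_mx 0 i) g y| <= 1.
    by move/cvgrPdist_le: (cg u Uu) => /(_ 1 ltr01).
  apply: filterS => y yu; rewrite /Q.
  apply: (@le_trans _ _ (`|'D_(delta_mx 0 i) g u| + 1)).
    rewrite -['D_(delta_mx 0 i) g y](subKr ('D_(delta_mx 0 i) g u)).
    by apply: le_trans (ler_normB _ _) _; rewrite lerD2l.
  rewrite /M (bigD1 i) //= lerDl sumr_ge0 // => j _; exact: addr_ge0.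
have HQ' : \forall y \near u, forall i, Q i y.
  exact: (@filter_forall _ _ Q (nbhs u) _ HQ).
have [r0 r00 Hr] := near_ball2 nU HQ'.
near=> r => y z yr zr.
have rr0 : r <= r0 by near: r; exact: nbhs_right_le.
have rp : 0 < r by [].
apply: (mvW g u r M) => // x xr i; have [Ux Qx] := Hr x (lt_le_trans xr rr0).
  by have [dg _] := gU i; exact: dg.
exact: Qx.
Unshelve. all: by end_near. Qed.

Lemma row_dist p q (i : 'I_p) (y z : 'M[R]_(p, q)) :
  `|row i y - row i z| <= `|y - z|.
Proof.
apply: mx_norm_le => // a j; rewrite !mxE.
by have := mx_entry_le (y - z) i j; rewrite !mxE.
Qed.

End LocallyLipschitz.

Lemma R_complete_seq (R : realType) (a : nat -> R) :
  (forall e : R, 0 < e -> exists N, forall n k, (N <= n)%N ->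
     `|a (n + k)%N - a n| <= e) -> cvg (a @ \oo).
Proof.
move=> H; apply/cauchy_cvgP/cauchyP => e e0.
have [N HN] := H _ (divr_gt0 e0 (ltr0n _ 2)).
exists (a N); exists N => // n /= Nn; rewrite -ball_normE /= distrC.
have := HN N (n - N)%N (leqnn N); rewrite subnKC // => /le_lt_trans; apply.
by rewrite ltr_pdivrMr // ltr_pMr // ltr1n.
Qed.

Section Picard.
Variables (R : realType) (p q : nat).
Local Notation Z := 'M[R]_(p, q).

(** The iterates converge entry by entry and uniformly, at a geometric rate;
    stability of [P] under uniform limits stands in for the completeness of a space
    of functions. *)
Lemma uniform_contraction (T : Type) (P : set (T -> Z)) (Gam : (T -> Z) -> T -> Z)
    (z0 : T -> Z) (B : R) :
    P z0 -> (forall z, P z -> P (Gam z)) -> 0 <= B ->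
    (forall t, `|Gam z0 t - z0 t| <= B) ->
    (forall z z' (e : R), P z -> P z' -> 0 <= e ->
      (forall t, `|z t - z' t| <= e) ->
      forall t, `|Gam z t - Gam z' t| <= e / 2) ->
    (forall (z : nat -> T -> Z) (zl : T -> Z), (forall n, P (z n)) ->
      (forall e : R, 0 < e -> \forall n \near \oo, forall t, `|z n t - zl t| <= e) ->
      P zl) ->
  exists2 z, P z & Gam z = z.
Proof.
move=> Pz0 PG B0 GB contr Plim.
pose z n := iter n Gam z0.
have Pz n : P (z n) by elim: n => // n IH; exact: PG.
have stepB n t : `|z n.+1 t - z n t| <= B / 2 ^+ n.
  elim: n t => [|n IH] t; first by rewrite expr0 divr1; exact: GB.
  rewrite exprS invfM mulrCA mulrC.
  apply: (contr (z n.+1) (z n)); [exact: Pz|exact: Pz| |exact: IH].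
  by rewrite mulr_ge0 // invr_ge0 exprn_ge0.
have distB n k t : `|z (n + k)%N t - z n t| <= 2 * B / 2 ^+ n.
  suff H : `|z (n + k)%N t - z n t| <= 2 * B / 2 ^+ n - 2 * B / 2 ^+ (n + k).
    by apply: le_trans H _; rewrite gerBl !mulr_ge0 // invr_ge0 exprn_ge0.
  elim: k => [|k IH]; first by rewrite addn0 !subrr normr0.
  rewrite addnS -[_ - z n t](subrKA (z (n + k)%N t)).
  apply: le_trans (ler_normD _ _) _; apply: le_trans (lerD (stepB _ _) IH) _.
  rewrite exprS; set a := 2 ^+ (n + k).
  have a0 : a != 0 by rewrite expf_neq0.
  by rewrite (_ : B / a = 2 * B / a - 2 * B / (2 * a)); [lra|field].
have half_small (e : R) : 0 < e -> \forall n \near \oo, 2 * B / 2 ^+ n <= e.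
  move=> e0.
  have c0 : (fun n => 2 * B * (2^-1) ^+ n) @ \oo --> (2 * B * 0 : R).
    by apply: cvgMl_tmp; apply: cvg_expr; rewrite ger0_norm //; lra.
  rewrite mulr0 in c0.
  move/cvgrPdist_le: c0 => /(_ e e0); apply: filterS => n.
  rewrite sub0r normrN exprVn; apply: le_trans; exact: ler_norm.
have cz t i j : cvg ((fun n => z n t i j) @ \oo).
  apply/R_complete_seq => e e0.
  have [N _ HN] := half_small _ e0.
  exists N => n k Nn.
  apply: le_trans (HN n Nn).
  by have := distB n k t; apply: le_trans; have := mx_entry_le (z (n + k)%N t - z n t) i j; rewrite !mxE.
pose zl t : Z := \matrix_(i, j) lim ((fun n => z n t i j) @ \oo).
have zzl n t : `|z n t - zl t| <= 2 * B / 2 ^+ n.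
  apply: mx_norm_le => [|i j]; first by rewrite !mulr_ge0 // invr_ge0 exprn_ge0.
  rewrite !mxE.
  have : (fun k => `|z n t i j - z (n + k)%N t i j|) @ \oo -->
      `|z n t i j - lim ((fun n => z n t i j) @ \oo)|.
    apply: cvg_norm; apply: cvgB; first exact: cvg_cst.
    have : (fun k => z (k + n)%N t i j) @ \oo --> lim ((fun n => z n t i j) @ \oo).
      by rewrite (cvg_shiftn n (fun k => z k t i j)); exact: cz.
    by under eq_fun do rewrite addnC.
  move=> cn; rewrite -(cvg_lim (@Rhausdorff R) cn); apply: limr_le.
    by apply/cvg_ex; eexists; exact: cn.
  near=> k.
  rewrite distrC; apply: le_trans (distB n k t).
  by have := mx_entry_le (z (n + k)%N t - z n t) i j; rewrite !mxE.
have Pzl : P zl.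
  apply: (Plim z) => // e e0.
  by move: (half_small e e0); apply: filterS => n H t; exact: le_trans (zzl n t) H.
exists zl => //; apply/funext => t; apply/eqP.
rewrite -subr_eq0 -normr_le0; apply/ler_addgt0Pl => e e0; rewrite addr0.
have [N _ HN] := half_small (e / 2) (divr_gt0 e0 (ltr0n _ 2)).
have HN' := HN N (leqnn N).
rewrite -[_ - zl t](subrKA (z N.+1 t)); apply: le_trans (ler_normD _ _) _.
rewrite [leRHS]splitr; apply: lerD; last first.
  exact: le_trans (zzl _ _) (HN _ (leqnSn N)).
have e20 : 0 <= e / 2 by lra.
apply: (@le_trans _ _ (e / 2 / 2)); last by lra.
apply: (contr zl (z N)) => // s; rewrite distrC; exact: le_trans (zzl N s) HN'.
Unshelve. all: by end_near. Qed.

(** The right-hand side may depend on the whole curve [z], in the application through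
    the memory of the oscillators. Curves are therefore taken on the whole line,
    constant outside the interval of half-length [d] around [t1], and the integral
    equation is a contraction for the supremum distance. *)
Lemma picard (t1 d r L N : R) (z1 : Z) (X : (R -> Z) -> R -> Z)
    (P := fun z : R -> Z =>
       [/\ continuous z, z t1 = z1 & forall s, `|z s - z1| <= r]) :
    0 < d -> 0 <= r -> 0 <= N -> 0 <= L -> d * N <= r -> d * L <= 1 / 2 ->
    (forall z, P z -> continuous (X z)) ->
    (forall z s, P z -> t1 - d <= s <= t1 + d -> `|X z s| <= N) ->
    (forall z z' (e : R), P z -> P z' -> 0 <= e ->
      (forall s, `|z s - z' s| <= e) ->
      forall s, t1 - d <= s <= t1 + d -> `|X z s - X z' s| <= L * e) ->
  exists2 z, P z & forall s, t1 - d < s < t1 + d -> is_derive s 1 z (X z s).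
Proof.
move=> d0 r0 N0 L0 dN dL cX XN XL.
pose c := clamp (t1 - d) (t1 + d).
have dd : t1 - d <= t1 + d by lra.
have ct1 : c t1 = t1 by apply: clamp_id; lra.
have cI t x : between t1 (c t) x -> t1 - d <= x <= t1 + d.
  have /andP[] := clamp_itv t dd; rewrite -/(c t) /between.
  by case: (leP t1 (c t)) => _ ? ? /andP[? ?]; apply/andP; split; lra.
have cd t : `|c t - t1| <= d.
  by have := clamp_itv t dd; rewrite -/(c t) ler_norml => /andP[? ?]; lra.
pose Gam z t := z1 + (mx_prim (X z) (c t) - mx_prim (X z) t1).
have PG z : P z -> P (Gam z).
  move=> Pz; split.
  - move=> t; apply: cvgD; first exact: cvg_cst.
    apply: cvgB; last exact: cvg_cst.
    apply: (@continuous_comp _ _ _ c (mx_prim (X z))); first exact: clamp_continuous.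
    by apply: derivable1_continuous; have [] := mx_prim_derive (c t) (cX z Pz).
  - by rewrite /Gam ct1 subrr addr0.
  - move=> t; rewrite /Gam addrAC subrr add0r.
    have : `|mx_prim (X z) (c t) - mx_prim (X z) t1| <= N * `|c t - t1|.
      apply: (mx_mvt_between (df := X z)) => // x.
        by move=> _; exact: mx_prim_derive (cX z Pz).
      by move=> /cI; exact: XN.
    move/le_trans; apply; apply: le_trans dN.
    by rewrite mulrC ler_wpM2r.
have [z Pz Gz] : exists2 z, P z & Gam z = z.
  apply: (@uniform_contraction R P Gam (cst z1) r) => //.
  - by split=> [t||s] //=; [exact: cvg_cst|rewrite subrr normr0].
  - have /PG[_ _] : P (cst z1).
      by split=> [t||s] //=; [exact: cvg_cst|rewrite subrr normr0].
    by move=> H t; exact: H.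
  - move=> z z' e Pz Pz' e0 zz' t.
    have -> : Gam z t - Gam z' t =
      (mx_prim (X z) \- mx_prim (X z')) (c t) - (mx_prim (X z) \- mx_prim (X z')) t1.
      by apply/matrixP => i j; rewrite /Gam !mxE; ring.
    have : `|(mx_prim (X z) \- mx_prim (X z')) (c t)
          - (mx_prim (X z) \- mx_prim (X z')) t1| <= (L * e) * `|c t - t1|.
      apply: (mx_mvt_between (df := X z \- X z')).
      + by rewrite mulr_ge0.
      + by move=> x _; apply: is_deriveB; apply: mx_prim_derive; exact: cX.
      + by move=> x /cI xI; exact: XL.
    move/le_trans; apply.
    apply: (@le_trans _ _ (L * e * d)); first by rewrite ler_wpM2l // mulr_ge0.
    by rewrite (_ : L * e * d = e * (d * L)); [rewrite ler_wpM2l //; lra|ring].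
  - move=> z zl Pz zzl.
    have lim_eq t l : (forall n, z n t = l) -> zl t = l.
      move=> zt; apply/eqP; rewrite -subr_eq0 -normr_le0; apply/ler_addgt0Pl => e e0.
      rewrite addr0; have [n _ /(_ n (leqnn n) t)] := zzl e e0.
      by rewrite zt distrC.
    split.
    + move=> t; apply/cvgrPdist_le => e e0.
      have e30 : 0 < e / 3 by lra.
      have [n _ /(_ n (leqnn n)) Hn] := zzl _ e30.
      have [czn _ _] := Pz n.
      move/cvgrPdist_le: (czn t) => /(_ _ e30); apply: filterS => s Hs.
      rewrite -[zl t - zl s](subrKA (z n t)) -[z n t - zl s](subrKA (z n s)).
      apply: le_trans (ler_normD _ _) _.
      have := ler_normD (z n t - z n s) (z n s - zl s).
      by have := Hn t; have := Hn s; rewrite (distrC (z n t) (zl t)); lra.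
    + by apply: lim_eq => n; have [] := Pz n.
    + move=> t; apply/ler_addgt0Pl => e e0.
      have [n _ /(_ n (leqnn n) t) Hn] := zzl e e0.
      rewrite -[zl t - z1](subrKA (z n t)); apply: le_trans (ler_normD _ _) _.
      by rewrite distrC lerD //; have [_ _] := Pz n; exact.
exists z => // s sI.
rewrite -{1}Gz; apply: (@near_eq_is_derive _ _ _
  (fun t => z1 + (mx_prim (X z) t - mx_prim (X z) t1))).
  have : \forall x \near s, t1 - d < x by apply: lt_nbhsr; case/andP: sI.
  have : \forall x \near s, x < t1 + d by apply: lt_nbhsl; case/andP: sI.
  apply: filterS2 => x x1 x2; rewrite /Gam /c clamp_id //.
  by rewrite !ltW.
have H := is_deriveD (is_derive_cst z1 s 1)
  (is_deriveB (mx_prim_derive s (cX z Pz))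
    (is_derive_cst (mx_prim (X z) t1) s 1)).
by apply: (is_derive_eq H); rewrite add0r subr0.
Qed.

End Picard.

(** * The forced harmonic oscillator *)

Section MeasurableInverse.
Variable R : realType.

Lemma measurable_inv : measurable_fun [set: R] (@GRing.inv R).
Proof.
have -> : @GRing.inv R = fun x => if x == 0 then 0 else x^-1.
  by apply/funext => x; case: eqP => // ->; rewrite invr0.
apply: measurable_fun_if => //.
  exact: measurable_fun_eqr.
have -> : [set: R] `&` (fun x : R => x == 0) @^-1` [set false] = [set x : R | x != 0].
  by apply/seteqP; split=> x /=; [move=> [_ /negbT]|move=> /negbTE].
apply: open_continuous_measurable_fun.
  have -> : [set x : R | x != 0] = [set x | x < 0] `|` [set x | 0 < x].
    by apply/seteqP; split=> x /=; rewrite neq_lt => /orP.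
  by apply: openU; [exact: open_lt|exact: open_gt].
by move=> x; rewrite inE /= => x0; exact: inv_continuous.
Qed.

Lemma measurable_funV (f : R -> R) : measurable_fun [set: R] f ->
  measurable_fun [set: R] (fun x => (f x)^-1).
Proof. by move=> mf; exact: measurableT_comp measurable_inv mf. Qed.

Lemma continuous_bounded (T : R) (h : R -> R) : continuous h ->
  exists2 B : R, 0 <= B & forall t, `|t| <= T -> `|h t| <= B.
Proof.
move=> ch.
have cT : compact `[(- T), T] by exact: segment_compact.
have /compact_bounded[M [Mr HM]] :=
  continuous_compact (continuous_subspaceT ch) cT.
exists (`|M| + 1); first by rewrite addr_ge0.
move=> t tT; apply: HM; first by rewrite ltr_pwDr // ler_norm.
by exists t => //=; rewrite in_itv /= -ler_norml.
Qed.

End MeasurableInverse.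

(** The harmonic oscillator x'' + nu^2 x = phi, solved by variation of
    constants, uniformly in the frequency nu (which may vanish). *)
Section HarmonicOscillator.
Variable R : realType.

(** The fundamental solutions of [x'' + nu ^+ 2 * x = 0]; the second one tends to
    [t] as the frequency vanishes. *)
Definition osc_cos (nu t : R) : R := cos (nu * t).
Definition osc_sin (nu t : R) : R := if nu == 0 then t else sin (nu * t) / nu.

Lemma is_derive_lin (nu t : R) : is_derive t 1 (fun s : R => nu * s) nu.
Proof.
have -> : (fun s : R => nu * s) = (fun s => s * nu).
  by apply/funext => s; rewrite mulrC.
exact: is_derive_mulr.
Qed.

Lemma osc_cos_derive (nu t : R) :
  is_derive t 1 (osc_cos nu) (- nu ^+ 2 * osc_sin nu t).
Proof.
have H := is_derive1_comp (is_derive_cos (nu * t)) (is_derive_lin nu t).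
apply: (is_derive_eq H); rewrite /osc_sin; case: eqP => [->|/eqP n0].
  by rewrite mulr0 expr0n /= oppr0 mul0r.
by field.
Qed.

Lemma osc_sin_derive (nu t : R) : is_derive t 1 (osc_sin nu) (osc_cos nu t).
Proof.
rewrite /osc_cos; have [->|n0] := eqVneq nu 0.
  rewrite mul0r cos0; have -> : osc_sin 0 = id.
    by apply/funext => s; rewrite /osc_sin eqxx.
  exact: is_derive_id.
have -> : osc_sin nu = (fun y => y / nu) \o (sin \o (fun s => nu * s)).
  by apply/funext => s; rewrite /osc_sin (negbTE n0).
have H := is_derive1_comp (is_derive_mulr nu^-1 (sin (nu * t)))
   (is_derive1_comp (is_derive_sin (nu * t)) (is_derive_lin nu t)).
by apply: (is_derive_eq H); field.
Qed.

Lemma osc_cos_continuous nu : continuous (osc_cos nu).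
Proof. by move=> t; apply: derivable1_continuous; case: (osc_cos_derive nu t). Qed.

Lemma osc_sin_continuous nu : continuous (osc_sin nu).
Proof. by move=> t; apply: derivable1_continuous; case: (osc_sin_derive nu t). Qed.

Lemma osc_cos_le1 nu t : `|osc_cos nu t| <= 1.
Proof. exact: cos_max. Qed.

Lemma osc_sinM nu t : nu * osc_sin nu t = sin (nu * t).
Proof.
rewrite /osc_sin; case: eqP => [->|/eqP n0]; first by rewrite !mul0r sin0.
by rewrite mulrCA divff // mulr1.
Qed.

Lemma osc_sin_le1 nu t : `|nu * osc_sin nu t| <= 1.
Proof. by rewrite osc_sinM sin_max. Qed.

Lemma osc_cos2_sin2 nu t : osc_cos nu t ^+ 2 + nu ^+ 2 * osc_sin nu t ^+ 2 = 1.
Proof. by rewrite -exprMn osc_sinM cos2Dsin2. Qed.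

Lemma osc_cos0 nu : osc_cos nu 0 = 1.
Proof. by rewrite /osc_cos mulr0 cos0. Qed.

Lemma osc_sin0 nu : osc_sin nu 0 = 0.
Proof. by rewrite /osc_sin mulr0 sin0 mul0r; case: ifP. Qed.

Lemma osc_cosN nu t : osc_cos nu (- t) = osc_cos nu t.
Proof. by rewrite /osc_cos mulrN cosN. Qed.

Lemma osc_sinN nu t : osc_sin nu (- t) = - osc_sin nu t.
Proof. by rewrite /osc_sin mulrN sinN mulNr; case: ifP. Qed.

Section Forced.
Variable phi : R -> R.

Definition duhamel_cos (nu t : R) : R := prim (fun s => osc_cos nu s * phi s) t.
Definition duhamel_sin (nu t : R) : R := prim (fun s => osc_sin nu s * phi s) t.

(** The sine kernel at time [t - s] is expanded by the addition formula, so that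
    only primitives with a fixed integrand occur. *)
Definition duhamel (nu t : R) : R :=
  osc_sin nu t * duhamel_cos nu t - osc_cos nu t * duhamel_sin nu t.
Definition duhamel_vel (nu t : R) : R :=
  osc_cos nu t * duhamel_cos nu t + nu ^+ 2 * osc_sin nu t * duhamel_sin nu t.

Lemma duhamel0 nu : duhamel nu 0 = 0.
Proof. by rewrite /duhamel /duhamel_cos /duhamel_sin !prim0 !mulr0 subrr. Qed.

Lemma duhamel_vel0 nu : duhamel_vel nu 0 = 0.
Proof. by rewrite /duhamel_vel /duhamel_cos /duhamel_sin !prim0 !mulr0 addr0. Qed.

Hypothesis cphi : continuous phi.

Lemma osc_cos_phi_continuous nu : continuous (fun s => osc_cos nu s * phi s).
Proof. by move=> s; apply: continuousM; [exact: osc_cos_continuous|exact: cphi]. Qed.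

Lemma osc_sin_phi_continuous nu : continuous (fun s => osc_sin nu s * phi s).
Proof. by move=> s; apply: continuousM; [exact: osc_sin_continuous|exact: cphi]. Qed.

Let dc (nu t : R) :
  is_derive t 1 (duhamel_cos nu) (osc_cos nu t * phi t).
Proof. exact/prim_derive/osc_cos_phi_continuous. Qed.

Let ds (nu t : R) :
  is_derive t 1 (duhamel_sin nu) (osc_sin nu t * phi t).
Proof. exact/prim_derive/osc_sin_phi_continuous. Qed.

Lemma duhamel_derive (nu t : R) : is_derive t 1 (duhamel nu) (duhamel_vel nu t).
Proof.
have H := is_deriveB (is_deriveM (osc_sin_derive nu t) (dc nu t))
  (is_deriveM (osc_cos_derive nu t) (ds nu t)).
by apply: (is_derive_eq H); rewrite /GRing.scale /= /duhamel_vel; ring.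
Qed.

Lemma duhamel_vel_derive (nu t : R) :
  is_derive t 1 (duhamel_vel nu) (- nu ^+ 2 * duhamel nu t + phi t).
Proof.
have H := is_deriveD (is_deriveM (osc_cos_derive nu t) (dc nu t))
  (is_deriveM (is_deriveM (is_derive_cst (nu ^+ 2) t 1) (osc_sin_derive nu t)) (ds nu t)).
apply: (is_derive_eq H).
have := osc_cos2_sin2 nu t; rewrite /GRing.scale /= /cst fctE /duhamel => E.
transitivity (- nu ^+ 2 * (osc_sin nu t * duhamel_cos nu t
    - osc_cos nu t * duhamel_sin nu t)
  + (osc_cos nu t ^+ 2 + nu ^+ 2 * osc_sin nu t ^+ 2) * phi t); first by ring.
by rewrite E mul1r.
Qed.

End Forced.

(** The kernels are at most 1 in modulus after multiplication of the sine kernel by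
    [nu]. The bounds are thus uniform in the frequency, which makes the force of the
    whole field a Lipschitz functional. *)
Lemma duhamel_dist (phi1 phi2 : R -> R) (nu t e : R) :
    continuous phi1 -> continuous phi2 ->
    (forall s, between 0 t s -> `|phi1 s - phi2 s| <= e) ->
  `|nu * duhamel phi1 nu t - nu * duhamel phi2 nu t| <= 2 * e * `|t| /\
  `|duhamel_vel phi1 nu t - duhamel_vel phi2 nu t| <= 2 * e * `|t|.
Proof.
move=> c1 c2 H.
have e0 : 0 <= e.
  apply: le_trans (H 0 _) => //; rewrite /between.
  by case: (leP 0 t) => [->|/ltW ->]; rewrite lexx.
have te0 : 0 <= e * `|t| by rewrite mulr_ge0.
have dC : `|duhamel_cos phi1 nu t - duhamel_cos phi2 nu t| <= e * `|t|.
  apply: prim_dist; [exact: osc_cos_phi_continuous..|].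
  move=> r /H Hr; rewrite -mulrBr normrM -[leRHS]mul1r.
  by apply: ler_pM => //; exact: osc_cos_le1.
have dS : `|nu * (duhamel_sin phi1 nu t - duhamel_sin phi2 nu t)| <= e * `|t|.
  have [->|n0] := eqVneq nu 0; first by rewrite mul0r normr0.
  rewrite normrM -ler_pdivlMl ?normr_gt0 // mulrA.
  apply: prim_dist; [exact: osc_sin_phi_continuous..|].
  move=> r /H Hr; rewrite -mulrBr ler_pdivlMl ?normr_gt0 // -normrM mulrA normrM.
  by rewrite -[leRHS]mul1r; apply: ler_pM => //; exact: osc_sin_le1.
have P a b : `|a| <= 1 -> `|b| <= e * `|t| -> `|a * b| <= e * `|t|.
  by move=> a1 bt; rewrite normrM -[leRHS]mul1r; apply: ler_pM.
split.
- have -> : nu * duhamel phi1 nu t - nu * duhamel phi2 nu t =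
    nu * osc_sin nu t * (duhamel_cos phi1 nu t - duhamel_cos phi2 nu t) -
    osc_cos nu t * (nu * (duhamel_sin phi1 nu t - duhamel_sin phi2 nu t)).
    by rewrite /duhamel; ring.
  apply: le_trans (ler_normB _ _) _.
  rewrite (_ : 2 * e * `|t| = e * `|t| + e * `|t|); last by ring.
  apply: lerD.
    by apply: P => //; exact: osc_sin_le1.
  by apply: P => //; exact: osc_cos_le1.
- have -> : duhamel_vel phi1 nu t - duhamel_vel phi2 nu t =
    osc_cos nu t * (duhamel_cos phi1 nu t - duhamel_cos phi2 nu t) +
    nu * osc_sin nu t * (nu * (duhamel_sin phi1 nu t - duhamel_sin phi2 nu t)).
    by rewrite /duhamel_vel; ring.
  apply: le_trans (ler_normD _ _) _.
  rewrite (_ : 2 * e * `|t| = e * `|t| + e * `|t|); last by ring.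
  apply: lerD.
    by apply: P => //; exact: osc_cos_le1.
  by apply: P => //; exact: osc_sin_le1.
Qed.

Lemma prim_cst0 : prim (fun=> 0 : R) = fun=> 0.
Proof.
apply/esym/prim_unique => //; exact: cst_continuous.
Qed.

Lemma duhamel_le (phi : R -> R) (nu t B : R) : continuous phi ->
    (forall s, between 0 t s -> `|phi s| <= B) ->
  `|nu * duhamel phi nu t| <= 2 * B * `|t| /\
  `|duhamel_vel phi nu t| <= 2 * B * `|t|.
Proof.
move=> cphi H.
have c0 : continuous (fun _ : R => 0 : R) by exact: cst_continuous.
have [|] := @duhamel_dist phi (fun=> 0) nu t B cphi c0.
  by move=> s /H; rewrite subr0.
have z (g : R -> R) : (fun s => g s * 0) = fun=> 0.
  by apply/funext => s; rewrite mulr0.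
have d0 : duhamel (fun=> 0) nu t = 0.
  by rewrite /duhamel /duhamel_cos /duhamel_sin !z prim_cst0 !mulr0 subrr.
have v0 : duhamel_vel (fun=> 0) nu t = 0.
  by rewrite /duhamel_vel /duhamel_cos /duhamel_sin !z prim_cst0 !mulr0 addr0.
by rewrite d0 v0 mulr0 !subr0.
Qed.

Lemma prim_reverse (h : R -> R) t : continuous h ->
  prim (h \o -%R) t = - prim h (- t).
Proof.
move=> ch.
have chN : continuous (h \o -%R).
  by move=> s; apply: continuous_comp; [exact: opp_continuous|exact: ch].
suff -> : prim (h \o -%R) = fun s => - prim h (- s) by [].
apply/esym/prim_unique => //; first by rewrite oppr0 prim0 oppr0.
move=> s.
have H := is_deriveN (is_derive1_comp (prim_derive (- s) ch)
  (is_deriveN (is_derive_id s 1))).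
by apply: (is_derive_eq H); rewrite /= mulrN1 opprK.
Qed.

Lemma prim_opp (h : R -> R) t : continuous h ->
  prim (fun s => - h s) t = - prim h t.
Proof.
move=> ch; suff -> : prim (fun s => - h s) = fun s => - prim h s by [].
apply/esym/prim_unique => [|//|s].
- by move=> s; apply: continuousN; exact: ch.
- by rewrite prim0 oppr0.
- exact: is_deriveN (prim_derive s ch).
Qed.

(** The sine kernel is odd and the cosine kernel is even in time. *)
Lemma duhamel_reverse (phi : R -> R) nu t : continuous phi ->
  duhamel (phi \o -%R) nu t = duhamel phi nu (- t).
Proof.
move=> cphi; rewrite /duhamel osc_sinN osc_cosN.
have -> : duhamel_cos (phi \o -%R) nu t = - duhamel_cos phi nu (- t).
  rewrite /duhamel_cos -prim_reverse; last exact: osc_cos_phi_continuous.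
  by congr (prim _ _); apply/funext => s /=; rewrite osc_cosN.
have -> : duhamel_sin (phi \o -%R) nu t = duhamel_sin phi nu (- t).
  rewrite /duhamel_sin -[RHS]opprK -prim_reverse; last exact: osc_sin_phi_continuous.
  rewrite -prim_opp.
    by congr (prim _ _); apply/funext => s /=; rewrite osc_sinN mulNr opprK.
  move=> s; apply: (@continuous_comp _ _ _ -%R (fun s => osc_sin nu s * phi s)).
    exact: opp_continuous.
  exact: osc_sin_phi_continuous.
by ring.
Qed.

Lemma cos_lipschitz (a b : R) : `|cos a - cos b| <= `|a - b|.
Proof.
have := @mvt_between R b a cos (fun x => - sin x) 1.
by rewrite !mul1r; apply=> x _; rewrite normrN sin_max.
Qed.

Lemma sin_lipschitz (a b : R) : `|sin a - sin b| <= `|a - b|.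
Proof.
have := @mvt_between R b a sin cos 1.
by rewrite !mul1r; apply=> x _; exact: cos_max.
Qed.

(** The integral is Lipschitz, hence continuous, in the parameter. *)
Lemma prim_param_measurable (g : R -> R) (phi : R -> R) t :
    continuous g -> (forall a b, `|g a - g b| <= `|a - b|) -> continuous phi ->
  measurable_fun [set: R] (fun nu => prim (fun s => g (nu * s) * phi s) t).
Proof.
move=> cg lg cphi; apply: continuous_measurable_fun => nu.
have [B B0 HB] := continuous_bounded `|t| cphi.
have ch (n : R) : continuous (fun s : R => g (n * s) * phi s).
  move=> s; apply: continuousM; last exact: cphi.
  by apply: (@continuous_comp _ _ _ ( *%R n) g); [exact: mulrl_continuous|exact: cg].
have lip (n : R) : `|prim (fun s => g (nu * s) * phi s) t -
    prim (fun s => g (n * s) * phi s) t| <= `|nu - n| * (`|t| * B * `|t|).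
  rewrite 2!mulrA; apply: prim_dist => // r /between_abs rt.
  rewrite -mulrBl normrM; apply: ler_pM => //; last exact: HB.
  by apply: le_trans (lg _ _) _; rewrite -mulrBl normrM ler_wpM2l.
set K := `|t| * B * `|t| in lip.
have K0 : 0 <= K by rewrite !mulr_ge0.
apply/cvgrPdist_le => e e0.
near=> n; apply: le_trans (lip n) _.
have : `|nu - n| <= e / (K + 1).
  by near: n; apply: cvgr_dist_le; [exact: cvg_id|rewrite divr_gt0 // ltr_wpDl].
rewrite ler_pdivlMr ?ltr_wpDl //; apply: le_trans.
by rewrite ler_wpM2l // lerDl.
Unshelve. all: by end_near. Qed.

Lemma osc_cos_measurable t : measurable_fun [set: R] (osc_cos ^~ t).
Proof.
apply: (@measurableT_comp _ _ _ _ _ _ (@cos R)).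
  by apply: continuous_measurable_fun; exact: continuous_cos.
exact: mulrr_measurable.
Qed.

Lemma osc_sin_measurable t : measurable_fun [set: R] (osc_sin ^~ t).
Proof.
apply: measurable_fun_ifT; [exact: measurable_fun_eqr|exact: measurable_cst|].
apply: measurable_funM; last exact: measurable_inv.
apply: (@measurableT_comp _ _ _ _ _ _ (@sin R)).
  by apply: continuous_measurable_fun; exact: continuous_sin.
exact: mulrr_measurable.
Qed.

Section ForcedMeasurable.
Variable phi : R -> R.
Hypothesis cphi : continuous phi.

Lemma duhamel_cos_measurable t : measurable_fun [set: R] (duhamel_cos phi ^~ t).
Proof.
by apply: prim_param_measurable => //; [exact: continuous_cos|exact: cos_lipschitz].
Qed.

(** Dividing by the frequency outside the integral leaves the bounded kernel [sin];
    the null frequency is a single point. *)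
Lemma duhamel_sin_measurable t : measurable_fun [set: R] (duhamel_sin phi ^~ t).
Proof.
have -> : duhamel_sin phi ^~ t = fun nu => if nu == 0 then duhamel_sin phi 0 t else
    prim (fun s => sin (nu * s) * phi s) t / nu.
  apply/funext => nu; case: eqP => [->//|/eqP n0].
  have ch : continuous (fun s : R => sin (nu * s) * phi s).
    move=> s; apply: continuousM; last exact: cphi.
    apply: (@continuous_comp _ _ _ ( *%R nu) sin); first exact: mulrl_continuous.
    exact: continuous_sin.
  pose H s := prim (fun s => sin (nu * s) * phi s) s / nu.
  suff -> : duhamel_sin phi nu = H by [].
  apply/esym/prim_unique.
  - exact: osc_sin_phi_continuous.
  - by rewrite /H prim0 mul0r.
  - move=> s; have D := is_derive1_comp (is_derive_mulr nu^-1 _) (prim_derive s ch).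
    by apply: (is_derive_eq D); rewrite -osc_sinM; field.
apply: measurable_fun_ifT; [exact: measurable_fun_eqr|exact: measurable_cst|].
apply: measurable_funM; last exact: measurable_inv.
by apply: prim_param_measurable => //; [exact: continuous_sin|exact: sin_lipschitz].
Qed.

Lemma duhamel_measurable t : measurable_fun [set: R] (duhamel phi ^~ t).
Proof.
apply: measurable_funB; apply: measurable_funM.
- exact: osc_sin_measurable.
- exact: duhamel_cos_measurable.
- exact: osc_cos_measurable.
- exact: duhamel_sin_measurable.
Qed.

Lemma duhamel_vel_measurable t : measurable_fun [set: R] (duhamel_vel phi ^~ t).
Proof.
apply: measurable_funD; apply: measurable_funM.
- exact: osc_cos_measurable.
- exact: duhamel_cos_measurable.
- apply: measurable_funM; last exact: osc_sin_measurable.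
  by apply: measurable_funX; exact: measurable_id.
- exact: duhamel_sin_measurable.
Qed.

End ForcedMeasurable.

End HarmonicOscillator.

(** * The field of oscillators *)

Section RealIntegrals.
Variable R : realType.
Local Notation mu := (@lebesgue_measure R).
Local Notation intg f := (mu.-integrable [set: R] (fun nu : R => (f nu)%:E)).

Lemma intg_measurable (f : R -> R) : intg f -> measurable_fun [set: R] f.
Proof. by move=> /measurable_int /measurable_EFinP. Qed.

Lemma intg_dominated (f g : R -> R) : measurable_fun [set: R] f ->
  (forall nu, `|f nu| <= g nu) -> intg g -> intg f.
Proof.
move=> mf fg ig; apply: (le_integrable _ _ _ ig) => //.
  exact/measurable_EFinP.
by move=> x _ /=; rewrite lee_fin (le_trans (fg x)) // ler_norm.
Qed.

Lemma intgD (f g : R -> R) : intg f -> intg g -> intg (fun nu => f nu + g nu).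
Proof. by move=> fi gi; exact: (integrableD measurableT fi gi). Qed.

Lemma intgZ (k : R) (f : R -> R) : intg f -> intg (fun nu => k * f nu).
Proof. by move=> fi; exact: (integrableZl measurableT k fi). Qed.

Lemma Rintegral_le (f g : R -> R) : intg f -> intg g ->
  (forall nu, f nu <= g nu) -> \int[mu]_nu f nu <= \int[mu]_nu g nu.
Proof. by move=> fi gi fg; apply: le_Rintegral. Qed.

Lemma Rintegral_norm_le (f g : R -> R) : intg f -> intg g ->
  (forall nu, `|f nu| <= g nu) -> `|\int[mu]_nu f nu| <= \int[mu]_nu g nu.
Proof.
move=> fi gi fg; apply: le_trans (le_normr_Rintegral _ fi) _ => //.
apply: Rintegral_le => //; apply: intg_dominated gi => //.
  apply: measurableT_comp; [exact: normr_measurable|exact: intg_measurable].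
by move=> nu; rewrite normr_id.
Qed.

Lemma ae_imply (P Q : R -> Prop) : {ae mu, forall nu, P nu} ->
  (forall nu, P nu -> Q nu) -> {ae mu, forall nu, Q nu}.
Proof.
move=> [N [mN N0 sub]] PQ; exists N; split=> // nu nQ.
by apply: sub => /= Pnu; apply: nQ; exact: PQ.
Qed.

Lemma ae_and (P Q : R -> Prop) : {ae mu, forall nu, P nu} ->
  {ae mu, forall nu, Q nu} -> {ae mu, forall nu, P nu /\ Q nu}.
Proof.
move=> [N [mN N0 sub]] [M [mM M0 subM]]; exists (N `|` M); split.
- exact: measurableU.
- by rewrite -N0; exact: measureU0.
- move=> nu /= nPQ; apply: contrapT => /not_orP[nN nM]; apply: nPQ.
  by split; apply: contrapT => H; [apply: nN; exact: sub|apply: nM; exact: subM].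
Qed.

Lemma Rintegral_ae (f g : R -> R) :
    measurable_fun [set: R] f -> measurable_fun [set: R] g ->
    {ae mu, forall nu, f nu = g nu} ->
  \int[mu]_nu f nu = \int[mu]_nu g nu.
Proof.
move=> mf mg fg; congr fine; apply: ae_eq_integral => //.
- exact/measurable_EFinP.
- exact/measurable_EFinP.
- by apply: (ae_imply fg) => nu -> _.
Qed.

Lemma intg_ae (f g : R -> R) :
    measurable_fun [set: R] f -> {ae mu, forall nu, f nu = g nu} ->
  intg g -> intg f.
Proof.
move=> mf fg gi; have mg := intg_measurable gi.
apply/integrableP; split; first exact/measurable_EFinP.
have /integrableP[_] := gi.
apply: le_lt_trans; rewrite le_eqVlt; apply/orP; left; apply/eqP.
apply: ae_eq_integral => //.
- by apply: measurableT_comp => //; exact/measurable_EFinP.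
- by apply: measurableT_comp => //; exact/measurable_EFinP.
- by apply: (ae_imply fg) => nu -> _.
Qed.

Lemma EFin_Rintegral (f : R -> R) : intg f ->
  (\int[mu]_nu (f nu)%:E)%E = (\int[mu]_nu f nu)%:E.
Proof. by move=> fi; rewrite fineK //; exact: integrable_fin_num. Qed.

Lemma ae_neq0 : {ae mu, forall nu : R, nu != 0}.
Proof.
exists [set 0]; split; [exact: measurable_set1|exact: lebesgue_measure_set1|].
by move=> nu /= /negP; rewrite negbK => /eqP.
Qed.

(** A dominating function on each bounded interval of times is enough, since
    derivability is local. *)
Lemma is_derive_integral (h dh : R -> R -> R) (t : R) :
    (forall s, measurable_fun [set: R] (h s)) ->
    (forall nu (s : R), is_derive s 1 (h ^~ nu) (dh s nu)) ->
    (forall T : R, exists2 G, intg G & forall s nu, `|s| <= T ->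
       `|h s nu| <= G nu /\ `|dh s nu| <= G nu) ->
  is_derive t 1 (fun s => \int[mu]_nu h s nu) (\int[mu]_nu dh t nu).
Proof.
move=> mh dhP dom.
have [G Gi HG] := dom (`|t| + 1).
have Ile s : `]t - 1, t + 1[%classic s -> `|s| <= `|t| + 1.
  rewrite /= in_itv /= => /andP[s1 s2].
  rewrite -[s](subrK t) addrC; apply: le_trans (ler_normD _ _) _.
  by rewrite lerD2l ler_norml; apply/andP; split; lra.
have It : `]t - 1, t + 1[%classic t by rewrite /= in_itv /=; apply/andP; split; lra.
have G0 nu : 0 <= G nu by have [H _] := HG t nu (Ile t It); exact: le_trans H.
have hi s : `]t - 1, t + 1[%classic s -> mu.-integrable [set: R] (EFin \o h s).
  by move=> /Ile sT; apply: intg_dominated Gi => // nu; case: (HG s nu sT).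
have hd s nu : `]t - 1, t + 1[%classic s -> [set: R] nu -> derivable (h ^~ nu) s 1.
  by move=> _ _; case: (dhP nu s).
have dE s nu : partial1of2 h s nu = dh s nu.
  by rewrite /partial1of2 derive1E; case: (dhP nu s).
have hG s nu : `]t - 1, t + 1[%classic s -> [set: R] nu -> `|partial1of2 h s nu| <= G nu.
  by move=> /Ile sT _; rewrite dE; case: (HG s nu sT).
have D := @derivable_under_integral R _ _ mu h _ measurableT t _ _ It hi hd G G0 Gi hG.
have V := @differentiation_under_integral R _ _ mu h _ measurableT t _ _ It hi hd G G0 Gi hG.
split; first exact: D.
rewrite -derive1E V; apply: eq_Rintegral => nu _; exact: dE.
Qed.

End RealIntegrals.

Section Field.
Variable R : realType.
Local Notation mu := (@lebesgue_measure R).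
Local Notation intg f := (mu.-integrable [set: R] (fun nu : R => (f nu)%:E)).

(** The coefficient kappa / rho is 0 where rho = 0, by the convention on the
    inverse of 0. *)
Definition ratio (rho kappa : R -> R) (nu : R) : R := kappa nu / rho nu.

Record oscillators (rho kappa xi0 dxi0 : R -> R) : Prop := Oscillators {
  osc_rho_meas : measurable_fun [set: R] rho ;
  osc_kappa_meas : measurable_fun [set: R] kappa ;
  osc_xi0_meas : measurable_fun [set: R] xi0 ;
  osc_dxi0_meas : measurable_fun [set: R] dxi0 ;
  osc_rho_ge0 : forall nu, 0 <= rho nu ;
  osc_kappa_ae : {ae mu, forall nu, kappa nu = rho nu * ratio rho kappa nu} ;
  osc_int_ratio : intg (fun nu => rho nu * ratio rho kappa nu ^+ 2) ;
  osc_int_ratio_nu : intg (fun nu => rho nu * (ratio rho kappa nu / nu) ^+ 2) ;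
  osc_int_init : intg (fun nu => rho nu * (dxi0 nu ^+ 2 + nu ^+ 2 * xi0 nu ^+ 2))
}.

Lemma oscillators_reverse rho kappa xi0 dxi0 :
  oscillators rho kappa xi0 dxi0 -> oscillators rho kappa xi0 (fun nu => - dxi0 nu).
Proof.
move=> [mr mk mx mdx r0 ka ic icn ii]; split=> //.
  exact: measurableT_comp.
by under eq_fun do rewrite sqrrN.
Qed.

Variables rho kappa xi0 dxi0 : R -> R.

(** The force on each oscillator is [ratio * phi], after division of its equation
    by [rho]; where rho vanishes the oscillator is free. *)
Definition osc_pos (phi : R -> R) (nu t : R) : R :=
  xi0 nu * osc_cos nu t + dxi0 nu * osc_sin nu t
  + ratio rho kappa nu * duhamel phi nu t.
Definition osc_vel (phi : R -> R) (nu t : R) : R :=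
  - nu ^+ 2 * xi0 nu * osc_sin nu t + dxi0 nu * osc_cos nu t
  + ratio rho kappa nu * duhamel_vel phi nu t.

Definition field_force (phi : R -> R) (t : R) : R :=
  \int[mu]_nu (kappa nu * osc_pos phi nu t).
(** The time derivative of the force: the integrand is [kappa] times the velocity,
    written with [rho * ratio], which equals [kappa] almost everywhere. *)
Definition field_power (phi : R -> R) (t : R) : R :=
  \int[mu]_nu (rho nu * ratio rho kappa nu * osc_vel phi nu t).
Definition field_energy (phi : R -> R) (t : R) : R :=
  \int[mu]_nu (rho nu * (osc_vel phi nu t ^+ 2 + nu ^+ 2 * osc_pos phi nu t ^+ 2)).

Lemma osc_pos0 phi nu : osc_pos phi nu 0 = xi0 nu.
Proof.
by rewrite /osc_pos osc_cos0 osc_sin0 duhamel0 !mulr0 mulr1 !addr0.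
Qed.

Lemma osc_vel0 phi nu : osc_vel phi nu 0 = dxi0 nu.
Proof.
by rewrite /osc_vel osc_cos0 osc_sin0 duhamel_vel0 !mulr0 mulr1 addr0 add0r.
Qed.

Lemma is_derive_Ml (k : R) (g : R -> R) (t dg : R) :
  is_derive t 1 g dg -> is_derive t 1 (fun s => k * g s) (k * dg).
Proof. by move=> H; exact: (is_deriveZ k H). Qed.

Lemma is_derive_sq (g : R -> R) (t dg : R) :
  is_derive t 1 g dg -> is_derive t 1 (fun s => g s ^+ 2) (2 * g t * dg).
Proof.
move=> H; apply: (is_derive_eq (is_deriveM H H)).
by rewrite /GRing.scale /=; ring.
Qed.

Section GivenForce.
Variable phi : R -> R.
Hypothesis cphi : continuous phi.

Lemma osc_pos_derive (nu t : R) :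
  is_derive t 1 (osc_pos phi nu) (osc_vel phi nu t).
Proof.
have H := is_deriveD (is_deriveD
    (is_derive_Ml (xi0 nu) (osc_cos_derive nu t))
    (is_derive_Ml (dxi0 nu) (osc_sin_derive nu t)))
  (is_derive_Ml (ratio rho kappa nu) (duhamel_derive cphi nu t)).
by apply: (is_derive_eq H); rewrite /osc_vel; ring.
Qed.

Lemma osc_vel_derive (nu t : R) :
  is_derive t 1 (osc_vel phi nu)
    (- nu ^+ 2 * osc_pos phi nu t + ratio rho kappa nu * phi t).
Proof.
have H := is_deriveD (is_deriveD
    (is_derive_Ml (- nu ^+ 2 * xi0 nu) (osc_sin_derive nu t))
    (is_derive_Ml (dxi0 nu) (osc_cos_derive nu t)))
  (is_derive_Ml (ratio rho kappa nu) (duhamel_vel_derive cphi nu t)).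
by apply: (is_derive_eq H); rewrite /osc_pos; ring.
Qed.

End GivenForce.

Hypothesis O : oscillators rho kappa xi0 dxi0.

Let c := ratio rho kappa.
(* Equal to [kappa] away from the null frequency and from the zeros of [rho]: its
   products with positions are bounded everywhere by the integrable weight. *)
Let kap nu := rho nu * (c nu / nu * nu).

Let ratio_meas : measurable_fun [set: R] c.
Proof.
apply: measurable_funM; first exact: (osc_kappa_meas O).
by apply: measurable_funV; exact: (osc_rho_meas O).
Qed.

Let kap_meas : measurable_fun [set: R] kap.
Proof.
apply: measurable_funM; first exact: (osc_rho_meas O).
apply: measurable_funM; last exact: measurable_id.
by apply: measurable_funM; [exact: ratio_meas|exact: measurable_inv].
Qed.

Let kappa_kap : {ae mu, forall nu, kappa nu = kap nu}.
Proof.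
apply: (ae_imply (ae_and (osc_kappa_ae O) (ae_neq0 R))) => nu [-> n0].
by rewrite /kap divfK.
Qed.

Lemma osc_pos_measurable phi t : continuous phi ->
  measurable_fun [set: R] (osc_pos phi ^~ t).
Proof.
move=> cphi; apply: measurable_funD; first apply: measurable_funD.
- by apply: measurable_funM; [exact: (osc_xi0_meas O)|exact: osc_cos_measurable].
- by apply: measurable_funM; [exact: (osc_dxi0_meas O)|exact: osc_sin_measurable].
- by apply: measurable_funM; [exact: ratio_meas|exact: duhamel_measurable].
Qed.

Lemma osc_vel_measurable phi t : continuous phi ->
  measurable_fun [set: R] (osc_vel phi ^~ t).
Proof.
move=> cphi; apply: measurable_funD; first apply: measurable_funD.
- apply: measurable_funM; last exact: osc_sin_measurable.
  apply: measurable_funM; last exact: (osc_xi0_meas O).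
  apply: measurableT_comp; first exact: oppr_measurable.
  by apply: measurable_funX; exact: measurable_id.
- by apply: measurable_funM; [exact: (osc_dxi0_meas O)|exact: osc_cos_measurable].
- by apply: measurable_funM; [exact: ratio_meas|exact: duhamel_vel_measurable].
Qed.

(** The energy density at time 0 plus the two densities of the coupling. By the
    inequality [2 x y <= x ^+ 2 + y ^+ 2] all densities met below, at a bounded time
    and under a bounded force, are at most a multiple of it. *)
Definition weight (nu : R) : R :=
  rho nu * (dxi0 nu ^+ 2 + nu ^+ 2 * xi0 nu ^+ 2)
  + (rho nu * ratio rho kappa nu ^+ 2 + rho nu * (ratio rho kappa nu / nu) ^+ 2).

Lemma weight_int : intg weight.
Proof.
apply: intgD; first exact: (osc_int_init O).
by apply: intgD; [exact: (osc_int_ratio O)|exact: (osc_int_ratio_nu O)].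
Qed.

Let weight_terms_ge0 nu :
  [/\ 0 <= rho nu * (dxi0 nu ^+ 2 + nu ^+ 2 * xi0 nu ^+ 2),
      0 <= rho nu * ratio rho kappa nu ^+ 2 &
      0 <= rho nu * (ratio rho kappa nu / nu) ^+ 2].
Proof.
have r0 := osc_rho_ge0 O nu.
split; apply: mulr_ge0; rewrite ?sqr_ge0 //.
by apply: addr_ge0; first exact: sqr_ge0; apply: mulr_ge0; exact: sqr_ge0.
Qed.

Lemma weight_ge0 nu : 0 <= weight nu.
Proof.
have [] := weight_terms_ge0 nu; rewrite /weight; lra.
Qed.

Definition weight_total : R := \int[mu]_nu weight nu.

Lemma weight_total_ge0 : 0 <= weight_total.
Proof. by apply: Rintegral_ge0 => nu _; exact: weight_ge0. Qed.

Let osc_bound phi (nu t T B : R) : continuous phi -> 0 <= B -> `|t| <= T ->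
    (forall s, between 0 t s -> `|phi s| <= B) ->
  `|nu * osc_pos phi nu t| <= `|nu * xi0 nu| + `|dxi0 nu| + `|c nu| * (2 * B * T) /\
  `|osc_vel phi nu t| <= `|nu * xi0 nu| + `|dxi0 nu| + `|c nu| * (2 * B * T).
Proof.
move=> cphi B0 tT HB; have [D1 D2] := duhamel_le nu cphi HB.
have BT : 2 * B * `|t| <= 2 * B * T by rewrite ler_wpM2l // mulr_ge0.
have P a b : `|b| <= 1 -> `|a * b| <= `|a| by move=> b1; rewrite normrM ler_piMr.
split.
- have -> : nu * osc_pos phi nu t = nu * xi0 nu * osc_cos nu t
    + dxi0 nu * (nu * osc_sin nu t) + c nu * (nu * duhamel phi nu t).
    by rewrite /osc_pos /c; ring.
  apply: le_trans (ler_normD _ _) _; apply: lerD.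
    apply: le_trans (ler_normD _ _) _; apply: lerD; apply: P.
      exact: osc_cos_le1.
    exact: osc_sin_le1.
  by rewrite normrM ler_wpM2l // (le_trans D1).
- have -> : osc_vel phi nu t = - (nu * xi0 nu) * (nu * osc_sin nu t)
    + dxi0 nu * osc_cos nu t + c nu * duhamel_vel phi nu t.
    by rewrite /osc_vel /c; ring.
  apply: le_trans (ler_normD _ _) _; apply: lerD.
    apply: le_trans (ler_normD _ _) _; rewrite -(normrN (nu * xi0 nu)).
    by apply: lerD; apply: P; [exact: osc_sin_le1|exact: osc_cos_le1].
  by rewrite normrM ler_wpM2l // (le_trans D2).
Qed.

(** The 3 comes from the square of a sum of three terms, one for each of the initial
   position, the initial velocity and the force; the 4 leaves room for the second
   factor of the products. *)
Definition dom_cst (b : R) : R := 4 + 3 * b ^+ 2.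

Let sq_le (nu w b : R) : 0 <= b ->
    `|w| <= `|nu * xi0 nu| + `|dxi0 nu| + `|c nu| * b ->
  rho nu * w ^+ 2 <= (3 + 3 * b ^+ 2) * weight nu.
Proof.
move=> b0 Hw; have r0 := osc_rho_ge0 O nu.
have w2 : w ^+ 2 <= 3 * ((nu * xi0 nu) ^+ 2 + dxi0 nu ^+ 2 + (c nu * b) ^+ 2).
  rewrite -[w ^+ 2]ger0_norm ?sqr_ge0 // normrX.
  apply: (@le_trans _ _ ((`|nu * xi0 nu| + `|dxi0 nu| + `|c nu| * b) ^+ 2)).
    by rewrite ler_sqr // nnegrE // !addr_ge0 // mulr_ge0.
  rewrite -(real_normK (num_real (nu * xi0 nu))) -(real_normK (num_real (dxi0 nu))).
  rewrite -(real_normK (num_real (c nu * b))) [`|c nu * b|]normrM (ger0_norm b0).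
  set x := `|nu * xi0 nu|; set y := `|dxi0 nu|; set z := `|c nu| * b.
  have := sqr_ge0 (x - y); have := sqr_ge0 (x - z); have := sqr_ge0 (y - z).
  by rewrite !expr2; lra.
apply: (@le_trans _ _ (rho nu * (3 * ((nu * xi0 nu) ^+ 2 + dxi0 nu ^+ 2 + (c nu * b) ^+ 2)))).
  by rewrite ler_wpM2l.
have [e3 e2 e1] := weight_terms_ge0 nu.
have b2 : 0 <= b ^+ 2 by rewrite sqr_ge0.
rewrite /weight -/c in e1 e2 *.
set a1 := rho nu * _ in e1 *; set a2 := rho nu * _ in e2 *; set a3 := rho nu * _ in e3 *.
have -> : rho nu * (3 * ((nu * xi0 nu) ^+ 2 + dxi0 nu ^+ 2 + (c nu * b) ^+ 2)) =
  3 * a3 + 3 * b ^+ 2 * a2 by rewrite /a3 /a2; ring.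
have m1 : 0 <= b ^+ 2 * a3 by exact: mulr_ge0.
have m2 : 0 <= b ^+ 2 * a1 by exact: mulr_ge0.
have -> : (3 + 3 * b ^+ 2) * (a3 + (a2 + a1)) = 3 * a3 + 3 * b ^+ 2 * a2 +
  (3 * (a2 + a1) + 3 * (b ^+ 2 * a3) + 3 * (b ^+ 2 * a1)) by ring.
by rewrite lerDl !addr_ge0 // mulr_ge0 // addr_ge0.
Qed.

Let dom_sq (nu : R) : rho nu * (c nu / nu) ^+ 2 <= weight nu /\
  rho nu * c nu ^+ 2 <= weight nu /\ rho nu * (c nu / nu * nu) ^+ 2 <= weight nu.
Proof.
have r0 := osc_rho_ge0 O nu.
have [e3 e2 e1] := weight_terms_ge0 nu.
rewrite -/c in e1 e2.
have w2 : rho nu * c nu ^+ 2 <= weight nu by rewrite /weight -/c; lra.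
split; first by rewrite /weight -/c; lra.
split=> //; have [->|n0] := eqVneq nu 0; last by rewrite divfK.
by rewrite mulr0 expr0n mulr0; exact: weight_ge0.
Qed.

Let prod_le (nu x w b : R) : rho nu * x ^+ 2 <= weight nu ->
    rho nu * w ^+ 2 <= (3 + 3 * b ^+ 2) * weight nu ->
  `|rho nu * x * w| <= dom_cst b * weight nu.
Proof.
move=> H1 H2; have r0 := osc_rho_ge0 O nu.
have w0 := weight_ge0 nu.
rewrite -mulrA normrM ger0_norm // normrM.
have : rho nu * (`|x| * `|w|) <= rho nu * ((x ^+ 2 + w ^+ 2) / 2).
  rewrite ler_wpM2l // -(real_normK (num_real x)) -(real_normK (num_real w)).
  by have := sqr_ge0 (`|x| - `|w|); rewrite !expr2; lra.
move/le_trans; apply; rewrite mulrA mulrDr /dom_cst.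
have b2 : 0 <= b ^+ 2 * weight nu by rewrite mulr_ge0 // sqr_ge0.
by move: H1 H2; lra.
Qed.

Section Bounds.
Variables (phi : R -> R) (t T B : R).
Hypotheses (cphi : continuous phi) (B0 : 0 <= B) (tT : `|t| <= T).
Hypothesis HB : forall s, between 0 t s -> `|phi s| <= B.
Let b := 2 * B * T.
Let b0 : 0 <= b.
Proof. by rewrite /b !mulr_ge0 // (le_trans _ tT). Qed.

Let pos_sq nu : rho nu * (nu * osc_pos phi nu t) ^+ 2 <= (3 + 3 * b ^+ 2) * weight nu.
Proof. by apply: sq_le => //; have [] := osc_bound nu cphi B0 tT HB. Qed.

Let vel_sq nu : rho nu * osc_vel phi nu t ^+ 2 <= (3 + 3 * b ^+ 2) * weight nu.
Proof. by apply: sq_le => //; have [] := osc_bound nu cphi B0 tT HB. Qed.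

Let dom_le nu : (3 + 3 * b ^+ 2) * weight nu <= dom_cst b * weight nu.
Proof.
by rewrite ler_wpM2r ?weight_ge0 // /dom_cst; lra.
Qed.

Lemma vel_sq_le nu : `|rho nu * osc_vel phi nu t ^+ 2| <= dom_cst b * weight nu.
Proof.
rewrite ger0_norm; first exact: le_trans (vel_sq nu) (dom_le nu).
by rewrite mulr_ge0 ?sqr_ge0 // (osc_rho_ge0 O).
Qed.

Lemma pos_sq_le nu :
  `|rho nu * nu ^+ 2 * osc_pos phi nu t ^+ 2| <= dom_cst b * weight nu.
Proof.
rewrite -mulrA -exprMn ger0_norm; first exact: le_trans (pos_sq nu) (dom_le nu).
by rewrite mulr_ge0 ?sqr_ge0 // (osc_rho_ge0 O).
Qed.

Lemma force_density_le nu : `|kap nu * osc_pos phi nu t| <= dom_cst b * weight nu.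
Proof.
have -> : kap nu * osc_pos phi nu t = rho nu * (c nu / nu) * (nu * osc_pos phi nu t).
  by rewrite /kap !mulrA.
by apply: prod_le => //; case: (dom_sq nu).
Qed.

Lemma kap_vel_le nu : `|kap nu * osc_vel phi nu t| <= dom_cst b * weight nu.
Proof. by apply: prod_le => //; case: (dom_sq nu) => _ []. Qed.

Lemma power_density_le nu :
  `|rho nu * c nu * osc_vel phi nu t| <= dom_cst b * weight nu.
Proof. by apply: prod_le => //; case: (dom_sq nu) => _ []. Qed.

End Bounds.

Let dom_weight_int b : intg (fun nu => dom_cst b * weight nu).
Proof. by apply: intgZ; exact: weight_int. Qed.

Let kap_pos_measurable phi t : continuous phi ->
  measurable_fun [set: R] (fun nu => kap nu * osc_pos phi nu t).
Proof.
by move=> cphi; apply: measurable_funM => //; exact: osc_pos_measurable.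
Qed.

Let kap_pos_int phi t : continuous phi -> intg (fun nu => kap nu * osc_pos phi nu t).
Proof.
move=> cphi; have [B B0 HB] := continuous_bounded `|t| cphi.
apply: (intg_dominated _ _ (dom_weight_int (2 * B * `|t|))).
  exact: kap_pos_measurable.
by move=> nu; apply: force_density_le => // s /between_abs; exact: HB.
Qed.

Let kappa_pos_measurable phi t : continuous phi ->
  measurable_fun [set: R] (fun nu => kappa nu * osc_pos phi nu t).
Proof.
move=> cphi; apply: measurable_funM; first exact: (osc_kappa_meas O).
exact: osc_pos_measurable.
Qed.

Lemma force_int phi t : continuous phi ->
  intg (fun nu => kappa nu * osc_pos phi nu t).
Proof.
move=> cphi; apply: (intg_ae _ _ (kap_pos_int t cphi)).
  exact: kappa_pos_measurable.
by apply: (ae_imply kappa_kap) => nu ->.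
Qed.

Let force_kap phi t : continuous phi ->
  field_force phi t = \int[mu]_nu (kap nu * osc_pos phi nu t).
Proof.
move=> cphi; apply: Rintegral_ae.
- exact: kappa_pos_measurable.
- exact: kap_pos_measurable.
- by apply: (ae_imply kappa_kap) => nu ->.
Qed.

Lemma vel_sq_int phi t : continuous phi ->
  intg (fun nu => rho nu * osc_vel phi nu t ^+ 2).
Proof.
move=> cphi; have [B B0 HB] := continuous_bounded `|t| cphi.
apply: (intg_dominated _ _ (dom_weight_int (2 * B * `|t|))).
  apply: measurable_funM; first exact: (osc_rho_meas O).
  by apply: measurable_funX; exact: osc_vel_measurable.
by move=> nu; apply: vel_sq_le => // s /between_abs; exact: HB.
Qed.

Lemma pos_sq_int phi t : continuous phi ->
  intg (fun nu => rho nu * nu ^+ 2 * osc_pos phi nu t ^+ 2).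
Proof.
move=> cphi; have [B B0 HB] := continuous_bounded `|t| cphi.
apply: (intg_dominated _ _ (dom_weight_int (2 * B * `|t|))).
  apply: measurable_funM; last by apply: measurable_funX; exact: osc_pos_measurable.
  apply: measurable_funM; first exact: (osc_rho_meas O).
  by apply: measurable_funX; exact: measurable_id.
by move=> nu; apply: pos_sq_le => // s /between_abs; exact: HB.
Qed.

Lemma energy_int phi t : continuous phi ->
  intg (fun nu => rho nu * (osc_vel phi nu t ^+ 2 + nu ^+ 2 * osc_pos phi nu t ^+ 2)).
Proof.
move=> cphi.
have -> : (fun nu => (rho nu * (osc_vel phi nu t ^+ 2 + nu ^+ 2 * osc_pos phi nu t ^+ 2))%:E)
  = (fun nu => (rho nu * osc_vel phi nu t ^+ 2 + rho nu * nu ^+ 2 * osc_pos phi nu t ^+ 2)%:E).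
  by apply/funext => nu; rewrite mulrDr mulrA.
by apply: intgD; [exact: vel_sq_int|exact: pos_sq_int].
Qed.

Lemma field_energyE phi t : continuous phi ->
  field_energy phi t = \int[mu]_nu (rho nu * osc_vel phi nu t ^+ 2)
    + \int[mu]_nu (rho nu * nu ^+ 2 * osc_pos phi nu t ^+ 2).
Proof.
move=> cphi; rewrite -RintegralD //; last 2 first.
- exact: vel_sq_int.
- exact: pos_sq_int.
by apply: eq_Rintegral => nu _; rewrite mulrDr mulrA.
Qed.

Lemma force_derive phi (t : R) : continuous phi ->
  is_derive t 1 (field_force phi) (field_power phi t).
Proof.
move=> cphi.
have -> : field_force phi = fun s => \int[mu]_nu (kap nu * osc_pos phi nu s).
  by apply/funext => s; exact: force_kap.
have -> : field_power phi t = \int[mu]_nu (kap nu * osc_vel phi nu t).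
  apply: Rintegral_ae.
  - apply: measurable_funM; last exact: osc_vel_measurable.
    by apply: measurable_funM => //; exact: (osc_rho_meas O).
  - by apply: measurable_funM => //; exact: osc_vel_measurable.
  - by apply: (ae_imply (ae_neq0 R)) => nu n0; rewrite /kap divfK.
apply: (@is_derive_integral R (fun s nu => kap nu * osc_pos phi nu s)
  (fun s nu => kap nu * osc_vel phi nu s)).
- by move=> s; exact: kap_pos_measurable.
- by move=> nu s; apply: is_derive_Ml; exact: osc_pos_derive.
- move=> T; have [B B0 HB] := continuous_bounded T cphi.
  exists (fun nu => dom_cst (2 * B * T) * weight nu) => // s nu sT.
  have Hs r : between 0 s r -> `|phi r| <= B.
    by move=> /between_abs rs; apply: HB; exact: le_trans rs sT.
  by split; [exact: force_density_le|exact: kap_vel_le].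
Qed.

(** In the derivative of the density the elastic terms cancel; what is left is the
    work of the force. *)
Lemma energy_derive phi (t : R) : continuous phi ->
  is_derive t 1 (field_energy phi) (2 * phi t * field_power phi t).
Proof.
move=> cphi.
pose dens s nu := rho nu * (osc_vel phi nu s ^+ 2 + nu ^+ 2 * osc_pos phi nu s ^+ 2).
pose ddens s nu := 2 * phi s * (rho nu * c nu * osc_vel phi nu s).
have densD nu (s : R) : is_derive s 1 (dens ^~ nu) (ddens s nu).
  have D := is_derive_Ml (rho nu) (is_deriveD
    (is_derive_sq (osc_vel_derive cphi nu s))
    (is_derive_Ml (nu ^+ 2) (is_derive_sq (osc_pos_derive cphi nu s)))).
  by apply: (is_derive_eq D); rewrite /ddens /c /GRing.scale /=; ring.
have powi : intg (fun nu => rho nu * c nu * osc_vel phi nu t).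
  have [B B0 HB] := continuous_bounded `|t| cphi.
  apply: (intg_dominated _ _ (dom_weight_int (2 * B * `|t|))).
    apply: measurable_funM; last exact: osc_vel_measurable.
    by apply: measurable_funM => //; exact: (osc_rho_meas O).
  by move=> nu; apply: power_density_le => // s /between_abs; exact: HB.
have -> : 2 * phi t * field_power phi t = \int[mu]_nu ddens t nu.
  by rewrite /ddens RintegralZl.
apply: (@is_derive_integral R dens ddens) => //.
- by move=> s; apply: intg_measurable; exact: energy_int.
- move=> T; have [B B0 HB] := continuous_bounded T cphi.
  pose k := dom_cst (2 * B * T).
  exists (fun nu => (2 + 2 * B) * (k * weight nu)).
    by apply: intgZ; exact: dom_weight_int.
  move=> s nu sT.
  have Hs r : between 0 s r -> `|phi r| <= B.
    by move=> /between_abs rs; apply: HB; exact: le_trans rs sT.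
  have W0 : 0 <= k * weight nu.
    have := vel_sq_le cphi B0 sT Hs nu; exact: le_trans.
  split.
  - rewrite /dens mulrDr mulrA; apply: le_trans (ler_normD _ _) _.
    have := vel_sq_le cphi B0 sT Hs nu; have := pos_sq_le cphi B0 sT Hs nu.
    rewrite -/k => H1 H2.
    have : 0 <= 2 * B * (k * weight nu) by apply: mulr_ge0 => //; exact: mulr_ge0.
    by lra.
  - rewrite /ddens normrM.
    have H1 := power_density_le cphi B0 sT Hs nu.
    have H2 : `|2 * phi s| <= 2 * B.
      by rewrite normrM ger0_norm // ler_wpM2l // HB.
    apply: le_trans (ler_pM _ _ H2 H1) _ => //.
    by rewrite -/k; lra.
Qed.

Lemma force_le phi t T B : continuous phi -> 0 <= B -> `|t| <= T ->
    (forall s, between 0 t s -> `|phi s| <= B) ->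
  `|field_force phi t| <= dom_cst (2 * B * T) * weight_total.
Proof.
move=> cphi B0 tT HB; rewrite force_kap // /weight_total -RintegralZl //; last first.
  exact: weight_int.
apply: Rintegral_norm_le.
- exact: kap_pos_int.
- exact: dom_weight_int.
- by move=> nu; exact: force_density_le.
Qed.

(** Only [phi] between times 0 and [t] matters, and it enters linearly through a
    kernel dominated by the weight. With [e = 0] this is causality. *)
Lemma force_dist phi1 phi2 t e : continuous phi1 -> continuous phi2 ->
    (forall s, between 0 t s -> `|phi1 s - phi2 s| <= e) ->
  `|field_force phi1 t - field_force phi2 t| <= 2 * e * `|t| * weight_total.
Proof.
move=> c1 c2 H; rewrite !force_kap // -RintegralB //; try exact: kap_pos_int.
rewrite /weight_total -RintegralZl //; last exact: weight_int.
apply: Rintegral_norm_le.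
- have -> : (fun nu => (kap nu * osc_pos phi1 nu t - kap nu * osc_pos phi2 nu t)%:E) =
   (fun nu => (kap nu * osc_pos phi1 nu t + -1 * (kap nu * osc_pos phi2 nu t))%:E).
    by apply/funext => nu; rewrite mulN1r.
  by apply: intgD; [|apply: intgZ]; exact: kap_pos_int.
- exact/intgZ/weight_int.
move=> nu; have [D _] := duhamel_dist nu c1 c2 H.
have r0 := osc_rho_ge0 O nu.
have -> : kap nu * osc_pos phi1 nu t - kap nu * osc_pos phi2 nu t =
    rho nu * (c nu / nu) * c nu * (nu * duhamel phi1 nu t - nu * duhamel phi2 nu t).
  by rewrite /kap /osc_pos -/c; ring.
rewrite normrM mulrC; apply: ler_pM => //.
rewrite -mulrA normrM ger0_norm // normrM.
have [e3 e2 e1] := weight_terms_ge0 nu; rewrite -/c in e1 e2.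
apply: (@le_trans _ _ (rho nu * (c nu / nu) ^+ 2 + rho nu * c nu ^+ 2)).
  rewrite -mulrDr ler_wpM2l //.
  rewrite -(real_normK (num_real (c nu / nu))) -(real_normK (num_real (c nu))).
  have := sqr_ge0 (`|c nu / nu| - `|c nu|); have := sqr_ge0 `|c nu / nu|.
  by have := sqr_ge0 `|c nu|; rewrite !expr2; lra.
by rewrite /weight -/c; lra.
Qed.

(** Completing the square in each oscillator: the interaction energy costs at
    most what the effective potential subtracts. *)
Lemma energy_ge phi t (y : R) : continuous phi ->
  - (y ^+ 2 / 2 * \int[mu]_nu (rho nu * (ratio rho kappa nu / nu) ^+ 2)) <=
  field_energy phi t / 2 - y * field_force phi t.
Proof.
move=> cphi; rewrite force_kap //.
have iK := osc_int_ratio_nu O.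
have iE := energy_int t cphi.
have iF := kap_pos_int t cphi.
rewrite -RintegralZl // -lerBlDr opprK (mulrC (field_energy phi t)).
rewrite /field_energy -!RintegralZl // addrC -lerBrDr opprK.
rewrite -RintegralD //; try exact: intgZ.
apply: Rintegral_le; [exact: intgZ|by apply: intgD; exact: intgZ|].
move=> nu; have r0 := osc_rho_ge0 O nu.
have H1 : 0 <= rho nu * osc_vel phi nu t ^+ 2 by rewrite mulr_ge0 // sqr_ge0.
have H2 : 0 <= rho nu * (nu * osc_pos phi nu t - y * (c nu / nu)) ^+ 2.
  by rewrite mulr_ge0 // sqr_ge0.
rewrite -/c -subr_ge0.
have -> : 2^-1 * (rho nu * (osc_vel phi nu t ^+ 2 + nu ^+ 2 * osc_pos phi nu t ^+ 2))
   + y ^+ 2 / 2 * (rho nu * (c nu / nu) ^+ 2) - y * (kap nu * osc_pos phi nu t) =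
   2^-1 * (rho nu * osc_vel phi nu t ^+ 2) +
   2^-1 * (rho nu * (nu * osc_pos phi nu t - y * (c nu / nu)) ^+ 2).
  by rewrite /kap; set d := c nu / nu; field.
by rewrite addr_ge0 // mulr_ge0 // invr_ge0.
Qed.

End Field.

Section FieldReversal.
Variable R : realType.
Variables rho kappa xi0 dxi0 : R -> R.

Lemma osc_pos_reverse (phi : R -> R) nu t : continuous phi ->
  osc_pos rho kappa xi0 (fun nu => - dxi0 nu) (phi \o -%R) nu t =
  osc_pos rho kappa xi0 dxi0 phi nu (- t).
Proof.
move=> cphi; rewrite /osc_pos duhamel_reverse // osc_cosN osc_sinN.
by rewrite mulNr mulrN.
Qed.

Lemma field_force_reverse (phi : R -> R) t : continuous phi ->
  field_force rho kappa xi0 (fun nu => - dxi0 nu) (phi \o -%R) t =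
  field_force rho kappa xi0 dxi0 phi (- t).
Proof.
by move=> cphi; apply: eq_Rintegral => nu _; rewrite osc_pos_reverse.
Qed.

End FieldReversal.

(** * Mechanics of the particle in charts *)

Section MatrixCalculus.
Variable R : realType.

Lemma is_derive_mulmx (V : normedModType R) p q r (P : V -> 'M[R]_(p, q))
    (Q : V -> 'M[R]_(q, r)) dP dQ (x v : V) :
    is_derive x v P dP -> is_derive x v Q dQ ->
  is_derive x v (fun y => P y *m Q y) (dP *m Q x + P x *m dQ).
Proof.
move=> HP HQ; apply/is_derive_mx => i j.
have -> : (fun y => (P y *m Q y) i j) = \sum_(k < q) (fun y => P y i k * Q y k j).
  by apply/funext => y; rewrite mxE fct_sumE.
have H k : is_derive x v (fun y => P y i k * Q y k j)
    (P x i k * dQ k j + Q x k j * dP i k).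
  exact: is_deriveM ((is_derive_mx _ _ _ _).1 HP i k) ((is_derive_mx _ _ _ _).1 HQ k j).
apply: (is_derive_eq (@is_derive_sum R V R q _ x v _ H)).
rewrite !mxE -big_split /=; apply: eq_bigr => k _.
by rewrite addrC (mulrC (Q x k j)).
Qed.

Lemma is_derive_trmx (V : normedModType R) p q (P : V -> 'M[R]_(p, q)) dP (x v : V) :
  is_derive x v P dP -> is_derive x v (fun y => (P y)^T) dP^T.
Proof.
move=> HP; apply/is_derive_mx => i j; rewrite mxE.
have -> : (fun y => (P y)^T i j) = (fun y => P y j i).
  by apply/funext => y; rewrite mxE.
exact: (is_derive_mx _ _ _ _).1 HP j i.
Qed.

Lemma mulmx_tr_sym m (B : 'M[R]_m) (v w : 'rV[R]_m) : B^T = B ->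
  (v *m B *m w^T) 0 0 = (w *m B *m v^T) 0 0.
Proof.
move=> sB; rewrite -[in LHS](trmxK (v *m B *m w^T)) [LHS]mxE.
by rewrite !trmx_mul trmxK sB mulmxA.
Qed.

Lemma row_mulmx_tr p q (w : 'rV[R]_p) (B : 'M[R]_(p, q)) j :
  (w *m B)^T j 0 = \sum_i w 0 i * B i j.
Proof. by rewrite !mxE. Qed.

Lemma delta_sum m (k : 'I_m) (a : 'I_m -> R) :
  \sum_i (delta_mx 0 k : 'rV[R]_m) 0 i * a i = a k.
Proof.
rewrite (bigD1 k) //= big1 => [|l lk]; first by rewrite mxE !eqxx mul1r addr0.
by rewrite mxE (negbTE lk) andbF mul0r.
Qed.

Lemma quad_sum m n (a : 'I_n -> R) (B : 'I_n -> 'M[R]_m) (w : 'rV[R]_m) :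
  quad (\sum_j a j *: B j) w = \sum_j a j * quad (B j) w.
Proof.
rewrite /quad mulmx_sumr mulmx_suml summxE; apply: eq_bigr => j _.
by rewrite -scalemxAr -scalemxAl mxE.
Qed.

Lemma is_derive_quad (V : normedModType R) m (B : V -> 'M[R]_m) (w : V -> 'rV[R]_m)
    dB dw (x v : V) : (B x)^T = B x ->
    is_derive x v B dB -> is_derive x v w dw ->
  is_derive x v (fun y => quad (B y) (w y))
    (quad dB (w x) + 2 * (w x *m B x *m dw^T) 0 0).
Proof.
move=> sB HB Hw.
have H := is_derive_mulmx (is_derive_mulmx Hw HB) (is_derive_trmx Hw).
apply: (is_derive_eq ((is_derive_mx _ _ _ _).1 H 0 0)).
rewrite mulmxDl !mxE -/(quad dB (w x)).
have E : \sum_j (dw *m B x) 0 j * (w x)^T j 0 = (w x *m B x *m dw^T) 0 0.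
  by rewrite -(mulmx_tr_sym dw (w x) sB) [RHS]mxE.
rewrite E (_ : quad dB (w x) = \sum_j (w x *m dB) 0 j * (w x)^T j 0); last first.
  by rewrite /quad mxE.
rewrite (_ : \sum_j (w x *m B x) 0 j * dw^T j 0 = (w x *m B x *m dw^T) 0 0); last first.
  by rewrite mxE.
by ring.
Qed.

End MatrixCalculus.

Lemma is_derive_comp_half (R : realType) (g : R -> R) (t dg : R) :
  is_derive t 1 g dg -> is_derive t 1 (fun s => g s / 2) (dg / 2).
Proof.
move=> H; have := is_derive_Ml 2^-1 H; rewrite (mulrC 2^-1 dg).
by have -> : (fun s => 2^-1 * g s) = (fun s => g s / 2) by apply/funext => s; rewrite mulrC.
Qed.

Section ClassC.
Variables (R : realType) (m : nat).
Local Notation e_ i := (delta_mx 0 i : 'rV[R]_m).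

Lemma open_near (U : set 'rV[R]_m) (u : 'rV[R]_m) : open U -> U u ->
  \forall y \near u, U y.
Proof. by move=> oU Uu; exact: open_nbhs_nbhs. Qed.

Lemma near_eq_continuous (T S : topologicalType) (g h : T -> S) (u : T) :
  (\forall y \near u, g y = h y) -> {for u, continuous g} -> {for u, continuous h}.
Proof.
move=> gh; have gu : g u = h u := nbhs_singleton gh.
rewrite /prop_for /continuous_at gu; apply: cvg_trans.
exact: near_eq_cvg.
Qed.

(** The iterated partial derivatives on an open set only depend on the values there. *)
Lemma class_C_ext (V : normedModType R) k (U : set 'rV[R]_m) (g h : 'rV[R]_m -> V) :
  open U -> (forall u, U u -> g u = h u) -> class_C k U g -> class_C k U h.
Proof.
move=> oU; elim: k g h => [|k IH] g h gh /= [cg dg].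
  split=> // u Uu; apply: near_eq_continuous (cg u Uu).
  by apply: filterS (open_near oU Uu) => y /gh.
have ngh u : U u -> \forall y \near u, g y = h y.
  by move=> Uu; apply: filterS (open_near oU Uu) => y /gh.
split=> [u Uu|i].
  exact: near_eq_continuous (ngh u Uu) (cg u Uu).
have [dgi Ci] := dg i; split=> [u Uu|].
  by apply: (near_eq_derivable (ngh u Uu)); exact: dgi.
apply: (IH (fun u => 'D_(e_ i) g u)) => // u Uu.
exact: near_eq_derive (ngh u Uu).
Qed.

Lemma class_C_entry k p q (U : set 'rV[R]_m) (g : 'rV[R]_m -> 'M[R]_(p, q)) a b :
  open U -> class_C k U g -> class_C k U (fun u => g u a b).
Proof.
move=> oU; elim: k g => [|k IH] g /= [cg dg].
  by split=> // u Uu; apply: entry_continuous; exact: cg.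
split=> [u Uu|i]; first by apply: entry_continuous; exact: cg.
have [dgi Ci] := dg i; split=> [u Uu|].
  by have /derivable_mxP := dgi u Uu.
apply: (class_C_ext oU _ (IH _ Ci)) => u Uu /=.
by rewrite derive_mx ?mxE //; exact: dgi.
Qed.

Lemma class_C_partial (V : normedModType R) k (U : set 'rV[R]_m)
    (g : 'rV[R]_m -> V) i :
  class_C k.+1 U g -> class_C k U (fun u => 'D_(e_ i) g u).
Proof. by move=> [_ /(_ i) []]. Qed.

Lemma class_C_derivable (V : normedModType R) k (U : set 'rV[R]_m)
    (g : 'rV[R]_m -> V) i u :
  class_C k.+1 U g -> U u -> derivable g u (e_ i).
Proof. by move=> [_ /(_ i) [dg _]] Uu; exact: dg. Qed.

(** The Jacobian matrix by its entries, without the differentials of the library: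
    it can then be differentiated again. *)
Definition jac (s : 'rV[R]_m -> 'rV[R]_m) (u : 'rV[R]_m) : 'M[R]_m :=
  \matrix_(k, j) ('D_(e_ k) s u) 0 j.

Lemma jacE (s : 'rV[R]_m -> 'rV[R]_m) u : differentiable s u -> 'J s u = jac s u.
Proof.
move=> ds; apply/matrixP => k j; rewrite [RHS]mxE deriveEjacobian //.
by rewrite -rowE [RHS]mxE.
Qed.

Lemma derive_jac (s : 'rV[R]_m -> 'rV[R]_m) u w : differentiable s u ->
  'D_w s u = w *m jac s u.
Proof. by move=> ds; rewrite deriveEjacobian // jacE. Qed.

Lemma jac_derive (s : 'rV[R]_m -> 'rV[R]_m) (U : set 'rV[R]_m) u w :
  open U -> class_C 2 U s -> U u ->
  is_derive u w (jac s) ('D_w (jac s) u) /\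
  forall k j, 'D_w (jac s) u k j = \sum_i w 0 i * ('D_(e_ i) (fun y => 'D_(e_ k) s y) u) 0 j.
Proof.
move=> oU Cs Uu.
have dk k : differentiable (fun y => 'D_(e_ k) s y) u.
  exact: (class_C_differentiable (@mean_value_mx R m 1 m) oU (class_C_partial k Cs) Uu).
have H : is_derive u w (jac s) (\matrix_(k, j) ('D_w (fun y => 'D_(e_ k) s y) u) 0 j).
  apply/is_derive_mx => k j; rewrite mxE.
  have -> : (fun y => jac s y k j) = (fun y => ('D_(e_ k) s y) 0 j).
    by apply/funext => y; rewrite mxE.
  have D := derivableP (@diff_derivable _ _ _ _ u w (dk k)).
  exact: (is_derive_mx _ _ _ _).1 D 0 j.
case: (H) => D E; split; first exact: derivableP.
move=> k j; rewrite E mxE derive_partial_sum // summxE.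
by apply: eq_bigr => i _; rewrite mxE.
Qed.

Lemma class_C_mx (k : nat) p q (U : set 'rV[R]_m) (g : 'rV[R]_m -> 'M[R]_(p, q)) :
  open U -> (forall a b, class_C k U (fun u => g u a b)) -> class_C k U g.
Proof.
move=> oU; elim: k g => [|k IH] g H /=.
  by split=> // u Uu; apply: mx_continuousP => a b; case: (H a b) => cg _; exact: cg.
split=> [u Uu|i].
  by apply: mx_continuousP => a b; case: (H a b) => cg _; exact: cg.
have dg u : U u -> derivable g u (e_ i).
  by move=> Uu; apply/derivable_mxP => a b; exact: class_C_derivable (H a b) Uu.
split=> //; apply: IH => a b.
apply: (class_C_ext oU _ (class_C_partial i (H a b))) => u Uu.
by rewrite derive_mx ?mxE //; exact: dg.
Qed.

Lemma class_C_jac k (s : 'rV[R]_m -> 'rV[R]_m) (U : set 'rV[R]_m) :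
  open U -> class_C k.+1 U s -> class_C k U (jac s).
Proof.
move=> oU Cs; apply: class_C_mx => // a b.
have -> : (fun u => jac s u a b) = (fun u => ('D_(e_ a) s u) 0 b).
  by apply/funext => u; rewrite mxE.
exact: (class_C_entry 0 b oU (class_C_partial a Cs)).
Qed.

Lemma mixed_derivatives_mx (s : 'rV[R]_m -> 'rV[R]_m) (U : set 'rV[R]_m) u (i k j : 'I_m) :
    open U -> class_C 2 U s -> U u ->
  ('D_(e_ i) (fun y => 'D_(e_ k) s y) u) 0 j =
  ('D_(e_ k) (fun y => 'D_(e_ i) s y) u) 0 j.
Proof.
move=> oU Cs Uu.
have H a b : ('D_(e_ a) (fun y => 'D_(e_ b) s y) u) 0 j =
    'D_(e_ a) (fun y => 'D_(e_ b) (fun z => s z 0 j) y) u.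
  rewrite derive_mx ?mxE; last exact: class_C_derivable (class_C_partial b Cs) Uu.
  apply: near_eq_derive; apply: filterS (open_near oU Uu) => y Uy.
  by rewrite derive_mx ?mxE //; exact: class_C_derivable Cs Uy.
apply: (etrans (H i k)); apply: (etrans _ (esym (H k i))).
have C2 : class_C 2 U (fun z => s z 0 j) := class_C_entry 0 j oU Cs.
exact: (@mixed_derivatives R m U (fun z => s z 0 j) u k i oU C2 Uu).
Qed.

End ClassC.

(** Newton's equations are written in the variables position and momentum, where no
    second derivative of the position occurs. *)
Section ChartMechanics.
Variables (R : realType) (m : nat) (M : manifold R m).
Variables (A : chart M -> 'rV[R]_m -> 'M[R]_m) (V0 f : M -> R).
Hypotheses (hA : riemannian A) (hV : smooth_fun V0) (hf : smooth_fun f).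
Local Notation e_ i := (delta_mx 0 i : 'rV[R]_m).

Definition img (c : chart M) : set 'rV[R]_m := chart_map c @` chart_dom c.
Definition overlap (c d : chart M) : set 'rV[R]_m :=
  chart_map c @` (chart_dom c `&` chart_dom d).

Lemma img_open c : open (img c).
Proof. exact: chart_img_open. Qed.

Lemma img_map c x : chart_dom c x -> img c (chart_map c x).
Proof. by move=> cx; exists x. Qed.

Lemma inv_img c u : img c u ->
  chart_dom c (chart_inv c u) /\ chart_map c (chart_inv c u) = u.
Proof. by move=> [x cx <-]; rewrite chart_mapK. Qed.

Lemma overlapE c d u : overlap c d u <-> img c u /\ chart_dom d (chart_inv c u).
Proof.
split=> [[x [cx dx] <-]|[[x cx <-]]]; first by rewrite chart_mapK //; split=> //; exists x.
by rewrite chart_mapK // => dx; exists x.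
Qed.

Lemma overlap_img c d u : overlap c d u -> img c u.
Proof. by move=> /overlapE []. Qed.

Lemma overlap_open c d : open (overlap c d).
Proof.
rewrite openE => u /overlapE [cu du]; rewrite /interior.
have H1 := open_near (@img_open c) cu.
have H2 : \forall y \near u, chart_dom d (chart_inv c y).
  apply: (chart_inv_continuous cu); apply: open_nbhs_nbhs; split=> //.
  exact: chart_dom_open.
by apply: filterS2 H1 H2 => y yc yd; apply/overlapE.
Qed.

Lemma overlap_swap c d u : overlap c d u ->
  overlap d c (chart_map d (chart_inv c u)) /\
  chart_map c (chart_inv d (chart_map d (chart_inv c u))) = u.
Proof.
by move=> [x [cx dx] <-]; rewrite !chart_mapK //; split=> //; exists x.
Qed.

Lemma near_dom c (x : R -> M) (t : R) : {for t, continuous x} -> chart_dom c (x t) ->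
  \forall s \near t, chart_dom c (x s).
Proof.
by move=> cx ct; apply: cx; apply: open_nbhs_nbhs; split=> //; exact: chart_dom_open.
Qed.

Lemma metric_class c k : class_C k (img c) (A c).
Proof. exact: (Defs.metric_smooth hA). Qed.

Lemma metric_diff c u : img c u -> differentiable (A c) u.
Proof.
exact: (class_C_differentiable (@mean_value_mx R m m m) (@img_open c)
  (metric_class c 1)).
Qed.

Lemma smooth_diff (g : M -> R) c u : smooth_fun g -> img c u ->
  differentiable (g \o chart_inv c) u.
Proof.
by move=> sg; exact: (class_C_differentiable (@mean_value_real R m) (@img_open c)
  (sg c 1%N)).
Qed.

(** A vector in the kernel of the metric has length 0. *)
Lemma metric_det c u : img c u -> \det (A c u) != 0.
Proof.
move=> cu; apply/negP => /det0P[w w0 wA].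
by have := Defs.metric_posdef hA cu w0; rewrite /quad wA mul0mx mxE ltxx.
Qed.

(** The partial derivatives of the Lagrangian plus the force [F] of the oscillators,
    as a function of position and velocity: the prescribed derivative of the
    momentum. *)
Definition law (c : chart M) (u w : 'rV[R]_m) (F : R) : 'rV[R]_m :=
  \row_k (quad ('D_(e_ k) (A c) u) w / 2 - 'D_(e_ k) (V0 \o chart_inv c) u
          + 'D_(e_ k) (f \o chart_inv c) u * F).

Definition velocity (c : chart M) (x : R -> M) (t : R) : 'rV[R]_m :=
  derive1 (chart_map c \o x) t.

Definition momentum (c : chart M) (x : R -> M) (t : R) : 'rV[R]_m :=
  velocity c x t *m A c (chart_map c (x t)).

Definition newton (c : chart M) (x : R -> M) (F t : R) : Prop :=
  derivable (chart_map c \o x) t 1 /\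
  is_derive t 1 (momentum c x) (law c (chart_map c (x t)) (velocity c x t) F).

Definition solves (x : R -> M) (F : R) (t : R) : Prop :=
  forall c, chart_dom c (x t) -> newton c x F t.

Lemma transition_diff (c d : chart M) u : overlap d c u ->
  differentiable (chart_map c \o chart_inv d) u.
Proof.
exact: (class_C_differentiable (@mean_value_mx R m 1 m) (@overlap_open d c)
  (transition_smooth d c 1%N)).
Qed.

Lemma metric_transform (c d : chart M) u (s := chart_map c \o chart_inv d) :
  overlap d c u -> A d u = jac s u *m A c (s u) *m (jac s u)^T.
Proof.
move=> ou; have /= := Defs.metric_tensor hA ou.
rewrite -/s => ->.
have -> : 'J s u = jac s u by apply: jacE; exact: transition_diff.
by [].
Qed.

(** Covariance of [law]. The second derivatives of the coordinate change that
    come from the momentum and from the metric cancel, because mixed derivatives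
    commute. *)
Lemma law_covariant (c d : chart M) (u w : 'rV[R]_m) (F : R)
    (s := chart_map c \o chart_inv d) :
    overlap d c u ->
  law d u w F = law c (s u) (w *m jac s u) F *m (jac s u)^T
    + (w *m jac s u *m A c (s u)) *m ('D_w (jac s) u)^T.
Proof.
move=> ou.
have oO := @overlap_open d c.
have Cs k : class_C k (overlap d c) s := transition_smooth d c k.
have ds y : overlap d c y -> differentiable s y by exact: transition_diff.
have nO := open_near oO ou.
have csu : img c (s u) by exact: overlap_img (overlap_swap ou).1.
have [Dw Ew] := jac_derive w oO (Cs 2%N) ou.
have chainD (W : normedModType R) (g : 'rV[R]_m -> W) k : differentiable g (s u) ->
    is_derive u (e_ k) (g \o s) (\sum_j jac s u k j *: 'D_(e_ j) g (s u)).
  move=> dg; have dgs : differentiable (g \o s) u.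
    by apply: differentiable_comp => //; exact: ds.
  split; first exact: diff_derivable.
  rewrite deriveE // diff_comp //=; last exact: ds.
  have -> : 'd s u (e_ k) = row k (jac s u).
    by rewrite -deriveE; [rewrite derive_jac -?rowE //; exact: ds|exact: ds].
  rewrite -deriveE // derive_partial_sum //; apply: eq_bigr => j _.
  by rewrite mxE.
have scal (g : M -> R) k : smooth_fun g ->
    'D_(e_ k) (g \o chart_inv d) u =
    \sum_j jac s u k j * 'D_(e_ j) (g \o chart_inv c) (s u).
  move=> sg; have [_ <-] := chainD _ _ k (smooth_diff sg csu).
  apply: near_eq_derive; apply: filterS nO => y [z [dz cz] <-] /=.
  by rewrite /s /= !chart_mapK.
apply/rowP => k; rewrite !mxE !scal //.
have HA : is_derive u (e_ k) (A c \o s) (\sum_j jac s u k j *: 'D_(e_ j) (A c) (s u)).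
  by apply: chainD; exact: metric_diff.
have [Dk Ek] := jac_derive (e_ k) oO (Cs 2%N) ou.
have Hv : is_derive u (e_ k) (fun y => w *m jac s y) (w *m 'D_(e_ k) (jac s) u).
  apply: (is_derive_eq (is_derive_mulmx (is_derive_cst w u (e_ k)) Dk)).
  by rewrite mul0mx add0r.
have HQ := is_derive_quad (Defs.metric_sym hA csu) HA Hv.
have quadD : is_derive u (e_ k) (fun y => quad (A d y) w)
     (quad ('D_(e_ k) (A d) u) w).
  have dAd := @diff_derivable _ _ _ _ u (e_ k) (metric_diff (overlap_img ou)).
  have Hc := is_derive_cst w u (e_ k).
  apply: (is_derive_eq (is_derive_quad (Defs.metric_sym hA (overlap_img ou))
    (derivableP dAd) Hc)).
  by rewrite trmx0 mulmx0 mxE mulr0 addr0.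
have quadE : quad ('D_(e_ k) (A d) u) w =
    quad (\sum_j jac s u k j *: 'D_(e_ j) (A c) (s u)) (w *m jac s u)
    + 2 * ((w *m jac s u) *m A c (s u) *m (w *m 'D_(e_ k) (jac s) u)^T) 0 0.
  case: HQ => _ <-; case: quadD => _ <-; apply: near_eq_derive.
  apply: filterS nO => y oy; rewrite /quad /= (metric_transform oy) -/s.
  by rewrite trmx_mul !mulmxA.
have crossE : ((w *m jac s u) *m A c (s u) *m (w *m 'D_(e_ k) (jac s) u)^T) 0 0 =
    \sum_j (w *m jac s u *m A c (s u)) 0 j * ('D_w (jac s) u)^T j k.
  apply: (etrans (mxE _ _ _ _)); apply: eq_bigr => j _; congr (_ * _).
  apply: (etrans (row_mulmx_tr _ _ _)); apply: (etrans _ (esym (mxE _ _ _ _))).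
  apply: (etrans _ (esym (Ew k j))); apply: eq_bigr => i _; congr (_ * _).
  apply: (etrans (Ek i j)); apply: (etrans (delta_sum k _)).
  exact: (mixed_derivatives_mx k i j oO (Cs 2%N) ou).
rewrite quadE crossE quad_sum mulrDl mulrAC divff // mul1r.
set X := \sum_j _ * ('D_w _ _)^T _ _.
have -> : \sum_j law c (s u) (w *m jac s u) F 0 j * (jac s u)^T j k =
    (\sum_j jac s u k j * quad ('D_(e_ j) (A c) (s u)) (w *m jac s u)) / 2
    - \sum_j jac s u k j * 'D_(e_ j) (V0 \o chart_inv c) (s u)
    + (\sum_j jac s u k j * 'D_(e_ j) (f \o chart_inv c) (s u)) * F.
  rewrite !mulr_suml -sumrN -!big_split /=; apply: eq_bigr => j _.
  by rewrite [(jac s u)^T j k]mxE [law _ _ _ _ 0 j]mxE; ring.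
by ring.
Qed.

Lemma near_inv_map c (x : R -> M) (t : R) (g : M -> R) :
    {for t, continuous x} -> chart_dom c (x t) ->
  \forall s \near t, (g \o chart_inv c) ((chart_map c \o x) s) = g (x s).
Proof.
move=> cx ct; apply: filterS (near_dom cx ct) => s cs /=.
by rewrite chart_mapK.
Qed.

Lemma velocityE c (x : R -> M) t : velocity c x t = 'D_1 (chart_map c \o x) t.
Proof. by rewrite /velocity derive1E. Qed.

(** In a chart around [x t], where the smooth function becomes a function of the
    coordinates. *)
Lemma smooth_along (g : M -> R) c (x : R -> M) (t : R) : smooth_fun g ->
    {for t, continuous x} -> chart_dom c (x t) -> derivable (chart_map c \o x) t 1 ->
  is_derive t 1 (g \o x)
    (\sum_k velocity c x t 0 k * 'D_(e_ k) (g \o chart_inv c) (chart_map c (x t))).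
Proof.
move=> sg cx ct du.
have dg := smooth_diff sg (img_map ct).
apply: near_eq_is_derive (near_inv_map g cx ct) _.
apply: (is_derive_eq (chain_curve dg du)).
by rewrite -velocityE; exact: derive_partial_sum.
Qed.

Lemma metric_along c (x : R -> M) (t : R) : {for t, continuous x} -> chart_dom c (x t) ->
    derivable (chart_map c \o x) t 1 ->
  is_derive t 1 (fun s => A c (chart_map c (x s)))
    (\sum_k velocity c x t 0 k *: 'D_(e_ k) (A c) (chart_map c (x t))).
Proof.
move=> cx ct du; have dA := metric_diff (img_map ct).
apply: (is_derive_eq (chain_curve dA du)).
by rewrite -velocityE; exact: derive_partial_sum.
Qed.

(** The coordinates in two charts differ by a differentiable map. *)
Lemma velocity_transform c d (x : R -> M) (t : R) (s := chart_map c \o chart_inv d) :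
    {for t, continuous x} -> chart_dom c (x t) -> chart_dom d (x t) ->
    derivable (chart_map d \o x) t 1 ->
  derivable (chart_map c \o x) t 1 /\
  velocity c x t = velocity d x t *m jac s (chart_map d (x t)).
Proof.
move=> cx ct dt du.
have ou : overlap d c (chart_map d (x t)) by exists (x t).
have ds : differentiable s (chart_map d (x t)) := transition_diff ou.
have ns : \forall r \near t, (s \o (chart_map d \o x)) r = (chart_map c \o x) r.
  by apply: filterS (near_dom cx dt) => r dr; rewrite /s /= chart_mapK.
have [D E] := near_eq_is_derive ns (chain_curve ds du).
by split=> //; rewrite !velocityE E derive_jac.
Qed.

(** The momenta in two charts are related by the Jacobian matrix of the coordinate
    change; differentiating this relation produces the correction in the
    transformation of [law]. *)
Lemma newton_covariant c d (x : R -> M) (F t : R) :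
    {for t, continuous x} -> (\forall r \near t, {for r, continuous x}) ->
    chart_dom c (x t) -> chart_dom d (x t) ->
    (\forall r \near t, derivable (chart_map c \o x) r 1) ->
    newton c x F t ->
  newton d x F t.
Proof.
move=> cx ncx ct dt ndu [du dp].
have ou : overlap d c (chart_map d (x t)) by exists (x t).
set s := chart_map c \o chart_inv d.
have ncd : \forall r \near t, chart_dom c (x r) /\ chart_dom d (x r).
  by apply: filterS2 (near_dom cx ct) (near_dom cx dt) => r.
have [dud _] := velocity_transform cx dt ct du.
split; first exact: dud.
have dj : is_derive t 1 (fun r => jac s (chart_map d (x r)))
    ('D_(velocity d x t) (jac s) (chart_map d (x t))).
  rewrite velocityE; apply: chain_curve => //.
  apply: (class_C_differentiable (@mean_value_mx R m m m) (@overlap_open d c) _ ou).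
  exact: class_C_jac (@overlap_open d c) (transition_smooth d c 2%N).
have H := is_derive_mulmx dp (is_derive_trmx dj).
apply: (@near_eq_is_derive _ _ _
    (fun r => momentum c x r *m (jac s (chart_map d (x r)))^T)).
  apply: filterS2 (filterI ncd ndu) ncx => r [[cr dr] dur] cxr.
  have [dudr _] := velocity_transform cxr dr cr dur.
  have [_ E] := velocity_transform cxr cr dr dudr.
  rewrite /momentum (metric_transform (_ : overlap d c (chart_map d (x r)))); last first.
    by exists (x r).
  by rewrite E /s /= chart_mapK // !mulmxA.
apply: (is_derive_eq H).
rewrite (law_covariant _ _ ou) -/s.
have [_ E] := velocity_transform cx ct dt dud.
have sE : s (chart_map d (x t)) = chart_map c (x t) by rewrite /s /= chart_mapK.
by rewrite sE -/s -E.
Qed.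

(** Cramer's rule, which keeps the dependence on the metric visibly smooth. *)
Lemma velocity_momentum c (x : R -> M) t : chart_dom c (x t) ->
  velocity c x t = (\det (A c (chart_map c (x t))))^-1 *:
    (momentum c x t *m \adj (A c (chart_map c (x t)))).
Proof.
move=> ct; rewrite /momentum -mulmxA mul_mx_adj mul_mx_scalar scalerA mulVf ?scale1r //.
exact: metric_det (img_map ct).
Qed.

(** The second derivative of the position exists because the momentum and the
    metric along the motion are differentiable. *)
Lemma velocity_derivable c (x : R -> M) (F t : R) :
    {for t, continuous x} -> chart_dom c (x t) -> newton c x F t ->
  derivable (velocity c x) t 1.
Proof.
move=> cx ct [du [dp _]].
have [dA _] := metric_along cx ct du.
apply: (@near_eq_derivable _ _ _ (fun r => (\det (A c (chart_map c (x r))))^-1 *: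
    (momentum c x r *m \adj (A c (chart_map c (x r)))))).
  by apply: filterS (near_dom cx ct) => r cr; rewrite [RHS]velocity_momentum.
have CC := derivable_ring_closed t.
have dAij : forall i j, derivable (fun r => A c (chart_map c (x r)) i j) t 1.
  exact: (derivable_mxP _ _ _).1 dA.
apply/derivable_mxP => i j.
have -> : (fun r => ((\det (A c (chart_map c (x r))))^-1 *:
    (momentum c x r *m \adj (A c (chart_map c (x r))))) i j) =
  (fun r => (\det (A c (chart_map c (x r))))^-1 *
    (momentum c x r *m \adj (A c (chart_map c (x r)))) i j).
  by apply/funext => r; rewrite mxE.
apply: (closed_mul CC).
  apply: derivableV; first exact: metric_det (img_map ct).
  exact: (closed_det CC).
apply: (closed_mulmx CC); first exact: (derivable_mxP _ _ _).1 dp.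
by move=> k l; exact: (closed_adj CC).
Qed.

(** The work of the potential and the variation of the metric are balanced by the
    law of motion; the force of the oscillators remains. *)
Lemma particle_energy_derive c (x : R -> M) (F t : R) :
    {for t, continuous x} -> chart_dom c (x t) -> newton c x F t ->
  is_derive t 1 (fun r => quad (A c (chart_map c (x r))) (velocity c x r) / 2 + V0 (x r))
    ('D_1 (f \o x) t * F).
Proof.
move=> cx ct nt; have [du dp] := nt.
have dw := derivableP (velocity_derivable cx ct nt).
set w := velocity c x t in dw *; set w' := 'D_(1 : R) (velocity c x) t in dw.
have dA := metric_along cx ct du; set dAt := \sum_k _ in dA.
have sA := Defs.metric_sym hA (img_map ct).
have dV := smooth_along hV cx ct du.
have [_ ->] := smooth_along hf cx ct du.
have HQ := is_derive_quad sA dA dw.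
have H := is_deriveD (is_derive_comp_half HQ) dV.
apply: (is_derive_eq H).
have pE : law c (chart_map c (x t)) w F = w' *m A c (chart_map c (x t)) + w *m dAt.
  by case: dp => _ <-; case: (is_derive_mulmx dw dA).
have wp : (law c (chart_map c (x t)) w F *m w^T) 0 0 =
    (w *m A c (chart_map c (x t)) *m w'^T) 0 0 + quad dAt w.
  by rewrite pE mulmxDl mxE mulmx_tr_sym.
have wl : (law c (chart_map c (x t)) w F *m w^T) 0 0 =
    quad dAt w / 2 - \sum_k w 0 k * 'D_(e_ k) (V0 \o chart_inv c) (chart_map c (x t))
    + (\sum_k w 0 k * 'D_(e_ k) (f \o chart_inv c) (chart_map c (x t))) * F.
  rewrite mxE /dAt quad_sum !mulr_suml -sumrB -big_split /=.
  by apply: eq_bigr => k _; rewrite !mxE; ring.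
have arith (q a b c' : R) : q / 2 - b + c' = a + q -> (q + 2 * a) / 2 + b = c'.
  by move=> e; lra.
by apply: arith; rewrite -wl.
Qed.

End ChartMechanics.

(** * Local solutions in a chart *)

Lemma lipnear_id (R : realType) (E : normedModType R) (a : E) :
  lipnear (fun x : E => x) a.
Proof.
exists 1 => //; apply: filterS (nbhs_right_gt (0 : R)) => r _ y z _ _.
by rewrite mul1r.
Qed.

Lemma closed_quad (R : realType) (X : Type) (C : (X -> R) -> Prop) m
    (B : X -> 'M[R]_m) (w : X -> 'rV[R]_m) : ring_closed C ->
    (forall i j, C (fun x => B x i j)) -> (forall j, C (fun x => w x 0 j)) ->
  C (fun x => quad (B x) (w x)).
Proof.
move=> CC HB Hw; apply: (closed_mulmx CC) => [i j|i j].
  apply: (closed_mulmx CC) => // i' j'.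
  by rewrite (ord1 i').
have -> : (fun x => (w x)^T i j) = (fun x => w x 0 i); last exact: Hw.
by apply/funext => x; rewrite mxE (ord1 j).
Qed.

(** The state of the particle in a chart is the matrix whose rows are position and
    momentum. *)
Section VectorField.
Variables (R : realType) (m : nat) (M : manifold R m).
Variables (A : chart M -> 'rV[R]_m -> 'M[R]_m) (V0 f : M -> R).
Hypotheses (hA : riemannian A) (hV : smooth_fun V0) (hf : smooth_fun f).
Local Notation e_ i := (delta_mx 0 i : 'rV[R]_m).
Local Notation state := 'M[R]_(2, m).

Definition pos (z : state) : 'rV[R]_m := row 0 z.
Definition mom (z : state) : 'rV[R]_m := row 1 z.
Definition mk_state (u p : 'rV[R]_m) : state :=
  \matrix_(i, j) if i == 0 then u 0 j else p 0 j.

Lemma pos_mk u p : pos (mk_state u p) = u.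
Proof. by apply/rowP => j; rewrite !mxE. Qed.

Lemma mom_mk u p : mom (mk_state u p) = p.
Proof. by apply/rowP => j; rewrite !mxE. Qed.

(** The velocity with the given momentum. *)
Definition inverse_legendre (c : chart M) (z : state) : 'rV[R]_m :=
  (\det (A c (pos z)))^-1 *: (mom z *m \adj (A c (pos z))).

(** Position and momentum obey [z' = drift z + F *: push z], where [F] is the
    force exerted by the oscillators. *)
Definition drift (c : chart M) (z : state) : state :=
  mk_state (inverse_legendre c z) (law A V0 f c (pos z) (inverse_legendre c z) 0).
Definition push (c : chart M) (z : state) : state :=
  mk_state 0 (\row_k 'D_(e_ k) (f \o chart_inv c) (pos z)).

Lemma law_force c u w F : law A V0 f c u w F =
  law A V0 f c u w 0 + F *: \row_k 'D_(e_ k) (f \o chart_inv c) u.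
Proof. by apply/rowP => k; rewrite !mxE mulr0 addr0 [F * _]mulrC. Qed.

Lemma mom_drift c z F : mom (drift c z + F *: push c z) =
  law A V0 f c (pos z) (inverse_legendre c z) F.
Proof.
rewrite law_force; apply/rowP => j; rewrite [LHS]mxE [LHS]mxE [RHS]mxE.
by congr (_ + _); rewrite ?mxE //= !mxE.
Qed.

Lemma pos_drift c z F : pos (drift c z + F *: push c z) = inverse_legendre c z.
Proof. by apply/rowP => j; rewrite !mxE /= mulr0 addr0. Qed.

Section At.
Variables (c : chart M) (z0 : state).
Hypothesis cz0 : img c (pos z0).
Let CC := @lipnear_ring_closed R _ z0.

Let lip_pos (W : normedModType R) (g : 'rV[R]_m -> W) :
  mean_value_target m W -> class_C 1 (img c) g -> lipnear (fun z : state => g (pos z)) z0.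
Proof.
move=> mv Cg; apply: (@lipnear_comp R _ _ W pos g z0).
  by move=> y z; exact: row_dist.
exact: (class_C_lipnear mv (@img_open _ _ _ c) Cg cz0).
Qed.

Let lip_metric i j : lipnear (fun z => A c (pos z) i j) z0.
Proof.
apply: (lipnear_entry i j); apply: (lip_pos (@mean_value_mx R m m m)).
exact: metric_class.
Qed.

Let lip_legendre j : lipnear (fun z => inverse_legendre c z 0 j) z0.
Proof.
have -> : (fun z => inverse_legendre c z 0 j) =
    (fun z => (\det (A c (pos z)))^-1 * (mom z *m \adj (A c (pos z))) 0 j).
  by apply/funext => z; rewrite /inverse_legendre mxE.
apply: (closed_mul CC).
  apply: lipnear_inv; last exact: metric_det cz0.
  exact: (closed_det CC).
apply: (closed_mulmx CC) => [i k|i k]; last exact: (closed_adj CC).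
have -> : (fun z => mom z i k) = (fun z : state => z 1 k).
  by apply/funext => z; rewrite mxE.
by apply: (lipnear_entry 1 k); exact: lipnear_id.
Qed.

Let lip_partial (g : M -> R) k : smooth_fun g ->
  lipnear (fun z => 'D_(e_ k) (g \o chart_inv c) (pos z)) z0.
Proof.
move=> sg; apply: (lip_pos (g := fun u => 'D_(e_ k) (g \o chart_inv c) u)).
  exact: mean_value_real.
exact: class_C_partial (sg c 2%N).
Qed.

Lemma lipnear_drift : lipnear (drift c) z0.
Proof.
apply: lipnear_mx => i j.
have [->|i0] := eqVneq i 0.
  have -> : (fun z => drift c z 0 j) = (fun z => inverse_legendre c z 0 j).
    by apply/funext => z; rewrite mxE.
  exact: lip_legendre.
have -> : (fun z => drift c z i j) =
    (fun z => quad ('D_(e_ j) (A c) (pos z)) (inverse_legendre c z) * 2^-1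
      + -1 * 'D_(e_ j) (V0 \o chart_inv c) (pos z)).
  by apply/funext => z; rewrite mxE (negbTE i0) mxE mulr0 addr0 mulN1r.
apply: (closed_add CC); apply: (closed_mul CC).
- apply: (closed_quad CC) => // a b; apply: (lipnear_entry a b).
  apply: (lip_pos (g := fun u => 'D_(e_ j) (A c) u)); first exact: mean_value_mx.
  exact: class_C_partial (metric_class hA c 2%N).
- exact: (closed_cst CC).
- exact: (closed_cst CC).
- exact: lip_partial.
Qed.

Lemma lipnear_push : lipnear (push c) z0.
Proof.
apply: lipnear_mx => i j; have [->|i0] := eqVneq i 0.
  have -> : (fun z => push c z 0 j) = (fun _ => 0).
    by apply/funext => z; rewrite !mxE.
  exact: (closed_cst CC).
have -> : (fun z => push c z i j) = (fun z => 'D_(e_ j) (f \o chart_inv c) (pos z)).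
  by apply/funext => z; rewrite mxE (negbTE i0) mxE.
exact: lip_partial.
Qed.

Lemma lipnear_interaction : lipnear (fun z => f (chart_inv c (pos z))) z0.
Proof.
apply: (lip_pos (g := f \o chart_inv c)); first exact: mean_value_real.
exact: (hf c 1%N).
Qed.

End At.
End VectorField.

Lemma continuous_dist (R : realType) (W : normedModType R) (g : R -> W) (t : R) :
  (forall e : R, 0 < e -> \forall s \near t, `|g t - g s| < e) ->
  {for t, continuous g}.
Proof. by move=> H; apply/cvgrPdist_lt => e e0; exact: H. Qed.

Lemma lip_continuous (R : realType) (E W : normedModType R) (g : E -> W)
    (a : E) (r L : R) (z : R -> E) : 0 <= L ->
    (forall y y', `|a - y| < r -> `|a - y'| < r -> `|g y - g y'| <= L * `|y - y'|) ->
    (forall s, `|a - z s| < r) -> continuous z ->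
  continuous (g \o z).
Proof.
move=> L0 HL zr cz t; apply: continuous_dist => e e0.
have L1 : 0 < L + 1 by rewrite ltr_wpDl.
have e1 : 0 < e / (L + 1) by rewrite divr_gt0.
have /cvgrPdist_lt/(_ _ e1) := cz t; apply: filterS => s zs.
apply: le_lt_trans (HL _ _ (zr t) (zr s)) _.
apply: (@le_lt_trans _ _ ((L + 1) * `|z t - z s|)).
  by rewrite ler_wpM2r // lerDl.
by rewrite mulrC -ltr_pdivlMr.
Qed.

Lemma affine_sub (R : realType) (V : lmodType R) (a b : R) (u v p q : V) :
  (u + a *: p) - (v + b *: q) = (u - v) + (a *: (p - q) + (a - b) *: q).
Proof. by rewrite scalerBr scalerBl subrKA opprD addrACA. Qed.

Lemma near_right_and (R : realType) (a : R) (P Q : R -> Prop) :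
    (\forall r \near a^'+, P r) -> (\forall r \near a^'+, Q r) ->
  \forall r \near a^'+, P r /\ Q r.
Proof. exact: filterI. Qed.

Lemma near_right_ex (R : realType) (a : R) (P : R -> Prop) :
  (\forall r \near a^'+, P r) -> exists r, P r.
Proof. by move=> H; exact: (@filter_ex _ _ (at_right_proper_filter a) _ H). Qed.

Section LocalFlow.
Variables (R : realType) (m : nat) (M : manifold R m).
Variables (A : chart M -> 'rV[R]_m -> 'M[R]_m) (V0 f : M -> R).
Hypotheses (hA : riemannian A) (hV : smooth_fun V0) (hf : smooth_fun f).
Variables rho kappa xi0 dxi0 : R -> R.
Hypothesis hO : oscillators rho kappa xi0 dxi0.
Local Notation force := (field_force rho kappa xi0 dxi0).
Local Notation state := 'M[R]_(2, m).

Definition glue (T : Type) (t1 : R) (g h : R -> T) (s : R) : T :=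
  if t1 <= s then h s else g s.

Lemma force_continuous phi : continuous phi -> continuous (force phi).
Proof.
move=> cphi t; apply: derivable1_continuous.
by have [] := force_derive hO t cphi.
Qed.

(** Contraction argument for the curve of states, with the force computed from the
    interaction [phi0] before [t1] and from the unknown curve after [t1]. The time
    [d] is uniform in the initial state near [z0], in the initial time up to [T] and
    in the past bounded by [B]; this is what the continuation argument needs. *)
Lemma local_flow (c : chart M) (z0 : state) (T B : R) :
    img c (pos z0) -> 0 <= T -> 0 <= B ->
  exists2 d : R, 0 < d & forall (z1 : state) (t1 : R) (phi0 : R -> R),
    `|z0 - z1| < d -> `|t1| <= T -> continuous phi0 ->
    (forall s, `|phi0 s| <= B) -> phi0 t1 = f (chart_inv c (pos z1)) ->
  exists z : R -> state,
    [/\ continuous z, z t1 = z1, forall s, img c (pos (z s)) &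
      let phi := glue t1 phi0 (fun s => f (chart_inv c (pos (z s)))) in
      continuous phi /\
      forall s, t1 - d < s < t1 + d ->
        is_derive s 1 z (drift A V0 f c (z s) + force phi s *: push f c (z s))].
Proof.
move=> cz0 T0 B0.
have [L1 L10 H1] := lipnear_drift f hA hV cz0.
have [L2 L20 H2] := lipnear_push hf cz0.
have [L3 L30 H3] := lipnear_interaction hf cz0.
have [N1 N10 G1] := lipnear_bounded (lipnear_drift f hA hV cz0).
have [N2 N20 G2] := lipnear_bounded (lipnear_push hf cz0).
have [N3 N30 G3] := lipnear_bounded (lipnear_interaction hf cz0).
have Himg : \forall r \near (0 : R)^'+, forall y : state, `|z0 - y| < r -> img c (pos y).
  have [r r0 Hr] := near_ball2 (open_near (@img_open _ _ _ c) cz0)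
    (open_near (@img_open _ _ _ c) cz0).
  apply: filterS (nbhs_right_lt r0) => r' r'r y yr; apply: (Hr _ _).1.
  by apply: le_lt_trans (row_dist 0 z0 y) _; exact: lt_trans r'r.
have [r [r0 [rimg [[r1 r2] r3] [[g1 g2] g3]]]] : exists r : R, 0 < r /\
   [/\ forall y : state, `|z0 - y| < r -> img c (pos y),
    [/\ forall y z, `|z0 - y| < r -> `|z0 - z| < r ->
         `|drift A V0 f c y - drift A V0 f c z| <= L1 * `|y - z| &
       forall y z, `|z0 - y| < r -> `|z0 - z| < r ->
         `|push f c y - push f c z| <= L2 * `|y - z| ] /\
       forall y z, `|z0 - y| < r -> `|z0 - z| < r ->
         `|f (chart_inv c (pos y)) - f (chart_inv c (pos z))| <= L3 * `|y - z| &
    [/\ forall y, `|z0 - y| < r -> `|drift A V0 f c y| <= N1 &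
       forall y, `|z0 - y| < r -> `|push f c y| <= N2 ] /\
       forall y, `|z0 - y| < r -> `|f (chart_inv c (pos y))| <= N3].
  have F := near_right_and (near_right_and (near_right_and H1 H2) (near_right_and H3 G1))
    (near_right_and (near_right_and G2 G3) (near_right_and Himg (nbhs_right_gt (0 : R)))).
  have [r [[[h1 h2] [h3 h4]] [[h5 h6] [h7 h8]]]] := near_right_ex F.
  by exists r.
(* A bound for the interaction, before and after [t1]; [CF] bounds the force. *)
pose Bm := B + N3.
have Bm0 : 0 <= Bm by rewrite addr_ge0.
pose W := @weight_total R rho kappa xi0 dxi0.
have W0 : 0 <= W := weight_total_ge0 hO.
pose CF := dom_cst (2 * Bm * (T + 1)) * W.
have CF0 : 0 <= CF.
  by rewrite mulr_ge0 // /dom_cst addr_ge0 // mulr_ge0 // sqr_ge0.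
pose N := N1 + CF * N2 + 1.
have N0 : 0 < N by rewrite ltr_wpDl // addr_ge0 // mulr_ge0.
pose L := L1 + CF * L2 + 2 * L3 * (T + 1) * W * N2 + 1.
have L0 : 0 < L.
  have T1 : 0 <= T + 1 by rewrite addr_ge0.
  apply: ltr_wpDl => //; apply: addr_ge0; first by apply: addr_ge0 => //; exact: mulr_ge0.
  by apply: mulr_ge0 => //; apply: mulr_ge0 => //; apply: mulr_ge0 => //; exact: mulr_ge0.
(* [d <= 1] bounds the times at which the force is evaluated, [d <= r / 2] keeps
   the initial state in the ball, and the last two make the Picard operator
   preserve that ball and contract. *)
pose d := Num.min (Num.min 1 (r / 2)) (Num.min (r / 2 / N) (1 / 2 / L)).
have d0 : 0 < d by rewrite !lt_min ltr01 !divr_gt0.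
have d1 : d <= 1 by rewrite !ge_min lexx.
have dr : d <= r / 2 by rewrite !ge_min lexx orbT.
have dN : d * N <= r / 2.
  by rewrite -ler_pdivlMr // !ge_min lexx /= !orbT.
have dL : d * L <= 1 / 2.
  by rewrite -ler_pdivlMr // !ge_min lexx /= !orbT.
exists d => // z1 t1 phi0 z1d t1T cphi0 Bphi0 phi01.
pose h (z : R -> state) (s : R) := f (chart_inv c (pos (z s))).
pose X z s := drift A V0 f c (z s) + force (glue t1 phi0 (h z)) s *: push f c (z s).
pose P z := [/\ continuous z, z t1 = z1 & forall s, `|z s - z1| <= r / 2].
have Pr z s : P z -> `|z0 - z s| < r.
  move=> [_ _ Hz]; have -> : z0 - z s = (z0 - z1) + (z1 - z s) by rewrite addrA subrK.
  apply: le_lt_trans (ler_normD _ _) _; rewrite (splitr r).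
  apply: ltr_leD; first exact: lt_le_trans z1d dr.
  by rewrite -normrN opprB; exact: Hz.
have Pglue z : P z -> continuous (glue t1 phi0 (h z)).
  move=> Pz; have [cz zt _] := Pz.
  apply: continuous_glue => //; last by rewrite /h zt.
  exact: (lip_continuous L30 r3 (fun s => Pr z s Pz) cz).
have glue_le z s : P z -> `|glue t1 phi0 (h z) s| <= Bm.
  move=> Pz; rewrite /glue; case: ifP => _.
    by apply: le_trans (g3 _ (Pr z s Pz)) _; rewrite lerDr.
  by apply: le_trans (Bphi0 s) _; rewrite lerDl.
have sT s : t1 - d <= s <= t1 + d -> `|s| <= T + 1.
  by move: t1T d1; rewrite !ler_norml; lra.
have F_le z s : P z -> t1 - d <= s <= t1 + d -> `|force (glue t1 phi0 (h z)) s| <= CF.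
  move=> Pz Hs; apply: (force_le hO (Pglue z Pz) Bm0 (sT s Hs)) => s' _.
  exact: glue_le.
have [||||||||z Pz Dz] := @picard R 2 m t1 d (r / 2) L N z1 X d0.
- exact/ltW/divr_gt0.
- exact: ltW.
- exact: ltW.
- exact: dN.
- exact: dL.
- move=> z Pz; have [cz _ _] := Pz => s.
  apply: cvgD; first exact: (lip_continuous L10 r1 (fun s => Pr z s Pz) cz).
  apply: cvgZ; first exact: (force_continuous (Pglue z Pz)).
  exact: (lip_continuous L20 r2 (fun s => Pr z s Pz) cz).
- move=> z s Pz Hs; apply: le_trans (ler_normD _ _) _.
  apply: (@le_trans _ _ (N1 + CF * N2)); last by rewrite lerDl.
  apply: lerD; first exact: g1 (Pr z s Pz).
  rewrite normrZ; apply: ler_pM => //; first exact: F_le.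
  exact: g2 (Pr z s Pz).
- move=> z z' e Pz Pz' e0 He s Hs.
  have E : X z s - X z' s = (drift A V0 f c (z s) - drift A V0 f c (z' s))
    + (force (glue t1 phi0 (h z)) s *: (push f c (z s) - push f c (z' s))
       + (force (glue t1 phi0 (h z)) s - force (glue t1 phi0 (h z')) s) *: push f c (z' s)).
    exact: affine_sub.
  rewrite E; apply: le_trans (ler_normD _ _) _.
  have -> : L * e = L1 * e + (CF * L2 * e + 2 * (L3 * e) * (T + 1) * W * N2) + e.
    by rewrite /L; ring.
  apply: (@le_trans _ _ (L1 * e + (CF * L2 * e + 2 * (L3 * e) * (T + 1) * W * N2)));
    last by rewrite lerDl.
  apply: lerD.
    apply: le_trans (r1 _ _ (Pr z s Pz) (Pr z' s Pz')) _.
    by rewrite ler_wpM2l.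
  apply: le_trans (ler_normD _ _) _; apply: lerD.
    rewrite normrZ -mulrA; apply: ler_pM => //; first exact: F_le.
    apply: le_trans (r2 _ _ (Pr z s Pz) (Pr z' s Pz')) _.
    by rewrite ler_wpM2l.
  rewrite normrZ; apply: ler_pM => //; last exact: g2 (Pr z' s Pz').
  have L3e : 0 <= L3 * e by rewrite mulr_ge0.
  have FD : `|force (glue t1 phi0 (h z)) s - force (glue t1 phi0 (h z')) s| <=
      2 * (L3 * e) * `|s| * W.
    apply: (force_dist hO (Pglue z Pz) (Pglue z' Pz')) => s' _.
    rewrite /glue; case: ifP => _; last by rewrite subrr normr0.
    apply: le_trans (r3 _ _ (Pr z s' Pz) (Pr z' s' Pz')) _.
    by rewrite ler_wpM2l.
  apply: le_trans FD _; rewrite ler_wpM2r // ler_wpM2l ?mulr_ge0 //.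
  exact: sT.
have [cz zt1 _] := Pz; exists z; split=> //.
  by move=> s; apply: rimg; exact: Pr.
by split; [exact: Pglue|move=> s; exact: Dz].
Qed.

End LocalFlow.

(** * Motions on the manifold and their energy *)

Lemma between_dist (R : realType) (s t q : R) : between s t q -> `|s - q| <= `|s - t|.
Proof.
rewrite /between; case: (leP s t) => st /andP[sq qt].
  by rewrite (distrC s q) (distrC s t) !ger0_norm ?subr_ge0 // lerB.
by rewrite !ger0_norm ?subr_ge0 ?lerB // ltW.
Qed.

Lemma between_right (R : realType) (s t : R) : between s t t.
Proof. by rewrite /between ge_min le_max !lexx !orbT. Qed.

Lemma quad_lincomb (R : realType) m (B : 'M[R]_m) (a b : R) (v w : 'rV[R]_m) :
  quad B (a *: v - b *: w) = a ^+ 2 * quad B v - a * b * (v *m B *m w^T) 0 0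
    - a * b * (w *m B *m v^T) 0 0 + b ^+ 2 * quad B w.
Proof.
have trE : (a *: v - b *: w)^T = a *: v^T - b *: w^T.
  by apply/matrixP => i j; rewrite !mxE.
rewrite /quad trE !mulmxBr !mulmxBl -!scalemxAr -!scalemxAl.
move: (v *m B *m v^T) (v *m B *m w^T) (w *m B *m v^T) (w *m B *m w^T) => a1 a2 a3 a4.
by rewrite !mxE; ring.
Qed.

Lemma locally_constant (R : realType) (g : R -> R) (a b : R) :
  (forall t, \forall r \near t, g t = g r) -> g a = g b.
Proof.
move=> H; have D (q : R) : is_derive q 1 g 0.
  exact: near_eq_is_derive (H q) (is_derive_cst (g q) q 1).
exact: (@derive0_between R b a g (fun q _ => D q)).
Qed.

Section Paths.
Variables (R : realType) (m : nat) (M : manifold R m).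
Variables (A : chart M -> 'rV[R]_m -> 'M[R]_m) (V0 f : M -> R).
Hypotheses (hA : riemannian A) (hV : smooth_fun V0) (hf : smooth_fun f).
Local Notation state := 'M[R]_(2, m).

Lemma smooth_continuous (g : M -> R) : smooth_fun g -> continuous g.
Proof.
move=> sg y; have [c cy] := chart_dom_cover y.
have cg : {for chart_map c y, continuous (g \o chart_inv c)}.
  by have [H _] := sg c 1%N; apply: H; exact: img_map.
apply: (@near_eq_continuous _ _ ((g \o chart_inv c) \o chart_map c)).
  have : \forall z \near y, chart_dom c z.
    by apply: open_nbhs_nbhs; split=> //; exact: chart_dom_open.
  by apply: filterS => z cz /=; rewrite chart_mapK.
exact: continuous_comp (chart_map_continuous cy) cg.
Qed.

Lemma velocity_near c (x y : R -> M) (t : R) : (\forall s \near t, x s = y s) ->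
  velocity c x t = velocity c y t.
Proof.
move=> xy; rewrite !velocityE; apply: near_eq_derive.
by apply: filterS xy => s /= ->.
Qed.

Lemma solves_near (x y : R -> M) (F t : R) : (\forall s \near t, x s = y s) ->
  solves A V0 f x F t -> solves A V0 f y F t.
Proof.
move=> xy Hx c; have xyt : x t = y t := nbhs_singleton xy.
rewrite -xyt => ct; have [du dp] := Hx c ct; split.
  by apply: near_eq_derivable du; apply: filterS xy => s /= ->.
rewrite -xyt -(velocity_near c xy).
apply: near_eq_is_derive dp; apply: filterS (nbhs_interior xy) => s xys.
by rewrite /momentum (velocity_near c xys) (nbhs_singleton xys).
Qed.

Lemma glue_left (T : Type) (t1 s : R) (g h : R -> T) : s < t1 -> glue t1 g h s = g s.
Proof. by rewrite /glue leNgt => ->. Qed.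

Lemma glue_right (T : Type) (t1 s : R) (g h : R -> T) : t1 <= s -> glue t1 g h s = h s.
Proof. by rewrite /glue => ->. Qed.

Lemma near_gt (a s : R) : a < s -> \forall r \near s, a < r.
Proof.
by move=> as_; apply: open_nbhs_nbhs; split.
Qed.

Lemma near_glue_left (T : Type) (t1 s : R) (g h : R -> T) : s < t1 ->
  \forall r \near s, g r = glue t1 g h r.
Proof. by move=> st; apply: filterS (lt_nbhsl st) => r rt; rewrite glue_left. Qed.

Lemma near_glue_right (T : Type) (t1 s : R) (g h : R -> T) : t1 < s ->
  \forall r \near s, h r = glue t1 g h r.
Proof. by move=> st; apply: filterS (near_gt st) => r rt; rewrite glue_right // ltW. Qed.

(** Two motions that meet with the same velocity can be joined, even though the
    second derivative of the position is not under control: the momenta glue. *)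
Lemma solves_glue (x y : R -> M) (F t1 : R) c :
    x t1 = y t1 -> {for t1, continuous x} ->
    solves A V0 f x F t1 -> solves A V0 f y F t1 ->
    {for t1, continuous y} ->
    chart_dom c (x t1) -> velocity c x t1 = velocity c y t1 ->
  solves A V0 f (glue t1 x y) F t1 /\
  forall d, chart_dom d (x t1) -> velocity d (glue t1 x y) t1 = velocity d x t1.
Proof.
move=> xy cx Hx Hy cy ct vc.
have gt1 : glue t1 x y t1 = x t1 by rewrite glue_right.
have vd d : chart_dom d (x t1) -> velocity d x t1 = velocity d y t1.
  move=> dt; have cyt : chart_dom c (y t1) by rewrite -xy.
  have dyt : chart_dom d (y t1) by rewrite -xy.
  have [_ ->] := velocity_transform cx dt ct (Hx c ct).1.
  have [_ ->] := velocity_transform cy dyt cyt (Hy c cyt).1.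
  by rewrite vc xy.
have dg d : chart_dom d (x t1) ->
    is_derive t1 1 (chart_map d \o glue t1 x y) (velocity d x t1).
  move=> dt; have dyt : chart_dom d (y t1) by rewrite -xy.
  have -> : chart_map d \o glue t1 x y =
      (fun s => if t1 <= s then (chart_map d \o y) s else (chart_map d \o x) s).
    by apply/funext => s; rewrite /= /glue; case: ifP.
  apply: is_derive_glue; last by rewrite /= xy.
    by rewrite velocityE; apply: derivableP; exact: (Hx d dt).1.
  by rewrite (vd d dt) velocityE; apply: derivableP; exact: (Hy d dyt).1.
have vg d : chart_dom d (x t1) -> velocity d (glue t1 x y) t1 = velocity d x t1.
  by move=> dt; rewrite velocityE; case: (dg d dt).
have momE d : chart_dom d (x t1) -> momentum A d x t1 = momentum A d y t1.
  by move=> dt; rewrite /momentum (vd d dt) xy.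
split; last exact: vg.
move=> d dt'; have dt : chart_dom d (x t1) by rewrite -gt1.
have dyt : chart_dom d (y t1) by rewrite -xy.
split; first by case: (dg d dt).
rewrite gt1 (vg d dt).
have -> : momentum A d (glue t1 x y) =
    (fun s => if t1 <= s then momentum A d y s else momentum A d x s).
  apply/funext => s; have [ts|st] := leP t1 s; last first.
    by rewrite /momentum (glue_left _ _ st) -(velocity_near d (near_glue_left x y st)).
  have [ts'|ts'] := eqVneq t1 s.
    by rewrite -ts' -(momE d dt) /momentum (vg d dt) gt1.
  have lts : t1 < s by rewrite lt_neqAle ts' ts.
  by rewrite /momentum (glue_right _ _ ts) -(velocity_near d (near_glue_right x y lts)).
have [_ px] := Hx d dt; have [_ py] := Hy d dyt.
rewrite -(vd d dt) -xy in py.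
exact: (is_derive_glue px py (momE d dt)).
Qed.

Lemma mom_legendre c (z : state) : img c (pos z) ->
  inverse_legendre A c z *m A c (pos z) = mom z.
Proof.
move=> cz; rewrite /inverse_legendre -scalemxAl -mulmxA mul_adj_mx mul_mx_scalar.
by rewrite scalerA mulVf ?scale1r //; exact: metric_det cz.
Qed.

Variables rho kappa xi0 dxi0 : R -> R.
Hypothesis hO : oscillators rho kappa xi0 dxi0.
Local Notation force := (field_force rho kappa xi0 dxi0).

(** The case of distance 0 of the Lipschitz estimate. *)
Lemma force_causal phi psi (t : R) : continuous phi -> continuous psi ->
  (forall s, between 0 t s -> phi s = psi s) -> force phi t = force psi t.
Proof.
move=> cphi cpsi H; apply/eqP; rewrite -subr_eq0 -normr_le0.
have := @force_dist _ _ _ _ _ hO phi psi t 0 cphi cpsi; rewrite mulr0 !mul0r; apply.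
by move=> s /H ->; rewrite subrr normr0.
Qed.

(** The particle moves under the force of the oscillators that it has itself
    excited since time 0. *)
Definition evolves (x : R -> M) (I : set R) : Prop :=
  continuous x /\ forall t, I t -> solves A V0 f x (force (f \o x) t) t.

(** The local flow, transported to the manifold; the equations then hold in every
    chart by covariance. *)
Lemma local_path (c : chart M) (z0 : state) (T B : R) :
    img c (pos z0) -> 0 <= T -> 0 <= B ->
  exists2 d : R, 0 < d & forall (z1 : state) (t1 : R) (phi0 : R -> R),
    `|z0 - z1| < d -> `|t1| <= T -> continuous phi0 ->
    (forall s, `|phi0 s| <= B) -> phi0 t1 = f (chart_inv c (pos z1)) ->
  exists y : R -> M,
    [/\ continuous y, chart_dom c (y t1), chart_map c (y t1) = pos z1,
        momentum A c y t1 = mom z1 &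
      let phi := glue t1 phi0 (f \o y) in
      continuous phi /\
      forall s, t1 - d < s < t1 + d -> solves A V0 f y (force phi s) s].
Proof.
move=> cz0 T0 B0; have [d d0 H] := local_flow hA hV hf hO cz0 T0 B0.
exists d => // z1 t1 phi0 z1d t1T cphi0 Bphi0 phi01.
have [z [cz zt1 iz [cphi Dz]]] := H z1 t1 phi0 z1d t1T cphi0 Bphi0 phi01.
pose y s := chart_inv c (pos (z s)).
have cpos : continuous (fun s => pos (z s)).
  move=> s; apply: mx_continuousP => i j.
  have -> : (fun s => pos (z s) i j) = (fun s => z s 0 j).
    by apply/funext => s'; rewrite mxE.
  by apply: entry_continuous; exact: cz.
have cy : continuous y.
  by move=> s; exact: continuous_comp (cpos s) (chart_inv_continuous (iz s)).
have yc s : chart_dom c (y s) by have [] := inv_img (iz s).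
have ym s : chart_map c (y s) = pos (z s) by have [] := inv_img (iz s).
have yE : chart_map c \o y = (fun s => pos (z s)).
  by apply/funext => s /=; rewrite ym.
have Dy s : t1 - d < s < t1 + d ->
    is_derive s 1 (chart_map c \o y) (inverse_legendre A c (z s)).
  move=> Hs; rewrite yE.
  rewrite -(pos_drift A V0 f c (z s)
    (force (glue t1 phi0 (fun r => f (chart_inv c (pos (z r))))) s)).
  apply/is_derive_mx => i j; rewrite (ord1 i) mxE.
  have -> : (fun r => pos (z r) 0 j) = (fun r => z r 0 j).
    by apply/funext => r; rewrite mxE.
  exact: (is_derive_mx _ _ _ _).1 (Dz s Hs) 0 j.
have vy s : t1 - d < s < t1 + d -> velocity c y s = inverse_legendre A c (z s).
  by move=> Hs; rewrite velocityE; case: (Dy s Hs).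
have py s : t1 - d < s < t1 + d -> momentum A c y s = mom (z s).
  by move=> Hs; rewrite /momentum vy // ym mom_legendre.
have t1d : t1 - d < t1 < t1 + d by rewrite ltrBlDr !ltrDl d0.
exists y; split=> //; first by rewrite ym zt1.
  by rewrite py // zt1.
split=> // s Hs e ey.
have ns : \forall r \near s, t1 - d < r < t1 + d.
  move/andP: Hs => [s1 s2].
  by apply: filterS2 (near_gt s1) (lt_nbhsl s2) => r -> ->.
apply: (newton_covariant hA hV hf (c := c)) => //.
- exact: cy.
- by apply: filterE => r; exact: cy.
- by apply: filterS ns => r Hr; have [] := Dy r Hr.
split; first by have [] := Dy s Hs.
rewrite vy // ym -mom_drift.
apply: (@near_eq_is_derive _ _ _ (fun r => mom (z r))).
  by apply: filterS ns => r Hr; rewrite py.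
apply/is_derive_mx => i j; rewrite (ord1 i) mxE.
have -> : (fun r => mom (z r) 0 j) = (fun r => z r 1 j).
  by apply/funext => r; rewrite mxE.
exact: (is_derive_mx _ _ _ _).1 (Dz s Hs) 1 j.
Qed.

Definition chart_at (y : M) : chart M := projT1 (cid (chart_dom_cover y)).

Lemma chart_atP y : chart_dom (chart_at y) y.
Proof. by rewrite /chart_at; case: cid. Qed.

(** Charts are chosen pointwise, so that the kinetic energy is a number attached to
    the motion; any other chart gives the same value. *)
Definition kinetic (x : R -> M) (t : R) : R :=
  let c := chart_at (x t) in quad (A c (chart_map c (x t))) (velocity c x t) / 2.

Lemma kineticE c (x : R -> M) (t : R) : {for t, continuous x} -> chart_dom c (x t) ->
    derivable (chart_map c \o x) t 1 ->
  kinetic x t = quad (A c (chart_map c (x t))) (velocity c x t) / 2.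
Proof.
move=> cx ct du; rewrite /kinetic; set d := chart_at (x t).
have dt : chart_dom d (x t) by exact: chart_atP.
have ou : overlap c d (chart_map c (x t)) by exists (x t).
have [_ ->] := velocity_transform cx dt ct du.
rewrite [in RHS](metric_transform hA ou) /quad /= chart_mapK //.
by rewrite trmx_mul !mulmxA.
Qed.

Lemma quad_ge0 c u w : img c u -> 0 <= quad (A c u) w.
Proof.
move=> cu; have [->|w0] := eqVneq w 0; last exact/ltW/(Defs.metric_posdef hA cu w0).
by rewrite /quad trmx0 mulmx0 mxE.
Qed.

Lemma kinetic_ge0 x t : 0 <= kinetic x t.
Proof. by rewrite divr_ge0 // quad_ge0 //; apply: img_map; exact: chart_atP. Qed.

(** Cauchy-Schwarz for the metric: the momentum is controlled by the kinetic
    energy and by the coefficients of the metric. *)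
Lemma momentum_le c (u w : 'rV[R]_m) k : img c u ->
  (w *m A c u) 0 k ^+ 2 <= quad (A c u) w * A c u k k.
Proof.
move=> cu; have sA := Defs.metric_sym hA cu.
pose e : 'rV[R]_m := delta_mx 0 k; set q := quad (A c u) w; set p := (w *m A c u) 0 k.
have eA : (e *m A c u *m e^T) 0 0 = A c u k k.
  by rewrite -rowE trmx_delta -colE mxE mxE.
have wA : (w *m A c u *m e^T) 0 0 = p by rewrite trmx_delta -colE mxE.
have eAw : (e *m A c u *m w^T) 0 0 = p by rewrite (mulmx_tr_sym _ _ sA).
have e0 : e != 0.
  by apply/eqP => /matrixP/(_ 0 k); rewrite !mxE !eqxx => /eqP; rewrite oner_eq0.
have a0 : 0 < A c u k k by have := Defs.metric_posdef hA cu e0; rewrite /quad eA.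
have := quad_ge0 (A c u k k *: w - p *: e) cu.
have -> : quad (A c u) (A c u k k *: w - p *: e) =
    A c u k k * (q * A c u k k - p ^+ 2).
  by rewrite quad_lincomb wA eAw -/(quad (A c u) w) -/q [quad _ e]eA; ring.
by rewrite pmulr_rge0 // subr_ge0.
Qed.

Definition total_energy (x : R -> M) (t : R) : R :=
  kinetic x t + V0 (x t)
  + (field_energy rho kappa xi0 dxi0 (f \o x) t / 2 - f (x t) * force (f \o x) t).

Lemma evolves_derivable c x (I : set R) t : evolves x I -> I t -> chart_dom c (x t) ->
  derivable (chart_map c \o x) t 1.
Proof. by move=> [_ H] /H/[apply] -[]. Qed.

Lemma interaction_continuous (x : R -> M) : continuous x -> continuous (f \o x).
Proof. by move=> cx t; apply: continuous_comp; [exact: cx|exact: smooth_continuous]. Qed.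

(** The energy, read in the chart at a given time, is constant on the part of the
    segment that stays in this chart. Stopping time at the ends of the segment turns
    this into local constancy on the whole line, where the mean value theorem
    applies. *)
Lemma energy_conserved x (a b : R) : a <= b ->
    evolves x [set t | a <= t <= b] ->
  total_energy x b = total_energy x a.
Proof.
move=> ab ex; have [cx Hx] := ex; have cfx := interaction_continuous cx.
pose h c r := quad (A c (chart_map c (x r))) (velocity c x r) / 2 + V0 (x r)
  + (field_energy rho kappa xi0 dxi0 (f \o x) r / 2 - f (x r) * force (f \o x) r).
have hE c r : a <= r <= b -> chart_dom c (x r) -> total_energy x r = h c r.
  by move=> Ir cr; rewrite /total_energy (kineticE (cx r) cr) //;
    exact: (evolves_derivable ex).
have Dh c r : a <= r <= b -> chart_dom c (x r) -> is_derive r 1 (h c) 0.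
  move=> Ir cr; have N := Hx r Ir c cr.
  have D1 := particle_energy_derive hA hV hf (cx r) cr N.
  have D2 := is_derive_comp_half (energy_derive hO r cfx).
  have [D3 _] := smooth_along hf (cx r) cr N.1.
  have D4 := force_derive hO r cfx.
  have D := is_deriveD D1 (is_deriveB D2 (is_deriveM (derivableP D3) D4)).
  by apply: (is_derive_eq D); rewrite /GRing.scale /=; field.
pose g r := total_energy x (clamp a b r).
have g_loc (t : R) : \forall r \near t, g t = g r.
  set s := clamp a b t; set c := chart_at (x s).
  have Is : a <= s <= b by exact: clamp_itv.
  have ns : \forall r \near s, chart_dom c (x r).
    by apply: near_dom; [exact: cx|exact: chart_atP].
  have [e e0 He] := near_ball2 ns ns.
  have cl : {for t, continuous (clamp a b)} by exact: clamp_continuous.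
  have /cvgrPdist_lt/(_ _ e0) := cl; apply: filterS => r sr.
  have Ir : a <= clamp a b r <= b by exact: clamp_itv.
  have Hb q : between s (clamp a b r) q -> a <= q <= b /\ chart_dom c (x q).
    move=> bq; split; last first.
      apply: (He _ _).1; apply: le_lt_trans sr.
      exact: between_dist.
    move: bq Is Ir; rewrite /between ge_min le_max; lra.
  have cs : chart_dom c (x s) by exact: chart_atP.
  have cr : chart_dom c (x (clamp a b r)) := (Hb _ (between_right _ _)).2.
  apply: (etrans (hE c s Is cs)); apply: (etrans _ (esym (hE c _ Ir cr))).
  by apply/esym/(@derive0_between R s _ (h c)) => q /Hb[Iq cq]; exact: Dh.
have := @locally_constant R g b a g_loc.
by rewrite /g !clamp_id ?lexx ?ab.
Qed.

End Paths.

(** * Continuation for positive times *)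

Lemma mk_state_dist (R : realType) m (u u' p p' : 'rV[R]_m) (d : R) : 0 < d ->
  `|u - u'| < d -> `|p - p'| < d -> `|mk_state u p - mk_state u' p'| < d.
Proof.
move=> d0 du dp; apply: mx_norm_lt => // i j.
have Hu := le_lt_trans (mx_entry_le (u - u') 0 j) du.
have Hp := le_lt_trans (mx_entry_le (p - p') 0 j) dp.
have subE (v w : 'rV[R]_m) : (v - w) 0 j = v 0 j - w 0 j by rewrite !mxE.
rewrite subE in Hu; rewrite subE in Hp.
by rewrite !mxE; case: ifP.
Qed.

Section Continuation.
Variables (R : realType) (m : nat) (M : manifold R m).
Variables (A : chart M -> 'rV[R]_m -> 'M[R]_m) (V0 f : M -> R).
Hypotheses (hA : riemannian A) (hV : smooth_fun V0) (hf : smooth_fun f).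
Variables rho kappa xi0 dxi0 : R -> R.
Hypothesis hO : oscillators rho kappa xi0 dxi0.
Local Notation force := (field_force rho kappa xi0 dxi0).
Local Notation state := 'M[R]_(2, m).
Local Notation evolves := (evolves A V0 f rho kappa xi0 dxi0).
Local Notation upto t1 := [set t : R | 0 <= t <= t1].

(** The initial velocity is mentioned because agreement up to [t1 = 0] does not
    determine the derivative at time 0. *)
Definition extends (t1 : R) (x x' : R -> M) : Prop :=
  (forall s, s <= t1 -> x' s = x s) /\
  forall c, chart_dom c (x 0) -> velocity c x' 0 = velocity c x 0.

Lemma extends_trans t1 t2 x y z : 0 <= t1 -> t1 <= t2 ->
  extends t1 x y -> extends t2 y z -> extends t1 x z.
Proof.
move=> t10 t12 [xy vxy] [yz vyz]; split=> [s st|c cx].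
  by rewrite yz ?xy // (le_trans st).
by rewrite vyz ?vxy // xy.
Qed.

(** At [t1] the two motions have the same velocity; before [t1] the force is
    unchanged, and after [t1] it is the force of the glued interaction, both by
    causality. *)
Lemma glue_step c (x y : R -> M) (t1 d e : R)
    (phi := glue t1 ((f \o x) \o clamp 0 t1) (f \o y)) :
    0 <= t1 -> evolves x (upto t1) -> continuous y -> x t1 = y t1 ->
    chart_dom c (x t1) -> velocity c x t1 = velocity c y t1 ->
    continuous phi ->
    (forall s, t1 - d < s < t1 + d -> solves A V0 f y (force phi s) s) ->
    0 < d -> e < d ->
  evolves (glue t1 x y) (upto (t1 + e)) /\ extends t1 x (glue t1 x y).
Proof.
move=> t10 [cx Hx] cy xy ct vxy cphi Hy d0 ed.
have cg : continuous (glue t1 x y) by move=> s; exact: continuous_glue.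
have t1I : upto t1 t1 by rewrite /= t10 lexx.
have t1d : t1 - d < t1 < t1 + d by rewrite ltrBlDr !ltrDl d0.
have cfx := interaction_continuous hf cx.
have cfg := interaction_continuous hf cg.
have phiE s r : 0 <= s -> between 0 s r -> (f \o glue t1 x y) r = phi r.
  move=> s0; rewrite /between (min_idPl s0) (max_idPr s0) => /andP[r0 rs].
  have [tr|rt] := leP t1 r; first by rewrite /phi /= !glue_right.
  by rewrite /phi /= !glue_left //= clamp_id // r0 ltW.
have gle r : r <= t1 -> glue t1 x y r = x r.
  move=> rt; have [tr|tr] := leP t1 r; last by rewrite glue_left.
  have -> : r = t1 by apply/eqP; rewrite eq_le tr rt.
  by rewrite glue_right.
have gx s r : s <= t1 -> between 0 s r -> (f \o glue t1 x y) r = (f \o x) r.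
  move=> st; rewrite /between le_max => /andP[_ rs] /=; rewrite gle //.
  by case/orP: rs => rs; [exact: le_trans rs _|exact: le_trans rs st].
have Ft1 : force (f \o x) t1 = force phi t1.
  apply: (etrans _ (force_causal hO cfg cphi (fun r => phiE t1 r t10))).
  exact: (force_causal hO cfx cfg (fun r br => esym (gx t1 r (lexx _) br))).
have Hyt : solves A V0 f y (force (f \o x) t1) t1 by rewrite Ft1; exact: Hy.
have [S1 vg] := solves_glue xy (cx t1) (Hx t1 t1I) Hyt (cy t1) ct vxy.
split; last first.
  split=> [s st|c' cx'].
    exact: gle.
  have [t1z|t1n] := eqVneq 0 t1.
    by rewrite t1z; apply: vg; rewrite -t1z.
  have t1p : 0 < t1 by rewrite lt_neqAle t1n.
  by rewrite -(velocity_near c' (near_glue_left x y t1p)).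
split; first exact: cg.
move=> s /= /andP[s0 se].
have [ts|st] := leP t1 s; last first.
  apply: (solves_near (near_glue_left x y st)).
  have -> : force (f \o glue t1 x y) s = force (f \o x) s.
    exact: (force_causal hO cfg cfx (fun r br => gx s r (ltW st) br)).
  by apply: Hx; rewrite /= s0 ltW.
have [ts'|ts'] := eqVneq t1 s.
  have FE : force (f \o glue t1 x y) t1 = force (f \o x) t1.
    exact: (force_causal hO cfg cfx (fun r br => gx t1 r (lexx _) br)).
  by rewrite -ts' FE.
have lts : t1 < s by rewrite lt_neqAle ts' ts.
apply: (solves_near (near_glue_right x y lts)).
have -> : force (f \o glue t1 x y) s = force phi s.
  exact: (force_causal hO cfg cphi (fun r => phiE s r s0)).
apply: Hy; apply/andP; split; last by apply: le_lt_trans se _; rewrite ltrD2l.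
by apply: lt_trans lts; rewrite ltrBlDr ltrDl.
Qed.

(** One time [e] for all motions that stand at [y] no later than [T]: the property
    that is to be made uniform over a compact set of points [y]. *)
Definition extendable (k T B e : R) (y : M) : Prop :=
  forall (x : R -> M) (t1 : R), 0 <= t1 <= T -> evolves x (upto t1) ->
    x t1 = y -> kinetic A x t1 <= k ->
    (forall s, 0 <= s <= t1 -> `|f (x s)| <= B) ->
  exists x', evolves x' (upto (t1 + e)) /\ extends t1 x x'.

Lemma velocity_eq c (x y : R -> M) (t : R) : chart_dom c (x t) -> x t = y t ->
  momentum A c x t = momentum A c y t -> velocity c x t = velocity c y t.
Proof.
move=> ct xy pxy; rewrite (velocity_momentum hA ct) (velocity_momentum hA (c := c) (x := y)).
  by rewrite -xy pxy.
by rewrite -xy.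
Qed.

(** Position and momentum at [t1] form an initial state near that of [y0] and [p0],
    and the time of the local path around the latter is uniform. *)
Lemma step_momentum (c : chart M) (y0 : M) (p0 : 'rV[R]_m) (T B : R) :
    chart_dom c y0 -> 0 <= T -> 0 <= B ->
  exists2 d : R, 0 < d & forall (x : R -> M) (t1 e : R),
    0 <= t1 <= T -> evolves x (upto t1) -> chart_dom c (x t1) ->
    `|chart_map c y0 - chart_map c (x t1)| < d -> `|p0 - momentum A c x t1| < d ->
    (forall s, 0 <= s <= t1 -> `|f (x s)| <= B) -> e < d ->
  exists x', evolves x' (upto (t1 + e)) /\ extends t1 x x'.
Proof.
move=> cy0 T0 B0; pose z0 := mk_state (chart_map c y0) p0.
have cz0 : img c (pos z0) by rewrite /z0 pos_mk; exact: img_map.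
have [d d0 H] := local_path hA hV hf hO cz0 T0 B0; exists d => // x t1 e.
move=> /andP[t10 t1T] ex ct du dp fB ed; have [cx _] := ex.
pose z1 := mk_state (chart_map c (x t1)) (momentum A c x t1).
have z1d : `|z0 - z1| < d.
  exact: mk_state_dist.
pose phi0 := (f \o x) \o clamp 0 t1.
have cphi0 : continuous phi0.
  move=> s; apply: continuous_comp; first exact: clamp_continuous.
  exact: interaction_continuous.
have Bphi0 s : `|phi0 s| <= B by apply: fB; exact: clamp_itv.
have phi01 : phi0 t1 = f (chart_inv c (pos z1)).
  by rewrite /phi0 /z1 pos_mk /= clamp_id ?t10 ?lexx // chart_mapK.
have t1T' : `|t1| <= T by rewrite ger0_norm.
have [y [cy cyt yt py [cphi Hy]]] := H z1 t1 phi0 z1d t1T' cphi0 Bphi0 phi01.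
have xy : x t1 = y t1 by rewrite -(chart_mapK ct) -(chart_mapK cyt) yt /z1 pos_mk.
have vxy : velocity c x t1 = velocity c y t1.
  by apply: velocity_eq => //; rewrite py /z1 mom_mk.
exists (glue t1 x y).
exact: (glue_step t10 ex cy xy ct vxy cphi Hy d0 ed).
Qed.

(** The momenta of bounded kinetic energy at points near [y0] stay in a ball, whose
    compactness makes the time of existence uniform in the momentum. *)
Lemma step_near (y0 : M) (k T B : R) : 0 <= k -> 0 <= T -> 0 <= B ->
  \forall y \near y0 & e \near (0 : R)^'+, extendable k T B e y.
Proof.
move=> k0 T0 B0; pose c := chart_at y0; have cy0 : chart_dom c y0 := chart_atP y0.
set u0 := chart_map c y0; have cu0 : img c u0 by exact: img_map.
(* [a] bounds the metric near [y0], and [Pm] the momenta: their squares are at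
   most [2 * k * a] by Cauchy-Schwarz. *)
pose a := `|A c u0| + 1; have a0 : 0 <= a by rewrite addr_ge0.
pose Pm := 2 * k * a + 1.
have Pm0 : 0 <= Pm by rewrite addr_ge0 // !mulr_ge0.
have nchart : \forall y \near y0, chart_dom c y.
  by apply: open_nbhs_nbhs; split=> //; exact: chart_dom_open.
have nA : \forall y \near y0, `|A c (chart_map c y)| <= a.
  have cA : {for y0, continuous (A c \o chart_map c)}.
    apply: continuous_comp; first exact: chart_map_continuous.
    by have [H _] := metric_class hA c 1%N; exact: H.
  have /cvgrPdist_le/(_ _ ltr01) := cA; apply: filterS => y /= Hy.
  rewrite /a -[X in `|X|](subrKC (A c u0)) addrC; apply: le_trans (ler_normD _ _) _.
  by rewrite [leRHS]addrC lerD2r distrC.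
have nu (d : R) : 0 < d -> \forall y \near y0, `|u0 - chart_map c y| < d.
  by move=> d0; have /cvgrPdist_lt/(_ _ d0) := chart_map_continuous cy0.
pose Q (q : M * R) (p : 'rV[R]_m) := forall (x : R -> M) (t1 : R), 0 <= t1 <= T ->
  evolves x (upto t1) -> x t1 = q.1 -> momentum A c x t1 = p ->
  (forall s, 0 <= s <= t1 -> `|f (x s)| <= B) ->
  exists x', evolves x' (upto (t1 + q.2)) /\ extends t1 x x'.
have ball_compact : compact [set p : 'rV[R]_m | `|p| <= Pm].
  apply: bounded_closed_compact.
    exists Pm; split; first exact: num_real.
    by move=> M' MM p /= /le_trans; apply; exact: ltW.
  apply: (@closed_comp _ _ (fun p : 'rV[R]_m => `|p|) [set r | r <= Pm]); last exact: closed_le.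
  by move=> p _; exact: norm_continuous.
have cover := (compact_near_coveringP _).1 ball_compact _
  (filter_prod (nbhs y0) (nbhs (0 : R)^'+)) Q _.
have {cover}/cover HQ : forall p0, [set p : 'rV[R]_m | `|p| <= Pm] p0 ->
    \forall p \near p0 & q \near filter_prod (nbhs y0) (nbhs (0 : R)^'+), Q q p.
  move=> p0 _; have [d d0 H] := step_momentum p0 cy0 T0 B0.
  exists ([set p | `|p0 - p| < d],
     [set q : M * R | (chart_dom c q.1 /\ `|u0 - chart_map c q.1| < d) /\ q.2 < d]).
    split; first by have /cvgrPdist_lt/(_ _ d0) := @cvg_id _ (nbhs p0).
    exists ([set y | chart_dom c y /\ `|u0 - chart_map c y| < d], [set e | e < d]).
      by split=> /=; [exact: filterI nchart (nu d d0)|exact: nbhs_right_lt].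
    by move=> [y e] [/= ? ?].
  move=> [p [y e]] [/= pd [[cy uy] ed]] x t1 t1T ex xy px fB /=.
  apply: (H x t1 e t1T ex) => //; rewrite ?xy ?px //.
have [[N D] /= [nN nD] ND] := HQ.
exists ([set y | N y /\ (chart_dom c y /\ `|A c (chart_map c y)| <= a)], D).
  by split=> //=; apply: filterI => //; exact: filterI.
move=> [y e] [/= [Ny [cy Ay]] De] x t1 t1T ex xy kx fB.
apply: (ND (y, e) _ (momentum A c x t1)) => //=.
have cxt : chart_dom c (x t1) by rewrite xy.
have cu := img_map cxt.
apply: mx_norm_le => // i j; rewrite (ord1 i).
have t1I : upto t1 t1 by case/andP: t1T => t10 _; rewrite /= t10 lexx.
rewrite (kineticE hA (ex.1 t1) cxt (evolves_derivable ex t1I cxt)) in kx.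
have H := momentum_le hA (velocity c x t1) j cu.
have Aj : A c (chart_map c (x t1)) j j <= a.
  by rewrite xy; apply: le_trans Ay; apply: le_trans (ler_norm _) _; exact: mx_entry_le.
have q0 := quad_ge0 hA (velocity c x t1) cu.
set p := (_ *m _) 0 j in H; change (`|p| <= Pm).
have H' : p ^+ 2 <= 2 * k * a.
  apply: le_trans H _; apply: le_trans (ler_wpM2l q0 Aj) _.
  by apply: ler_wpM2r => //; move: kx; lra.
have : `|p| <= p ^+ 2 + 1.
  rewrite -(real_normK (num_real p)); have := sqr_ge0 (`|p| - 1); have := sqr_ge0 `|p|; nra.
by move/le_trans; apply; rewrite lerD2r.
Qed.

Variables K b : R.
Hypothesis hK : \int[@lebesgue_measure R]_nu (rho nu * (ratio rho kappa nu / nu) ^+ 2) <= K.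
Let veff (y : M) := V0 y - K * f y ^+ 2 / 2.
Hypothesis Vmin : forall y, b <= veff y.
Hypothesis Vcpt : forall E, compact [set y | veff y <= E].
Local Notation total := (total_energy A V0 f rho kappa xi0 dxi0).

(** The effective potential is what remains of the energy after the oscillators
    have been minimized out. *)
Lemma energy_split (x : R -> M) (t : R) : continuous x ->
  kinetic A x t + veff (x t) <= total x t.
Proof.
move=> cx; have := energy_ge hO t (f (x t)) (interaction_continuous hf cx).
have hK' := hK; set I := \int[_]_nu _ in hK' *; rewrite /total_energy /veff => H.
have H1 : f (x t) ^+ 2 / 2 * I <= f (x t) ^+ 2 / 2 * K.
  by rewrite ler_wpM2l // divr_ge0 // sqr_ge0.
by move: H H1; lra.
Qed.

Lemma energy_bounds (x : R -> M) (t e : R) : continuous x -> total x t <= e ->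
  veff (x t) <= e /\ kinetic A x t <= e - b.
Proof.
move=> cx xe; have := energy_split t cx; have := kinetic_ge0 hA x t.
by have := Vmin (x t); move: xe; lra.
Qed.

Lemma interaction_bounded (e : R) :
  exists2 B, 0 <= B & forall y, veff y <= e -> `|f y| <= B.
Proof.
have : bounded_set (f @` [set y | veff y <= e]).
  apply: compact_bounded; apply: continuous_compact; last exact: Vcpt.
  by apply: continuous_subspaceT; exact: smooth_continuous.
move=> [B [_ HB]]; exists (`|B| + 1) => [|y ye]; first by rewrite addr_ge0.
by apply: HB; [rewrite (le_lt_trans (ler_norm B)) // ltrDl|exists y].
Qed.

(** Conservation of energy confines the particle to a compact sublevel set of the
    effective potential and bounds its kinetic energy, so finitely many of the
    local times of existence are enough. *)
Lemma step_uniform (e T : R) : 0 <= T ->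
  exists2 d : R, 0 < d & forall (x : R -> M) (t1 : R), 0 <= t1 <= T ->
    evolves x (upto t1) -> total x 0 <= e ->
  exists x', evolves x' (upto (t1 + d)) /\ extends t1 x x'.
Proof.
move=> T0; have [B B0 HB] := interaction_bounded e.
pose k := Num.max 0 (e - b); have k0 : 0 <= k by rewrite le_max lexx.
have H : \forall d \near (0 : R)^'+, [set y | veff y <= e] `<=` extendable k T B d.
  have cover := (compact_near_coveringP _).1 (@Vcpt e) R (nbhs (0 : R)^'+) (extendable k T B) _.
  by apply: cover => y _; exact: step_near.
have [d [d0 Hd]] := near_right_ex (near_right_and (nbhs_right_gt (0 : R)) H).
exists d => // x t1 /andP[t10 t1T] ex xe.
have He s : 0 <= s <= t1 -> veff (x s) <= e /\ kinetic A x s <= e - b.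
  move=> /andP[s0 st]; apply: energy_bounds; first by case: ex.
  rewrite (energy_conserved hA hV hf hO s0) //.
  by split; [case: ex|move=> r /andP[r0 rs]; apply: ex.2; rewrite /= r0 (le_trans rs)].
have t1I : 0 <= t1 <= t1 by rewrite t10 lexx.
apply: (Hd (x t1) (He t1 t1I).1 x t1) => //; first by rewrite t10.
  by apply: le_trans (He t1 t1I).2 _; rewrite le_max lexx orbT.
by move=> s /He[+ _]; exact: HB.
Qed.

(** At time 0 the oscillators have not yet felt the particle. *)
Lemma total_energy0 (x y : R -> M) : x 0 = y 0 ->
  (forall c, chart_dom c (x 0) -> velocity c x 0 = velocity c y 0) ->
  total x 0 = total y 0.
Proof.
move=> xy vxy; rewrite /total_energy.
have -> : kinetic A x 0 = kinetic A y 0.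
  by rewrite /kinetic -xy vxy //; exact: chart_atP.
have -> : force (f \o x) 0 = force (f \o y) 0.
  by apply: eq_Rintegral => nu _; rewrite !osc_pos0.
have -> : field_energy rho kappa xi0 dxi0 (f \o x) 0 =
    field_energy rho kappa xi0 dxi0 (f \o y) 0.
  by apply: eq_Rintegral => nu _; rewrite !osc_pos0 !osc_vel0.
by rewrite xy.
Qed.

Lemma evolves_sub x (t1 t2 : R) : t1 <= t2 -> evolves x (upto t2) -> evolves x (upto t1).
Proof.
by move=> t12 [cx Hx]; split=> // t /andP[t0 tt]; apply: Hx; rewrite /= t0 (le_trans tt).
Qed.

Lemma extends_energy t1 x y : 0 <= t1 -> extends t1 x y -> total y 0 = total x 0.
Proof.
by move=> t10 [xy vxy]; apply: total_energy0; [exact: xy|move=> c; rewrite xy //; exact: vxy].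
Qed.

(** Steps of constant length reach any given time. *)
Lemma continue_until (T t1 : R) x : 0 <= t1 <= T -> evolves x (upto t1) ->
  exists y, evolves y (upto T) /\ extends t1 x y.
Proof.
move=> /andP[t10 t1T]; have [d d0 H] := step_uniform (total x 0) (le_trans t10 t1T).
have [n] : exists n : nat, T <= t1 + n%:R * d.
  have q0 : 0 <= (T - t1) / d by rewrite divr_ge0 ?subr_ge0 // ltW.
  exists (Num.bound ((T - t1) / d)); rewrite -lerBlDl -ler_pdivrMr //.
  exact/ltW/archi_boundP.
have : total x 0 <= total x 0 by [].
move: {1 3 4}(x) t10 t1T; elim: n t1 => [|n IH] t1 y t10 t1T ye Tn ey.
  by rewrite mul0r addr0 in Tn; exists y; split; [exact: evolves_sub Tn ey|].
have t1I : 0 <= t1 <= T by rewrite t10.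
have [z [ez xz]] := H y t1 t1I ey ye.
have [Td|dT] := leP T (t1 + d); first by exists z; split; [exact: evolves_sub Td ez|].
have td0 : 0 <= t1 + d by rewrite addr_ge0 // ltW.
have zE : total z 0 <= total x 0 by rewrite (extends_energy t10 xz).
have Tn' : T <= t1 + d + n%:R * d.
  by apply: le_trans Tn _; rewrite -natr1 mulrDl mul1r addrA addrAC.
have [w [ew zw]] := IH (t1 + d) z td0 (ltW dT) zE Tn' ez.
exists w; split=> //; apply: (extends_trans t10 _ xz zw).
by rewrite lerDl ltW.
Qed.

(** A sequence of motions, each extending the previous one by a unit of time, glued
    pointwise. *)
Lemma continue_forever x : evolves x (upto 0) ->
  exists y, evolves y [set t | 0 <= t] /\ extends 0 x y.
Proof.
move=> ex.
have /boolp.choice[next Hn] : forall p : nat * (R -> M), exists y,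
    evolves p.2 (upto p.1%:R) ->
    evolves y (upto p.1.+1%:R) /\ extends p.1%:R p.2 y.
  move=> [n y] /=.
  have [ey|ney] := pselect (evolves y (upto n%:R)); last by exists y.
  have nI : 0 <= (n%:R : R) <= n.+1%:R by rewrite ler0n ler_nat leqnSn.
  by have [z Hz] := continue_until nI ey; exists z.
pose X := fix X n := if n is n'.+1 then next (n', X n') else x.
have eX n : evolves (X n) (upto n%:R).
  by elim: n => [|n IH]; [exact: ex|exact: (Hn (n, X n) IH).1].
have XS n : extends n%:R (X n) (X n.+1) by exact: (Hn (n, X n) (eX n)).2.
have Xij i j s : (i <= j)%N -> s <= i%:R -> X j s = X i s.
  move=> ij si; elim: j ij => [|j IH]; first by rewrite leqn0 => /eqP ->.
  rewrite leq_eqVlt => /orP[/eqP -> //|]; rewrite ltnS => ij.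
  by rewrite (XS j).1 ?IH // (le_trans si) // ler_nat.
have vX n c : chart_dom c (x 0) -> velocity c (X n) 0 = velocity c x 0.
  move=> cx0; elim: n => [//|n IH]; rewrite (XS n).2 //.
  by rewrite (Xij 0%N n).
pose y s := X (Num.bound `|s|) s.
have yX n s : s <= n%:R -> y s = X n s.
  move=> sn; have sb : s <= (Num.bound `|s|)%:R.
    by apply: le_trans (ler_norm s) _; exact/ltW/archi_boundP.
  have [nb|bn] := leqP n (Num.bound `|s|); first exact: Xij.
  by apply/esym/Xij => //; exact: ltnW.
have ny t : \forall s \near t, X (Num.bound `|t|) s = y s.
  have tb : t < (Num.bound `|t|)%:R.
    by apply: le_lt_trans (ler_norm t) _; exact: archi_boundP.
  by apply: filterS (lt_nbhsl tb) => s sb; rewrite (yX _ s (ltW sb)).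
have cy : continuous y.
  by move=> t; apply: near_eq_continuous (ny t) _; have [cX _] := eX (Num.bound `|t|); exact: cX.
exists y; split; last first.
  split=> [s s0|c cx0]; first exact: (yX 0%N).
  by rewrite -(velocity_near c (ny 0)); exact: vX.
split; first exact: cy.
move=> t t0; set n := Num.bound `|t|; have [cX HX] := eX n.
have tn : t <= n%:R by apply: le_trans (ler_norm t) _; exact/ltW/archi_boundP.
apply: (solves_near (ny t)); rewrite -/n.
have -> : force (f \o y) t = force (f \o X n) t.
  apply: (force_causal hO).
  - exact: interaction_continuous.
  - exact: interaction_continuous.
  move=> s; rewrite /between (max_idPr t0) => /andP[_ st] /=.
  by rewrite (yX n) // (le_trans st).
by apply: HX; rewrite /= t0.
Qed.

End Continuation.

(** * Motions for all times *)

Section Reversal.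
Variable R : realType.

Lemma is_derive_opp_comp n (g : R -> 'rV[R]_n) (t : R) (dg : 'rV[R]_n) :
  is_derive (- t) 1 g dg -> is_derive t 1 (g \o -%R) (- dg).
Proof.
move=> Dg; apply/is_derive_mx => i j; rewrite mxE.
have D1 : is_derive (- t) 1 (fun s => g s i j) (dg i j) := (is_derive_mx _ _ _ _).1 Dg i j.
have DN : is_derive t 1 (-%R : R -> R) (-1) by exact: is_deriveN (is_derive_id t 1).
apply: (is_derive_eq (@is_derive1_comp R _ (-%R : R -> R) t _ _ D1 DN)).
by rewrite mulrN1.
Qed.

(** Valid also at the points where no derivative exists, since both sides are then
    the default value 0. This matters at time 0, near which a motion need not be
    differentiable for negative times. *)
Lemma derive_opp_comp n (g : R -> 'rV[R]_n) (t : R) :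
  'D_1 (g \o -%R) t = - 'D_1 g (- t).
Proof.
have [dg|ndg] := pselect (derivable g (- t) 1).
  by have [_ ->] := is_derive_opp_comp (derivableP dg).
have ndgN : ~ derivable (g \o -%R) t 1.
  move=> dgN; apply: ndg; rewrite -(opprK t) in dgN.
  have [H _] := is_derive_opp_comp (derivableP dgN).
  suff <- : (g \o -%R) \o -%R = g by [].
  by apply/funext => s /=; rewrite opprK.
have L1 : 'D_1 (g \o -%R) t = point by exact: dvgP ndgN.
have L2 : 'D_1 g (- t) = point by exact: dvgP ndg.
apply: (etrans L1); apply: (etrans _ (esym (congr1 -%R L2))).
by apply/rowP => j; rewrite !mxE oppr0.
Qed.

End Reversal.

Section TwoSided.
Variables (R : realType) (m : nat) (M : manifold R m).
Variables (A : chart M -> 'rV[R]_m -> 'M[R]_m) (V0 f : M -> R).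
Hypotheses (hA : riemannian A) (hV : smooth_fun V0) (hf : smooth_fun f).

Lemma quadN n (B : 'M[R]_n) (w : 'rV[R]_n) : quad B (- w) = quad B w.
Proof.
have -> : - w = 0 *: w - 1 *: w by rewrite scale0r scale1r add0r.
by rewrite quad_lincomb; ring.
Qed.

(** The law of motion is even in the velocity. *)
Lemma solves_reverse (x : R -> M) (F t : R) :
  solves A V0 f x F (- t) -> solves A V0 f (x \o -%R) F t.
Proof.
move=> H c ct; have [du dp] := H c ct.
have vE s : velocity c (x \o -%R) s = - velocity c x (- s).
  by rewrite !velocityE; exact: (derive_opp_comp (chart_map c \o x) s).
split.
  by have [] := is_derive_opp_comp (derivableP du).
have pE : momentum A c (x \o -%R) = (fun s => - (momentum A c x \o -%R) s).
  by apply/funext => s; rewrite /momentum vE mulNmx.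
have := is_deriveN (is_derive_opp_comp dp); rewrite opprK.
have -> : law A V0 f c (chart_map c ((x \o -%R) t)) (velocity c (x \o -%R) t) F =
    law A V0 f c (chart_map c (x (- t))) (velocity c x (- t)) F.
  by rewrite vE; apply/rowP => k; rewrite !mxE quadN.
by rewrite pE.
Qed.

Variables rho kappa : R -> R.
Variables K b : R.
Hypothesis hK : \int[@lebesgue_measure R]_nu (rho nu * (ratio rho kappa nu / nu) ^+ 2) <= K.
Hypothesis Vmin : forall y, b <= V0 y - K * f y ^+ 2 / 2.
Hypothesis Vcpt : forall E, compact [set y | V0 y - K * f y ^+ 2 / 2 <= E].

(** At time 0 there is no past yet; the local solution is started from a constant one. *)
Lemma start_path xi0 dxi0 (c : chart M) (x0 : M) (v0 : 'rV[R]_m) :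
    oscillators rho kappa xi0 dxi0 -> chart_dom c x0 ->
  exists x, [/\ evolves A V0 f rho kappa xi0 dxi0 x [set t | 0 <= t <= 0],
    x 0 = x0 & velocity c x 0 = v0].
Proof.
move=> hO cx0; pose z0 := mk_state (chart_map c x0) (v0 *m A c (chart_map c x0)).
have cz0 : img c (pos z0) by rewrite /z0 pos_mk; exact: img_map.
have [d d0 H] := local_path hA hV hf hO cz0 (lexx 0) (normr_ge0 (f x0)).
have dz : `|z0 - z0| < d by rewrite subrr normr0.
have c0 : `|0 : R| <= 0 by rewrite normr0.
have f0 : f x0 = f (chart_inv c (pos z0)) by rewrite /z0 pos_mk chart_mapK.
have [y [cy cy0 y0 py [cphi Hy]]] := H z0 0 (fun=> f x0) dz c0
  (@cst_continuous _ _ (f x0)) (fun _ => lexx _) f0.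
have yx : y 0 = x0 by rewrite -(chart_mapK cy0) y0 /z0 pos_mk chart_mapK.
exists y; split=> //; last first.
  rewrite (velocity_momentum hA cy0) py /z0 mom_mk yx -mulmxA mul_mx_adj mul_mx_scalar.
  by rewrite scalerA mulVf ?scale1r //; apply: (metric_det hA); exact: img_map.
split=> // t /= t0; have {t0}-> : t = 0 by apply/eqP; rewrite eq_le andbC.
have <- : field_force rho kappa xi0 dxi0 (glue 0 (fun=> f x0) (f \o y)) 0 =
    field_force rho kappa xi0 dxi0 (f \o y) 0.
  by apply: eq_Rintegral => nu _; rewrite !osc_pos0.
by apply: Hy; rewrite sub0r add0r oppr_lt0 d0.
Qed.

Lemma forward xi0 dxi0 (c : chart M) (x0 : M) (v0 : 'rV[R]_m) :
    oscillators rho kappa xi0 dxi0 -> chart_dom c x0 ->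
  exists x, [/\ evolves A V0 f rho kappa xi0 dxi0 x [set t | 0 <= t],
    x 0 = x0 & velocity c x 0 = v0].
Proof.
move=> hO cx0; have [x [ex x00 vx]] := start_path v0 hO cx0.
have [y [ey [xy vxy]]] := continue_forever hA hV hf hO hK Vmin Vcpt ex.
by exists y; split; rewrite ?xy ?vxy ?x00 // x00.
Qed.

(** The motion for negative times is the reversal of the motion that starts with
    the opposite velocities of the particle and of the oscillators. *)
Lemma global_motion xi0 dxi0 (c : chart M) (x0 : M) (v0 : 'rV[R]_m) :
    oscillators rho kappa xi0 dxi0 -> chart_dom c x0 ->
  exists x, [/\ evolves A V0 f rho kappa xi0 dxi0 x setT,
    x 0 = x0 & velocity c x 0 = v0].
Proof.
move=> hO cx0.
have [x [[cx Hx] x00 vx]] := forward v0 hO cx0.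
have [xb [[cxb Hxb] xb0 vxb]] := forward (- v0) (oscillators_reverse hO) cx0.
pose y := xb \o -%R.
have cy : continuous y.
  by move=> t; apply: continuous_comp; [exact: opp_continuous|exact: cxb].
have y0 : y 0 = x0 by rewrite /y /= oppr0.
have cfy := interaction_continuous hf cy.
have Hy t : t <= 0 -> solves A V0 f y (field_force rho kappa xi0 dxi0 (f \o y) t) t.
  move=> t0; apply: solves_reverse.
  have -> : field_force rho kappa xi0 dxi0 (f \o y) t =
      field_force rho kappa xi0 (fun nu => - dxi0 nu) (f \o xb) (- t).
    have E : (f \o y) \o -%R = f \o xb by apply/funext => s; rewrite /y /= opprK.
    have FR := @field_force_reverse R rho kappa xi0 dxi0 (f \o y) (- t) cfy.
    apply: (etrans (congr1 (field_force rho kappa xi0 dxi0 (f \o y)) (esym (opprK t)))).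
    apply: (etrans (esym FR)).
    exact: (congr1 (fun g => field_force rho kappa xi0 (fun nu => - dxi0 nu) g (- t)) E).
  by apply: Hxb; rewrite /= oppr_ge0.
have yx : y 0 = x 0 by rewrite y0 x00.
have F0 z : field_force rho kappa xi0 dxi0 (f \o z) 0 =
    field_force rho kappa xi0 dxi0 (f \o x) 0.
  by apply: eq_Rintegral => nu _; rewrite !osc_pos0.
have vy : velocity c y 0 = v0.
  rewrite velocityE (derive_opp_comp (chart_map c \o xb) 0) oppr0 -velocityE vxb.
  by rewrite opprK.
have S0x : solves A V0 f x (field_force rho kappa xi0 dxi0 (f \o x) 0) 0.
  by apply: Hx; rewrite /= lexx.
have S0y : solves A V0 f y (field_force rho kappa xi0 dxi0 (f \o x) 0) 0.
  by rewrite -(F0 y); exact: Hy.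
have cy0 : chart_dom c (y 0) by rewrite y0.
have [S0 v0g] := solves_glue yx (cy 0) S0y S0x (cx 0) cy0 (etrans vy (esym vx)).
pose z := glue 0 y x.
have cz : continuous z by move=> t; exact: continuous_glue.
have cfz := interaction_continuous hf cz.
have cfx := interaction_continuous hf cx.
exists z; split; [|by rewrite /z glue_right|by rewrite /z v0g].
split; first exact: cz.
move=> t _; have [t0|t0] := ltP t 0.
  apply: (solves_near (near_glue_left y x t0)).
  have -> : field_force rho kappa xi0 dxi0 (f \o z) t =
      field_force rho kappa xi0 dxi0 (f \o y) t.
    apply: (force_causal hO cfz cfy) => s.
    rewrite /between (max_idPl (ltW t0)) => /andP[_ s0] /=.
    have [s0'|s0'] := leP 0 s; last by rewrite /z glue_left.
    have -> : s = 0 by apply/eqP; rewrite eq_le s0 s0'.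
    by rewrite /z glue_right // yx.
  exact/Hy/ltW.
have FE : field_force rho kappa xi0 dxi0 (f \o z) t =
    field_force rho kappa xi0 dxi0 (f \o x) t.
  apply: (force_causal hO cfz cfx) => s.
  by rewrite /between (min_idPl t0) => /andP[s0 _] /=; rewrite /z glue_right.
rewrite FE; have [t0'|t0'] := eqVneq 0 t; first by rewrite -t0'.
have lt0 : 0 < t by rewrite lt_neqAle t0' t0.
by apply: (solves_near (near_glue_right y x lt0)); exact: Hx.
Qed.

End TwoSided.

(** * Finiteness of the integrals and equations of motion *)

Section FiniteIntegrals.
Variable R : realType.
Local Notation mu := (@lebesgue_measure R).
Local Notation intg f := (mu.-integrable [set: R] (fun nu : R => (f nu)%:E)).

Lemma quotient_cases (a s : R) : 0 <= a ->
  (a%:E / s%:E)%E = if s == 0 then if a == 0 then 0%E else +oo%E else (a / s)%:E.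
Proof.
move=> a0; rewrite inver; case: ifP => [_|//].
have [->|an] := eqVneq a 0; first by rewrite mul0e.
by rewrite gt0_muley // lte_fin lt_neqAle eq_sym an.
Qed.

Lemma ge0_integrable (g : R -> \bar R) : measurable_fun [set: R] g ->
    (forall nu, (0 <= g nu)%E) -> (\int[mu]_nu g nu < +oo)%E ->
  mu.-integrable [set: R] g.
Proof.
move=> mg g0 fin; apply/integrableP; split=> //.
have -> : (fun nu => `|g nu|%E) = g by apply/funext => nu; exact: gee0_abs.
exact: fin.
Qed.

Lemma quotient_integrable (a s : R -> R) :
    measurable_fun [set: R] a -> measurable_fun [set: R] s ->
    (forall nu, 0 <= a nu) -> (forall nu, 0 <= s nu) ->
    (\int[mu]_nu ((a nu)%:E / (s nu)%:E) < +oo)%E ->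
  mu.-integrable [set: R] (fun nu => ((a nu)%:E / (s nu)%:E)%E).
Proof.
move=> ma ms a0 s0; apply: ge0_integrable; last first.
  by move=> nu; rewrite quotient_cases //; do ?case: ifP => _ //; rewrite lee_fin divr_ge0.
have -> : (fun nu => ((a nu)%:E / (s nu)%:E)%E) =
    (fun nu => if s nu == 0 then if a nu == 0 then 0%E else +oo%E else (a nu / s nu)%:E).
  by apply/funext => nu; rewrite quotient_cases.
apply: measurable_fun_ifT.
- by apply: measurable_fun_eqr => //; exact: measurable_cst.
- apply: measurable_fun_ifT; [|exact: measurable_cst|exact: measurable_cst].
  by apply: measurable_fun_eqr => //; exact: measurable_cst.
- apply/measurable_EFinP; apply: measurable_funM => //.
  exact: measurable_funV.
Qed.

Variables rho kappa xi0 dxi0 : R -> R.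
Hypotheses (rho_meas : measurable_fun [set: R] rho)
  (kappa_meas : measurable_fun [set: R] kappa)
  (xi0_meas : measurable_fun [set: R] xi0)
  (dxi0_meas : measurable_fun [set: R] dxi0)
  (rho_ge0 : forall nu, 0 <= rho nu)
  (fin1 : (\int[mu]_nu kappa2_rho rho kappa nu < +oo)%E)
  (fin2 : (\int[mu]_nu kappa2_rho_nu2 rho kappa nu < +oo)%E)
  (fin3 : (\int[mu]_nu (rho nu * (dxi0 nu ^+ 2 + nu ^+ 2 * xi0 nu ^+ 2))%:E < +oo)%E).

Let int1 : mu.-integrable [set: R] (kappa2_rho rho kappa).
Proof.
apply: quotient_integrable => // [|nu]; last exact: sqr_ge0.
exact: measurable_funX.
Qed.

Let int2 : mu.-integrable [set: R] (kappa2_rho_nu2 rho kappa).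
Proof.
apply: quotient_integrable => // [||nu|nu]; [exact: measurable_funX| |exact: sqr_ge0|].
  by apply: measurable_funM => //; apply: measurable_funX; exact: measurable_id.
by rewrite mulr_ge0 // sqr_ge0.
Qed.

Let ratio_meas : measurable_fun [set: R] (ratio rho kappa).
Proof. by apply: measurable_funM => //; exact: measurable_funV. Qed.

Lemma ratio_sq_le nu :
  ((rho nu * ratio rho kappa nu ^+ 2)%:E <= kappa2_rho rho kappa nu)%E.
Proof.
rewrite /kappa2_rho quotient_cases ?sqr_ge0 //; case: ifPn => [/eqP r0|r0].
  by rewrite r0 mul0r; case: ifP => _; [exact: lexx|exact: leey].
by rewrite lee_fin /ratio le_eqVlt; apply/orP; left; apply/eqP; field.
Qed.

Lemma ratio_nu_sq_le nu :
  ((rho nu * (ratio rho kappa nu / nu) ^+ 2)%:E <= kappa2_rho_nu2 rho kappa nu)%E.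
Proof.
rewrite /kappa2_rho_nu2 quotient_cases ?sqr_ge0 //; case: ifPn => [|].
  rewrite mulf_eq0 => /orP[/eqP ->|]; first rewrite mul0r.
    by case: ifP => _; [exact: lexx|exact: leey].
  rewrite expf_eq0 /= => /eqP ->; rewrite invr0 mulr0 expr0n /= mulr0.
  by case: ifP => _; [exact: lexx|exact: leey].
rewrite mulf_eq0 expf_eq0 /= negb_or => /andP[r0 n0].
by rewrite lee_fin /ratio le_eqVlt; apply/orP; left; apply/eqP; field; rewrite r0 n0.
Qed.

Let intg_below (g : R -> R) (h : R -> \bar R) : measurable_fun [set: R] g ->
    (forall nu, 0 <= g nu) -> (forall nu, ((g nu)%:E <= h nu)%E) ->
    mu.-integrable [set: R] h -> intg g.
Proof.
move=> mg g0 gh ih; apply: (le_integrable measurableT _ _ ih).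
  exact/measurable_EFinP.
move=> nu _; rewrite gee0_abs ?lee_fin //; apply: le_trans (gh nu) _.
exact: lee_abs.
Qed.

Let int_ratio_nu : intg (fun nu => rho nu * (ratio rho kappa nu / nu) ^+ 2).
Proof.
apply: (intg_below _ _ ratio_nu_sq_le int2) => [|nu]; last first.
  by rewrite mulr_ge0 // sqr_ge0.
apply: measurable_funM => //; apply: measurable_funX; apply: measurable_funM => //.
exact: measurable_inv.
Qed.

(** Where rho vanishes and kappa does not, the first quotient is infinite; this can
    only happen on a null set when its integral is finite. *)
Lemma finite_oscillators : oscillators rho kappa xi0 dxi0.
Proof.
split=> //.
- have /(ae_imply) := integrable_ae measurableT int1; apply => nu /(_ I).
  rewrite /kappa2_rho quotient_cases ?sqr_ge0 // /ratio.
  case: ifPn => [/eqP ->|r0 _]; last by rewrite mulrC divfK.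
  by rewrite mul0r sqrf_eq0; case: ifPn => [/eqP|].
- apply: (intg_below _ _ ratio_sq_le int1) => [|nu].
    by apply: measurable_funM => //; exact: measurable_funX.
  by rewrite mulr_ge0 // sqr_ge0.
- apply: ge0_integrable fin3 => [|nu]; last first.
    rewrite lee_fin; apply: mulr_ge0 => //; apply: addr_ge0; first exact: sqr_ge0.
    by apply: mulr_ge0; exact: sqr_ge0.
  apply/measurable_EFinP; apply: measurable_funM => //; apply: measurable_funD.
    exact: measurable_funX.
  by apply: measurable_funM; apply: measurable_funX => //; exact: measurable_id.
Qed.

(** The two integrands differ at most where the quotients of extended reals and of
    reals follow different conventions, and there the left one is 0. *)
Lemma coupling_ge : \int[mu]_nu (rho nu * (ratio rho kappa nu / nu) ^+ 2) <=
  coupling_const rho kappa.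
Proof.
apply: fine_le.
- exact: integrable_fin_num int_ratio_nu.
- exact: integrable_fin_num int2.
- by apply: le_integral => // nu _; exact: ratio_nu_sq_le.
Qed.

End FiniteIntegrals.

Section Conclusions.
Variables (R : realType) (m : nat) (M : manifold R m).
Variables (A : chart M -> 'rV[R]_m -> 'M[R]_m) (V0 f : M -> R).
Hypotheses (hA : riemannian A) (hV : smooth_fun V0) (hf : smooth_fun f).
Local Notation e_ i := (delta_mx 0 i : 'rV[R]_m).

(** The Legendre transform of a quadratic Lagrangian, by symmetry of the metric. *)
Lemma lagrangian_momentum c u w k : img c u ->
  'D_(e_ k) (lagrangian A V0 c u) w = (w *m A c u) 0 k.
Proof.
move=> cu; have sA := Defs.metric_sym hA cu.
have HQ := is_derive_quad (x := w) (v := e_ k) sA (is_derive_cst (A c u) w (e_ k))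
  (is_derive_id w (e_ k)).
have H := is_deriveB (is_deriveZ (2^-1 : R) HQ) (is_derive_cst (V0 (chart_inv c u)) w (e_ k)).
have E : lagrangian A V0 c u = (fun y => 2^-1 * quad (A c u) y) - cst (V0 (chart_inv c u)).
  by apply/funext => y; rewrite /lagrangian mulrC.
rewrite E; case: H => _ ->.
rewrite trmx_delta -colE [in LHS]mxE subr0 {1}/quad mulmx0 mul0mx.
by rewrite [X in X + _]mxE add0r /GRing.scale /= mulrA mulVf ?mul1r.
Qed.


Lemma lagrangian_position c u w k : img c u ->
  'D_(e_ k) (fun y => lagrangian A V0 c y w) u =
  quad ('D_(e_ k) (A c) u) w / 2 - 'D_(e_ k) (V0 \o chart_inv c) u.
Proof.
move=> cu; have sA := Defs.metric_sym hA cu.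
have dA := derivableP (@diff_derivable _ _ _ _ u (e_ k) (metric_diff hA cu)).
have dV := derivableP (@diff_derivable _ _ _ _ u (e_ k) (smooth_diff hV cu)).
have HQ := is_derive_quad sA dA (is_derive_cst w u (e_ k)).
have H := is_deriveB (is_deriveZ (2^-1 : R) HQ) dV.
have E : (fun y => lagrangian A V0 c y w) =
    (fun y => 2^-1 * quad (A c y) w) - (V0 \o chart_inv c).
  by apply/funext => y; rewrite /lagrangian mulrC.
apply: (etrans (congr1 (fun g => 'D_(e_ k) g u) E)).
case: H => _ H2; apply: (etrans H2).
by rewrite trmx0 mulmx0 [X in _ + 2 * X]mxE mulr0 addr0 /GRing.scale /= mulrC.
Qed.

(** Back to the Euler-Lagrange form of the equations. *)
Lemma newton_lagrange (x : R -> M) (F t : R) : continuous x ->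
  solves A V0 f x F t -> particle_equation A V0 f x F t.
Proof.
move=> cx Hx c ct /=; have [du dp] := Hx c ct.
have dv := velocity_derivable hA (cx t) ct (Hx c ct).
split=> // k.
have Dp : is_derive t 1 (fun s => 'D_(e_ k) (lagrangian A V0 c ((chart_map c \o x) s))
    (velocity c x s)) (law A V0 f c (chart_map c (x t)) (velocity c x t) F 0 k).
  apply: (@near_eq_is_derive _ _ _ (fun s => momentum A c x s 0 k)).
    apply: filterS (near_dom (cx t) ct) => s cs; apply/esym.
    exact: lagrangian_momentum (img_map cs).
  exact: (is_derive_mx _ _ _ _).1 dp 0 k.
case: (Dp) => D1 D2; split; first exact: D1.
rewrite derive1E; apply: (etrans (congr2 (fun a b => a - b) D2
  (lagrangian_position (velocity c x t) k (img_map ct)))).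
by rewrite [law _ _ _ _ _ _ _ 0 k]mxE addrAC subrr add0r.
Qed.


Variables rho kappa xi0 dxi0 : R -> R.
Hypothesis hO : oscillators rho kappa xi0 dxi0.
Local Notation mu := (@lebesgue_measure R).
Local Notation intg f := (mu.-integrable [set: R] (fun nu : R => (f nu)%:E)).
Local Notation pos_of := (osc_pos rho kappa xi0 dxi0).
Local Notation vel_of := (osc_vel rho kappa xi0 dxi0).
Local Notation total := (total_energy A V0 f rho kappa xi0 dxi0).

Section Motion.
Variable x : R -> M.
Hypothesis ex : evolves A V0 f rho kappa xi0 dxi0 x setT.
Let phi := f \o x.

Let cx : continuous x. Proof. by case: ex. Qed.
Let cphi : continuous phi. Proof. exact: interaction_continuous. Qed.

Lemma motion_velocity nu t : derive1 (pos_of phi nu) t = vel_of phi nu t.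
Proof. by rewrite derive1E; case: (osc_pos_derive rho kappa xi0 dxi0 cphi nu t). Qed.

Lemma motion_solution : solution A V0 f rho kappa x (pos_of phi).
Proof.
have vE nu : derive1 (pos_of phi nu) = vel_of phi nu.
  by apply/funext => t; exact: motion_velocity.
split.
- exact: cx.
- by move=> t; exact: force_int.
- by move=> t; apply: newton_lagrange; [exact: cx|exact: (ex.2 t)].
- move=> nu t; split; first by case: (osc_pos_derive rho kappa xi0 dxi0 cphi nu t).
  by rewrite vE; case: (osc_vel_derive rho kappa xi0 dxi0 cphi nu t).
- move=> nu H t.
  have -> : derive1n 2 (pos_of phi nu) t =
      - nu ^+ 2 * pos_of phi nu t + ratio rho kappa nu * phi t.
    rewrite /= vE derive1E.
    by case: (osc_vel_derive rho kappa xi0 dxi0 cphi nu t).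
  have rk : rho nu * ratio rho kappa nu = kappa nu.
    have [r0|r0] := eqVneq (rho nu) 0; last by rewrite /ratio mulrC divfK.
    by rewrite r0 mul0r; apply/esym; have [//|k0] := eqVneq (kappa nu) 0;
      case: H; split=> //; exact/eqP.
  by rewrite mulNr addrAC addNr add0r mulrA rk.
Qed.

Lemma motion_energy t c : chart_dom c (x t) ->
  energy A V0 f rho kappa c (chart_map c (x t)) (derive1 (chart_map c \o x) t)
    (fun nu => pos_of phi nu t) (fun nu => derive1 (pos_of phi nu) t) = (total x t)%:E.
Proof.
move=> ct; rewrite /energy /total_energy.
have -> : (fun nu => (rho nu * derive1 (pos_of phi nu) t ^+ 2)%:E) =
    (fun nu => (rho nu * vel_of phi nu t ^+ 2)%:E).
  by apply/funext => nu; rewrite motion_velocity.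
rewrite !EFin_Rintegral; [|exact: force_int|exact: pos_sq_int|exact: vel_sq_int].
rewrite chart_mapK // (kineticE hA (@cx t) ct (evolves_derivable ex (I : setT t) ct)).
rewrite field_energyE //.
rewrite -!EFinM.
rewrite -!EFinD -?EFinB; congr EFin.
rewrite /velocity /field_force -/phi.
by ring.
Qed.

Lemma motion_conserved t : total x t = total x 0.
Proof.
have sub I : evolves A V0 f rho kappa xi0 dxi0 x I.
  by split; [exact: cx|move=> s _; exact: (ex.2 s)].
have [t0|t0] := leP 0 t; first exact: (energy_conserved hA hV hf hO t0 (sub _)).
exact/esym/(energy_conserved hA hV hf hO (ltW t0) (sub _)).
Qed.

Lemma motion_oscillator_energy t :
  (\int[mu]_nu (rho nu * (nu ^+ 2 * pos_of phi nu t ^+ 2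
      + derive1 (pos_of phi nu) t ^+ 2))%:E)%E =
  (field_energy rho kappa xi0 dxi0 phi t)%:E.
Proof.
rewrite /field_energy -EFin_Rintegral; last exact: energy_int.
by apply: eq_integral => nu _; rewrite motion_velocity [X in rho nu * X]addrC.
Qed.

(** The lower bound [energy_ge], with twice the interaction, lets half of the
    oscillator energy absorb the interaction energy at the price of a multiple of
    [f ^+ 2]. *)
Lemma field_energy_le K b C t :
    \int[mu]_nu (rho nu * (ratio rho kappa nu / nu) ^+ 2) <= K ->
    (forall y, b <= V0 y - K * f y ^+ 2 / 2) -> `|f (x t)| <= C ->
  field_energy rho kappa xi0 dxi0 phi t <= 4 * (total x t - b + K * C ^+ 2).
Proof.
move=> hK Vmin fC; have := energy_ge hO t (2 * f (x t)) cphi.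
set I := \int[_]_nu _ in hK *; set H := field_energy _ _ _ _ _ _.
move=> E1; have k0 := kinetic_ge0 hA x t; have V1 := Vmin (x t).
rewrite /total_energy -/phi -/H; set F := field_force _ _ _ _ _ _ in E1 *.
set k := kinetic A x t in k0 *; set y := f (x t) in fC V1 E1 *.
have I0 : 0 <= I.
  apply: Rintegral_ge0 => nu _.
  by apply: mulr_ge0; [exact: (osc_rho_ge0 hO)|exact: sqr_ge0].
have yC : y ^+ 2 <= C ^+ 2.
  by rewrite -(real_normK (num_real y)) lerXn2r // nnegrE // (le_trans _ fC).
have K0 : 0 <= K := le_trans I0 hK.
have KC : K * y ^+ 2 <= K * C ^+ 2 by rewrite ler_wpM2l.
have IK : y ^+ 2 * I <= y ^+ 2 * K by rewrite ler_wpM2l // sqr_ge0.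
have E2 : - (2 * (y ^+ 2 * I)) <= H / 2 - 2 * (y * F).
  have e1 : (2 * y) ^+ 2 / 2 * I = 2 * (y ^+ 2 * I) by field.
  by rewrite -e1 [_ * (y * F)]mulrA.
have KC0 : 0 <= K * C ^+ 2 by rewrite mulr_ge0 // sqr_ge0.
by move: E2 V1 KC IK k0 KC0; set z := y * F; lra.
Qed.

End Motion.

End Conclusions.

(** * Global solutions with constant energy *)

Unset Implicit Arguments.

(* The initial velocity is the tangent vector at [x0] whose coordinates in the
   chart [c0] around [x0] are [v0]. *)
Theorem theorem1 (R : realType) (m : nat) (M : manifold R m)
    (A : chart M -> 'rV[R]_m -> 'M[R]_m) (V0 f : M -> R)
    (rho kappa xi0 dxi0 : R -> R)
    (x0 : M) (c0 : chart M) (v0 : 'rV[R]_m)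
    (x0_dom : chart_dom c0 x0)
    (rho_meas : measurable_fun [set: R] rho)
    (kappa_meas : measurable_fun [set: R] kappa)
    (xi0_meas : measurable_fun [set: R] xi0)
    (dxi0_meas : measurable_fun [set: R] dxi0)
    (A_riemannian : riemannian A) (V0_smooth : smooth_fun V0)
    (f_smooth : smooth_fun f)
    (rho_ge0 : forall nu, 0 <= rho nu)
    (supp_kappa : supp kappa `<=` supp rho)
    (int_kappa2_rho :
      (\int[@lebesgue_measure R]_nu kappa2_rho rho kappa nu < +oo)%E)
    (int_kappa2_rho_nu2 :
      (\int[@lebesgue_measure R]_nu kappa2_rho_nu2 rho kappa nu < +oo)%E)
    (V_bounded_below :
      exists b : R, forall x, b <= effective_potential V0 f rho kappa x)
    (f_bounded_or_V_coercive :
      (exists C : R, forall x, `|f x| <= C) \/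
      (forall C : R, exists N : R, forall x,
         N <= `|f x| -> C <= effective_potential V0 f rho kappa x))
    (V_sublevel_compact : forall E : R,
      compact [set x | effective_potential V0 f rho kappa x <= E])
    (init_energy : (\int[@lebesgue_measure R]_nu
       (rho nu * (dxi0 nu ^+ 2 + nu ^+ 2 * xi0 nu ^+ 2))%:E < +oo)%E) :
  exists (x : R -> M) (xi : R -> R -> R),
    solution A V0 f rho kappa x xi /\
    [/\ x 0 = x0, forall nu, xi nu 0 = xi0 nu,
        derive1 (chart_map c0 \o x) 0 = v0 &
        forall nu, derive1 (xi nu) 0 = dxi0 nu] /\
    (forall t,
      (@lebesgue_measure R).-integrable [set: R]
        (fun nu => (rho nu * derive1 (xi nu) t ^+ 2)%:E) /\
      (@lebesgue_measure R).-integrable [set: R]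
        (fun nu => (rho nu * nu ^+ 2 * xi nu t ^+ 2)%:E)) /\
    (exists e : R, forall t (c : chart M), chart_dom c (x t) ->
      energy A V0 f rho kappa c (chart_map c (x t))
        (derive1 (chart_map c \o x) t)
        (fun nu => xi nu t) (fun nu => derive1 (xi nu) t) = e%:E) /\
    (exists C : R, forall t, `|f (x t)| <= C) /\
    (exists C : R, forall t,
      (\int[@lebesgue_measure R]_nu
        (rho nu * (nu ^+ 2 * xi nu t ^+ 2 + derive1 (xi nu) t ^+ 2))%:E
        <= C%:E)%E).
Proof.
have hO := finite_oscillators rho_meas kappa_meas xi0_meas dxi0_meas rho_ge0
  int_kappa2_rho int_kappa2_rho_nu2 init_energy.
have hK := coupling_ge rho_meas kappa_meas rho_ge0 int_kappa2_rho_nu2.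
have [b Vmin] := V_bounded_below.
have [x [ex x00 vx]] := global_motion A_riemannian V0_smooth f_smooth hK Vmin
  V_sublevel_compact v0 hO x0_dom.
have cx : continuous x by case: ex.
have cphi : continuous (f \o x) by exact: interaction_continuous.
pose tot := total_energy A V0 f rho kappa xi0 dxi0 x.
have consE t : tot t = tot 0 := motion_conserved A_riemannian V0_smooth f_smooth hO ex t.
have [C C0 HC] := interaction_bounded f_smooth V_sublevel_compact (tot 0).
have fC t : `|f (x t)| <= C.
  have tot_le : tot t <= tot 0 by rewrite consE.
  exact: HC (energy_bounds A_riemannian f_smooth hO hK Vmin cx tot_le).1.
have vE nu t : derive1 (osc_pos rho kappa xi0 dxi0 (f \o x) nu) t =
    osc_vel rho kappa xi0 dxi0 (f \o x) nu t := motion_velocity f_smooth ex nu t.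
exists x, (osc_pos rho kappa xi0 dxi0 (f \o x)); split.
  exact: motion_solution.
split.
  split=> //.
  - by move=> nu; exact: osc_pos0.
  - by move=> nu; rewrite vE; exact: osc_vel0.
split.
  move=> t; split; last exact: pos_sq_int.
  by under eq_fun do rewrite vE; exact: vel_sq_int.
split.
  by exists (tot 0) => t c ct; rewrite -(consE t); exact: motion_energy.
split; first by exists C.
exists (4 * (tot 0 - b + coupling_const rho kappa * C ^+ 2)) => t.
rewrite (motion_oscillator_energy f_smooth hO ex t) lee_fin -(consE t).
exact: (field_energy_le A_riemannian f_smooth hO ex hK Vmin (fC t)).
Qed.
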